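(* Let $\Theta=\sum_{k}\theta_k\delta_{\psi_k}$ be a gamma process on $\Psi$, i.e. a completely random measure with fixed-location atoms whose weights have densities $\mathrm{Gamma}(\theta\mid\xi_{fix,k}+1,\lambda_{fix,k})$, $k=1,\dots,K_{prior,fix}$, and with an ordinary component having weight rate measure $\nu(d\theta)=\gamma\,\theta^{\xi}e^{-\lambda\theta}\,d\theta$ on $\mathbb{R}_+$ and location distribution $G$, where $\gamma>0$, $\xi\in(-2,-1]$, $\lambda>0$, and $\xi_{fix,k}>-1$, $\lambda_{fix,k}>0$ for all $k$. Let $X_n$ be drawn, i.i.d. across $n$, conditional on $\Theta$ according to a Poisson likelihood process, i.e. $X_n=\sum_k x_{n,k}\delta_{\psi_k}$ with $x_{n,k}\sim\mathrm{Poisson}(\theta_k)$ independently across $n,k$ given $\Theta$. Then $X_{1:N}=(X_1,\dots,X_N)$ has the same distribution as the following construction. For each $n=1,2,\dots,N$: 1. Let $\{\psi_k\}_{k=1}^{K_{n-1}}$ be the union of the atom locations in $X_1,\dots,X_{n-1}$, and let $x_{m,k}:=X_m(\{\psi_k\})$. Let $x_{n,k}$ denote the weight of $X_n\mid X_1,\dots,X_{n-1}$ at $\psi_k$. Then, independently across $k$, $x_{n,k}$ has probability mass function $$h_{cond}(x_{n,k}=x\mid x_{1:(n-1),k})=\mathrm{NegBin}\left(x\,\middle|\,\xi+\sum_{m=1}^{n-1}x_{m,k}+1,\ (\lambda+n)^{-1}\right).$$ 2. For each $x=1,2,\dots$, $X_n$ has $\rho_{n,x}$ new atoms of weight $x$;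 that is, $X_n$ has atoms of weight $x$ at locations $\{\psi_{n,x,j}\}_{j=1}^{\rho_{n,x}}$, where $\{\psi_{n,x,j}\}_{j=1}^{\rho_{n,x}}\cap\{\psi_k\}_{k=1}^{K_{n-1}}=\emptyset$ a.s. Moreover, $$M_{n,x}:=\gamma\cdot\frac{1}{x!}\cdot\frac{\Gamma(\xi+x+1)}{(\lambda+n)^{\xi+x+1}},$$ $\rho_{n,x}\sim\mathrm{Poisson}(M_{n,x})$ independently across $n,x$, and $\psi_{n,x,j}\sim G$ independently across $n,x$ and i.i.d. across $j$, these being independent of each other and of the draws in step 1.
   Context: $\Psi$ is a measurable space whose $\sigma$-algebra contains all singletons; $\mathbb{R}_+$ denotes the non-negative reals. $\mathrm{Gamma}(a,b)$ is the gamma distribution with shape $a>0$ and rate $b>0$. A completely random measure (CRM) on $\Psi$ is a random measure taking independent values on disjoint measurable sets. The gamma process is the CRM that is the independent sum of (a) a fixed-location component $\sum_{k=1}^{K_{prior,fix}}\theta_{fix,k}\delta_{\psi_{fix,k}}$, $K_{prior,fix}<\infty$, with deterministic distinct locations and independent weights $\theta_{fix,k}\sim\mathrm{Gamma}(\xi_{fix,k}+1,\lambda_{fix,k})$; and (b) an ordinary component $\sum_k\theta_{ord,k}\delta_{\psi_{ord,k}}$, where $\{(\theta_{ord,k},\psi_{ord,k})\}$ are the points of a Poisson point process on $\mathbb{R}_+\times\Psi$ with rate (mean) measure $\gamma\theta^{\xi}e^{-\lambda\theta}d\theta\cdot G(d\psi)$, with $G$ a diffuse probability distribution on $\Psi$.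 $\Theta=\sum_k\theta_k\delta_{\psi_k}$ lists all fixed-location and ordinary atoms. $\mathrm{NegBin}(x\mid r,p)=\frac{\Gamma(r+x)}{x!\,\Gamma(r)}(1-p)^r p^x$ for $x=0,1,2,\dots$, $r>0$, $p\in(0,1)$. A weight $x_{n,k}=0$ means that $X_n$ has no atom at $\psi_k$. For $n=1$ there are no earlier atom locations ($K_0=0$). $x_{1:(n-1),k}$ means $(x_{1,k},\dots,x_{n-1,k})$.
   Formalization: Step 1 also ranges over the prior fixed locations from n=1 on, with ξ_fix,k, λ_fix,k in place of ξ, λ (as displayed it fails for K_prior,fix>0); a.s. disjointness of new from earlier locations is claimed only when the diagonal of Ψ×Ψ is measurable, as it can fail otherwise. *)

(* Defs.v *)
From HB Require Import structures.
From mathcomp Require Import all_boot all_order all_algebra finmap.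
From mathcomp Require Import all_classical all_reals all_analysis.
From mathcomp Require Import measurable_realfun.

Set Implicit Arguments.
Unset Strict Implicit.
Unset Printing Implicit Defensive.

Import Order.TTheory GRing.Theory Num.Theory.
Import numFieldNormedType.Exports.

Local Open Scope classical_set_scope.
Local Open Scope ring_scope.

Section distributions.
Context {R : realType}.
Implicit Types (a b r p t : R) (x n : nat).

Definition Gamma_fun a : R :=
  \int[lebesgue_measure]_(t in `]0, +oo[) (t `^ (a - 1) * expR (- t)).

Definition gamma_pdf a b t : R :=
  b `^ a / Gamma_fun a * t `^ (a - 1) * expR (- (b * t)).

Definition gamma_law a b (A : set R) : \bar R :=
  (\int[lebesgue_measure]_(t in A `&` `]0%R, +oo[) (gamma_pdf a b t)%:E)%E.

(* The second argument of [poisson_prob] is a dummy.  The library's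
   [poisson_pmf] is not used: at rate 0 it is constantly 1, whereas
   [poisson_prob 0] is the Dirac mass at 0. *)
Definition poisson_mass r x : R := fine (poisson_prob r 0%N [set x]).

Definition negbin_pmf r p x : R :=
  Gamma_fun (r + x%:R) / (x`!%:R * Gamma_fun r) * (1 - p) `^ r * p ^+ x.

(* M_{n,x}, the integral of the Poisson(theta) mass at x against
   gam * theta^xi * e^(- (lam + n - 1) * theta) dtheta *)
Definition new_atom_mean (gam xi lam : R) n x : R :=
  gam * x`!%:R^-1 *
  (Gamma_fun (xi + x%:R + 1) / (lam + n%:R) `^ (xi + x%:R + 1)).

End distributions.

Section independence.
Context {d : measure_display} {T : measurableType d} {R : realType}.

Definition sigma_join (I : Type) (S : I -> set (set T)) : set (set T) :=
  <<s \bigcup_i S i >>.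

Definition mutually_independent (P : probability T R) (I : choiceType)
    (S : I -> set (set T)) : Prop :=
  forall (F : {fset I}) (E : I -> set T), (forall i, i \in F -> S i (E i)) ->
    P (\bigcap_(i in [set` F]) E i) = (\prod_(i <- F) fine (P (E i)))%:E.

End independence.

(* The measure \sum_i w_i \delta_{p_i} *)
Section atomic_measure.
Local Open Scope ereal_scope.
Context {d : measure_display} {T : measurableType d} {R : realType}
  {I : choiceType}.
Variables (w : I -> {nonneg R}) (p : I -> T).

Definition atomic_measure (A : set T) : \bar R :=
  \esum_(i in [set: I]) ((w i)%:num%:E * \d_(p i) A).

Let atomic_measure0 : atomic_measure set0 = 0.
Proof. by apply: esum1 => i _; rewrite measure0 mule0. Qed.

Let atomic_measure_ge0 A : 0 <= atomic_measure A.
Proof. by apply: esum_ge0 => i _; rewrite mule_ge0. Qed.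

Let atomic_measure_sigma_additive : semi_sigma_additive atomic_measure.
Proof.
have term_ge0 i A : 0 <= (w i)%:num%:E * \d_(p i) A by rewrite mule_ge0.
move=> F mF tF mUF; suff -> : atomic_measure (\bigcup_n F n) =
    lim ((fun n => \sum_(0 <= i < n) atomic_measure (F i)) @ \oo).
  by apply: is_cvg_ereal_nneg_natsum => k _; exact: atomic_measure_ge0.
have swap_bij : set_bij ([set: I] `*`` (fun=> [set: nat]))
    ([set: nat] `*`` (fun=> [set: I])) (fun x => (x.2, x.1)).
  split => //=; first by move=> [i j] [k l] _ _ /= [-> ->].
  by move=> [i j] _ /=; exists (j, i).
rewrite nneseries_esumT// /atomic_measure esum_esum// (reindex_esum _ _ _ _ swap_bij)/=.
rewrite -(@esum_esum _ _ _ _ (fun=> setT)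
  (fun i k => (w i)%:num%:E * \d_(p i) (F k)))//.
apply: eq_esum => i _; rewrite -nneseries_esumT// nneseriesZl//.
by congr (_ * _); exact: measure_semi_bigcup.
Qed.

HB.instance Definition _ := isMeasure.Build _ _ _ atomic_measure
  atomic_measure0 atomic_measure_ge0 atomic_measure_sigma_additive.

End atomic_measure.

Section poisson_process.
Context {d d' : measure_display} {Omega : measurableType d}
  {T : measurableType d'} {R : realType}.
Variables (P : probability Omega R) (pt : nat -> Omega -> T).

Definition point_count (w : Omega) : set T -> \bar R :=
  atomic_measure (fun=> 1%:nng : {nonneg R}) (pt ^~ w).

(* The points form a sequence indexed by all of [nat], which is the case of a
   Poisson process whose mean measure is infinite. *)
Definition poisson_process (mu : set T -> \bar R) : Prop :=
  [/\ forall k, measurable_fun setT (pt k),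
      forall A, measurable A -> (mu A < +oo)%E -> forall x : nat,
        P [set w | point_count w A = x%:R%:E]
          = (poisson_mass (fine (mu A)) x)%:E,
      forall A, measurable A -> mu A = +oo%E ->
        P [set w | point_count w A = +oo%E] = 1%E &
      forall (m : nat) (A : 'I_m -> set T), (forall i, measurable (A i)) ->
        trivIset setT A ->
        mutually_independent P
          (fun i => g_sigma_algebra_preimage (fun w => point_count w (A i)))].

Definition sigma_point_process : set (set Omega) :=
  sigma_join (fun A : {A : set T | measurable A} =>
    g_sigma_algebra_preimage (fun w => point_count w (sval A))).

End poisson_process.

Section gamma_process.
Context {d d' : measure_display} {Omega : measurableType d}
  {Psi : measurableType d'} {R : realType} {K : nat}.

(* Weights and locations of the atoms of a random measure with fixed-location
   atoms at deterministic locations [psifix k], and ordinary atoms. *)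
Record crm_atoms := CrmAtoms {
  fix_weight : 'I_K -> Omega -> {nonneg R} ;
  ord_weight : nat -> Omega -> {nonneg R} ;
  ord_loc : nat -> Omega -> Psi }.

Variables (P : probability Omega R) (psifix : 'I_K -> Psi) (a : crm_atoms).

Definition atom_weight (k : 'I_K + nat) (w : Omega) : {nonneg R} :=
  match k with inl k => fix_weight a k w | inr k => ord_weight a k w end.

Definition atom_loc (k : 'I_K + nat) (w : Omega) : Psi :=
  match k with inl k => psifix k | inr k => ord_loc a k w end.

Definition crm (w : Omega) : {measure set Psi -> \bar R} :=
  atomic_measure (atom_weight ^~ w) (atom_loc ^~ w).

Definition ord_point (k : nat) (w : Omega) : (R * Psi)%type :=
  ((ord_weight a k w)%:num, ord_loc a k w).

Definition fix_weight_num (k : 'I_K) (w : Omega) : R :=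
  (fix_weight a k w)%:num.

(* gam * theta^xi * e^(- lam * theta) dtheta * G(dpsi), theta > 0 *)
Definition gamma_rate (gam xi lam : R) (G : probability Psi R)
    (A : set (R * Psi)) : \bar R :=
  (\int[lebesgue_measure]_(t in `]0%R, +oo[)
     ((gam * t `^ xi * expR (- (lam * t)))%:E * G (xsection A t)))%E.

Definition is_gamma_process (gam xi lam : R) (G : probability Psi R)
    (xifix lamfix : 'I_K -> R) : Prop :=
  [/\ forall k, measurable_fun setT (fix_weight_num k),
      forall k (A : set R), measurable A ->
        P (fix_weight_num k @^-1` A)
          = gamma_law (xifix k + 1) (lamfix k) A,
      poisson_process P ord_point (gamma_rate gam xi lam G) &
      mutually_independent P (fun i : option 'I_K =>
        if i is Some k then g_sigma_algebra_preimage (fix_weight_num k)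
        else sigma_point_process (R := R) ord_point)].

Definition sigma_atoms : set (set Omega) :=
  sigma_join (fun i : 'I_K + nat => match i with
    | inl k => g_sigma_algebra_preimage (fix_weight_num k)
    | inr k => g_sigma_algebra_preimage (ord_point k)
    end).

(* x n k is the weight of X_{n+1} at the k-th atom: conditionally on the atoms
   of the random measure, the x n k are independent and Poisson(theta_k). *)
Definition poisson_likelihood (N : nat)
    (x : 'I_N -> 'I_K + nat -> {mfun Omega >-> nat}) : Prop :=
  forall (F : {fset 'I_N * ('I_K + nat)}) (v : 'I_N * ('I_K + nat) -> nat)
    (B : set Omega), sigma_atoms B ->
    P (B `&` \bigcap_(q in [set` F]) [set w | x q.1 q.2 w = v q]) =
    (\int[P]_(w in B)
      (\prod_(q <- F) poisson_mass (atom_weight q.2 w)%:num (v q))%:E)%E.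

Definition likelihood_process (N : nat)
    (x : 'I_N -> 'I_K + nat -> {mfun Omega >-> nat}) (n : 'I_N) (w : Omega) :
    {measure set Psi -> \bar R} :=
  atomic_measure (fun k => (x n k w)%:R%:nng) (atom_loc ^~ w).

End gamma_process.
Arguments crm_atoms {d d'} Omega Psi R K.

Section marginal_construction.
Context {d d' : measure_display} {Omega : measurableType d}
  {Psi : measurableType d'} {R : realType} {N K : nat}.

(* Rounds are numbered from 0: [n : 'I_N] is the round producing X_{n+1}.
   An atom is labelled by [inl k] (k-th prior fixed location) or by
   [inr (n, x, j)]: the j-th new atom of weight x+1 at round n.  Prior fixed
   locations count as existing at every round, with their own hyperparameters;
   for K = 0 the existing atoms are exactly those of the earlier rounds. *)
Definition atom_label : choiceType := ('I_K + 'I_N * nat * nat)%type.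

(* [new_count n x] : number of new atoms of weight x+1 at round n;
   [new_loc n x j] : location of the atom labelled [inr (n, x, j)];
   [cond_draw n i] : weight drawn at round n for the existing atom i; it is
   irrelevant when the label i does not denote an existing atom. *)
Record marginal_draws := MarginalDraws {
  new_count : 'I_N -> nat -> {mfun Omega >-> nat} ;
  new_loc : 'I_N -> nat -> nat -> {mfun Omega >-> Psi} ;
  cond_draw : 'I_N -> atom_label -> {mfun Omega >-> nat} }.

Variables (Q : probability Omega R) (psifix : 'I_K -> Psi)
  (s : marginal_draws).

Definition label_loc (i : atom_label) (w : Omega) : Psi :=
  match i with
  | inl k => psifix k
  | inr (n, x, j) => new_loc s n x j w
  end.

Definition is_label (i : atom_label) (w : Omega) : bool :=
  match i with
  | inl _ => true
  | inr (n, x, j) => (j < new_count s n x w)%N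
  end.

Definition existing (n : 'I_N) (i : atom_label) (w : Omega) : bool :=
  is_label i w && (if i is inr (m, _, _) then (m < n)%N else true).

Definition label_weight (n : 'I_N) (i : atom_label) (w : Omega) : nat :=
  if existing n i w then cond_draw s n i w
  else if i is inr (m, x, _) then
    if is_label i w && (m == n) then x.+1 else 0%N
  else 0%N.

Definition constructed_process (n : 'I_N) (w : Omega) :
    {measure set Psi -> \bar R} :=
  atomic_measure (fun i => (label_weight n i w)%:R%:nng) (label_loc ^~ w).

Definition past (n : 'I_N) : set (set Omega) :=
  <<s \bigcup_(m in [set m : 'I_N | (m < n)%N])
      ((\bigcup_x g_sigma_algebra_preimage (new_count s m x)) `|`
       (\bigcup_x \bigcup_j g_sigma_algebra_preimage (new_loc s m x j)) `|`
       (\bigcup_i g_sigma_algebra_preimage (label_weight m i))) >>.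

Definition new_draws (n : 'I_N) : set (set Omega) :=
  <<s (\bigcup_x g_sigma_algebra_preimage (new_count s n x)) `|`
      (\bigcup_x \bigcup_j g_sigma_algebra_preimage (new_loc s n x j)) >>.

Section laws.
Variables (gam xi lam : R) (G : probability Psi R) (xifix lamfix : 'I_K -> R).

Definition label_xi (i : atom_label) : R :=
  if i is inl k then xifix k else xi.

Definition label_lam (i : atom_label) : R :=
  if i is inl k then lamfix k else lam.

Definition h_cond (n : 'I_N) (i : atom_label) (w : Omega) (x : nat) : R :=
  negbin_pmf
    (label_xi i + (\sum_(m < N | (m < n)%N) label_weight m i w)%:R + 1)
    (label_lam i + n.+1%:R)^-1 x.

(* Conditionally on the past, the weights at the existing atoms are
   independent with mass functions h_cond, and independent of the new draws. *)
Definition step_one : Prop :=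
  forall (n : 'I_N) (F : {fset atom_label}) (v : atom_label -> nat)
    (B C : set Omega), past n B -> new_draws n C ->
    (forall w i, B w -> i \in F -> existing n i w) ->
    Q (B `&` C `&` \bigcap_(i in [set` F]) [set w | label_weight n i w = v i])
    = (Q C * \int[Q]_(w in B) (\prod_(i <- F) h_cond n i w (v i))%:E)%E.

Definition step_two : Prop :=
  [/\ forall n x (U : set nat), Q (new_count s n x @^-1` U)
        = poisson_prob (new_atom_mean gam xi lam n.+1 x.+1) 0%N U,
      forall n x j (A : set Psi), measurable A ->
        Q (new_loc s n x j @^-1` A) = G A &
      mutually_independent Q
        (fun i : ('I_N * nat + 'I_N * nat * nat)%type => match i with
          | inl (n, x) => g_sigma_algebra_preimage (new_count s n x)
          | inr (n, x, j) => g_sigma_algebra_preimage (new_loc s n x j)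
          end)].

End laws.
End marginal_construction.
Arguments marginal_draws {d d'} Omega Psi N K.

Section laws_of_random_measures.
Context {d' : measure_display} {Psi : measurableType d'} {R : realType}
  {N : nat}.

(* The sigma-algebra on N-tuples of measures generated by the evaluations *)
Definition measure_events :
    set (set ('I_N -> {measure set Psi -> \bar R})) :=
  <<s [set E | exists n (A : set Psi) (B : set (\bar R)),
        [/\ measurable A, measurable B &
          E = [set mu : 'I_N -> {measure set Psi -> \bar R} | B (mu n A)]]] >>.

Definition same_law {d1 d2 : measure_display} {Omega1 : measurableType d1}
    {Omega2 : measurableType d2}
    (P : probability Omega1 R) (Q : probability Omega2 R)
    (X : 'I_N -> Omega1 -> {measure set Psi -> \bar R})
    (Y : 'I_N -> Omega2 -> {measure set Psi -> \bar R}) : Prop :=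
  forall E, measure_events E ->
    P [set w | E (X ^~ w)] = Q [set w | E (Y ^~ w)].

Definition atom_locations (mu : {measure set Psi -> \bar R}) : set Psi :=
  [set p | mu [set p] != 0%E].

End laws_of_random_measures.

(* Main.v *)
Require Import Defs.
From HB Require Import structures.
From mathcomp Require Import all_boot all_order all_algebra finmap.
From mathcomp Require Import all_classical all_reals all_analysis.
From mathcomp Require Import measurable_realfun.
From mathcomp Require Import ring lra zify.

Set Implicit Arguments.
Unset Strict Implicit.
Unset Printing Implicit Defensive.

Import Order.TTheory GRing.Theory Num.Theory.
Import numFieldNormedType.Exports.
Import HBSimple HBNNSimple.

Local Open Scope classical_set_scope.
Local Open Scope ring_scope.

(** Random measures whose values are natural numbers or +oo have the same joint
law as soon as the Laplace functionals E exp(- sum_n X_n(sigma_n)) agree for all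
measurable sigma_n >= 0.  The proof computes this functional on both sides.

On the side of the gamma process, conditioning on the atoms turns the Poisson
counts of an atom of weight theta at p into the factor exp(- theta f(p)), where
f = sum_n (1 - exp(- sigma_n)) ([laplace_counts_given_atoms]).  What remains is
the Laplace functional of the gamma process itself at f: one gamma integral for
each fixed location, and the exponential of an integral against the rate measure
for the ordinary atoms ([gamma_process_laplace]).

On the side of the construction, call history of a label the vector of its
weights at the N rounds.  Given all the new counts and new locations, the
histories are independent across labels ([history_cond_law]).  Negative binomial
probabilities with updated parameters are the predictive probabilities of Poisson
counts whose rate theta is gamma distributed, so the law of a history is a mixture
over theta of products of Poisson laws ([history_prob_mixture]); its Laplace
transform is an integral over theta ([label_laplaceE]).  For a fixed location this
is the factor found above ([fixed_label_laplace]).  The new atoms of weight x at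
round m are a Poisson number of independent locations with law G, hence contribute
a compound Poisson factor ([compound_poisson_laplace]).  The exponents of these
factors add up to the exponent of the ordinary component ([new_atom_exponentE]):
under the integral over theta and p, the term of (m, x) is the loss caused by an
atom first seen at round m with weight x, and the sum over m telescopes to
1 - exp(- theta f(p)) ([esum_step_loss]).

Equality of the Laplace functionals gives equality of the laws of the vectors
(X_n1(A_1), ..., X_nr(A_r)): as functions of exp(- c), the Laplace transforms are
power series, and their coefficients are compared one coordinate at a time
([joint_laplace_determines_law]).  A pi-system argument extends this to all events
([laplace_functional_same_law]).

Finally, independent locations with a diffuse law almost surely differ from each
other and from the fixed locations ([ae_distinct_locations]), so that no two labels
share a location. *)

(** * The exponential of minus an extended real *)

Section expN.
Context {R : realType}.
Local Open Scope ereal_scope.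
Implicit Types x y : \bar R.

(** Weights may add up to +oo, where the value is 0; this keeps Laplace functionals
multiplicative without any summability condition. *)
Definition expN y : \bar R := expeR (- y).

Lemma expN0 : expN 0 = 1.
Proof. by rewrite /expN oppe0 expeR0. Qed.

Lemma expN_ge0 y : 0 <= expN y. Proof. exact: expeR_ge0. Qed.

Lemma expN_le1 y : 0 <= y -> expN y <= 1.
Proof. by move=> y0; rewrite -expN0 lee_expeR leeN2. Qed.

Lemma expN_EFin (r : R) : expN r%:E = (expR (- r))%:E.
Proof. by []. Qed.

Lemma expND x y : 0 <= x -> 0 <= y -> expN (x + y) = expN x * expN y.
Proof.
move=> x0 y0; rewrite /expN oppeD ?expeRD//.
by rewrite ge0_adde_def // inE.
Qed.

Lemma expN_sum I (s : seq I) (P : pred I) (f : I -> \bar R) :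
  (forall i, 0 <= f i) ->
  expN (\sum_(i <- s | P i) f i) = \prod_(i <- s | P i) expN (f i).
Proof.
move=> f0; elim: s => [|i s ih]; first by rewrite !big_nil expN0.
by rewrite !big_cons; case: ifP => // _; rewrite expND ?sume_ge0// ih.
Qed.

Lemma measurable_expN : measurable_fun setT expN.
Proof.
have -> : expN = (fun y => if y == +oo then 0 else
    if y == -oo then +oo else (expR (- fine y))%:E).
  by apply/funext => -[r| |].
apply: measurable_fun_ifT => //.
  by apply: (measurable_fun_bool true); rewrite setTI (_ : _ @^-1` _ = [set +oo])//;
     apply/seteqP; split => x /= /eqP.
apply: measurable_fun_ifT => //.
  by apply: (measurable_fun_bool true); rewrite setTI (_ : _ @^-1` _ = [set -oo])//;
     apply/seteqP; split => x /= /eqP.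
apply/measurable_EFinP; apply: measurableT_comp => //.
by apply: measurableT_comp => //; exact: fine_measurable.
Qed.

Lemma cvg_expN (u : nat -> \bar R) (y : \bar R) : (forall n, 0 <= u n) ->
  u n @[n --> \oo] --> y -> expN (u n) @[n --> \oo] --> expN y.
Proof.
move=> u0; case: y => [r| |].
- move=> /fine_cvgP[fu cu]; apply/fine_cvgP; split.
    by near=> n; have /fineK <- : u n \is a fin_num by near: n.
  apply: (@cvg_trans _ ((expR (- fine (u n))) @[n --> \oo])).
    apply: near_eq_cvg; near=> n => /=.
    by have /fineK <- : u n \is a fin_num by near: n.
  apply: continuous_cvg; first exact: continuous_expR.
  by apply: cvgN.
- move=> /cvgeyPge cu; rewrite [expN +oo](_ : _ = 0%:E)//; apply/fine_cvgP; split.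
    near=> n; rewrite ge0_fin_numE ?expN_ge0// (le_lt_trans (expN_le1 (u0 n)))//.
    exact: ltry.
  apply/cvgr0Pnorm_le => e e0; near=> n.
  have un : (- ln e)%:E <= u n by near: n; exact: cu.
  rewrite ger0_norm ?fine_ge0 ?expN_ge0// -lee_fin fineK; last first.
    by rewrite ge0_fin_numE ?expN_ge0// (le_lt_trans (expN_le1 (u0 n)))// ltry.
  rewrite -[e in leRHS]lnK// -[ln e]opprK -expN_EFin.
  by rewrite lee_expeR leeN2.
- move=> cu; have : 0 <= -oo :> \bar R by apply: (cvge_ge _ cu) => //; exact: nearW.
  by [].
Unshelve. all: by end_near. Qed.

End expN.

Lemma measurable_expN_comp {R : realType} d (T : measurableType d)
    (y : T -> \bar R) :
  measurable_fun setT y -> measurable_fun setT (expN \o y).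
Proof. by apply: measurableT_comp; exact: measurable_expN. Qed.

(** The integrands are bounded by 1, so dominated convergence applies to any
pointwise limit of exponents. *)
Lemma cvg_expN_integral {R : realType} d (T : measurableType d)
    (P : probability T R) (u : nat -> T -> \bar R) (y : T -> \bar R) :
  (forall n, measurable_fun setT (u n)) -> (forall n w, 0 <= u n w)%E ->
  (forall w, u n w @[n --> \oo] --> y w) ->
  (\int[P]_w expN (u n w) @[n --> \oo] --> \int[P]_w expN (y w))%E.
Proof.
move=> mu u0 cu.
have my : measurable_fun setT y by apply: (emeasurable_fun_cvg u).
have [] := @dominated_convergence _ _ _ P setT measurableT
  (fun n => expN \o u n) (expN \o y) (cst 1%E).
- by move=> n; apply: measurable_expN_comp.
- exact: measurable_expN_comp.
- by apply: aeW => w _; apply: cvg_expN.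
- exact: finite_measure_integrable_cst.
- by apply: aeW => w n _ /=; rewrite gee0_abs ?expN_ge0 ?expN_le1.
by move=> _ _.
Qed.

(** Partial sums over this list are those of the series indexed by [pickle], so they
converge to the sum over [I]. *)
Definition enum_upto (I : countType) (r : nat) : seq I :=
  pmap (@pickle_inv I) (iota 0 r).

Lemma enum_upto_uniq (I : countType) r : uniq (enum_upto I r).
Proof. by apply: pmap_uniq (iota_uniq 0 r); exact: pickle_invK. Qed.

Lemma sum_enum_upto {R : realType} (I : countType) (a : I -> \bar R) r :
  (\sum_(i <- enum_upto I r) a i =
   \sum_(0 <= n < r) oapp a 0 (pickle_inv n))%E.
Proof. by rewrite big_pmap /index_iota subn0. Qed.

Lemma esum_pickle {R : realType} (I : countType) (a : I -> \bar R) :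
  (forall i, 0 <= a i)%E ->
  (\esum_(i in [set: I]) a i = \sum_(n <oo) oapp a 0 (pickle_inv n))%E.
Proof.
move=> a0; rewrite nneseries_esumT; last by move=> n; case: pickle_inv => /=.
rewrite [RHS](_ : _ = \esum_(n in range (@choice.pickle I))
    oapp a 0%E (pickle_inv n)); last first.
  rewrite [RHS]esum_mkcond; apply: eq_esum => n _; case: ifPn => // /negP nr.
  have := @pickle_invK I n; case: pickle_inv => //= i iE.
  by exfalso; apply: nr; rewrite inE; exists i.
rewrite esum_image; last by move=> x y _ _ /(pcan_inj choice.pickleK).
by apply: eq_esum => i _; rewrite pickleK_inv.
Qed.

Lemma cvg_sum_enum_upto {R : realType} (I : countType) (a : I -> \bar R) :
  (forall i, 0 <= a i)%E ->
  (\sum_(i <- enum_upto I r) a i @[r --> \oo] --> \esum_(i in [set: I]) a i)%E.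
Proof.
move=> a0; rewrite esum_pickle//; under eq_fun do rewrite sum_enum_upto.
by apply: is_cvg_nneseries => n _ _; case: pickle_inv => /=.
Qed.

(** * Integrals, countable sums and independence *)

Lemma integral_mul_indic {R : realType} d (T : measurableType d)
    (m : {measure set T -> \bar R}) (A : set T) (h : T -> \bar R) :
  (\int[m]_x ((\1_A x)%:E * h x) = \int[m]_(x in A) h x)%E.
Proof.
rewrite [RHS]integral_mkcond epatch_indic; apply: eq_integral => x _.
by rewrite muleC.
Qed.

Lemma integral_simple_comp_mul {R : realType} d d' (T : measurableType d)
    (T' : measurableType d') (m : {measure set T -> \bar R}) (h : T -> \bar R)
    (f : T -> T') (phi : {nnsfun T' >-> R}) :
  measurable_fun setT h -> (forall x, 0 <= h x)%E -> measurable_fun setT f ->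
  (\int[m]_x ((phi (f x))%:E * h x) =
   \sum_(y \in range phi) y%:E * \int[m]_(x in f @^-1` (phi @^-1` [set y])) h x)%E.
Proof.
move=> mh h0 mf.
have mfy y : measurable (f @^-1` (phi @^-1` [set y])).
  by rewrite -[X in measurable X]setTI; exact: mf.
have ge0 y x : (0 <= y%:E * (\1_(f @^-1` (phi @^-1` [set y])) x)%:E * h x)%E.
  by apply: mule_ge0 => //; exact: (nnfun_muleindic_ge0 phi y (f x)).
transitivity (\int[m]_x \sum_(y \in range phi)
    (y%:E * (\1_(f @^-1` (phi @^-1` [set y])) x)%:E * h x))%E.
  apply: eq_integral => x _; rewrite fimfunE -fsumEFin// ge0_mule_fsuml//.
  move=> y; exact: (nnfun_muleindic_ge0 phi y (f x)).
rewrite ge0_integral_fsum//; last first.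
  move=> y; apply: emeasurable_funM => //; apply/measurable_EFinP.
  by apply: measurable_funM => //; exact: measurable_indic.
apply: eq_fsbigr => y; rewrite inE => -[z _ <-].
under eq_integral do rewrite -muleA.
rewrite ge0_integralZl//.
- by rewrite integral_mul_indic.
- apply: emeasurable_funM => //; apply/measurable_EFinP.
  exact: measurable_indic.
- by move=> x _; rewrite mule_ge0.
by rewrite lee_fin.
Qed.

(** Two weighted measures that agree on a sub-sigma-algebra integrate alike the
functions measurable for it.  With [h1] an indicator and [h2] a conditional
probability, this is the defining property of conditional expectation extended
from events to functions; with [S] all measurable sets it is integration against
a density. *)
Lemma ge0_integral_sub_sigma {R : realType} d (T : measurableType d)
    (S : set (set T)) (m1 m2 : {measure set T -> \bar R})
    (h1 h2 f : T -> \bar R) :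
  S `<=` measurable ->
  measurable_fun setT h1 -> (forall x, 0 <= h1 x)%E ->
  (forall x, h1 x \is a fin_num) ->
  measurable_fun setT h2 -> (forall x, 0 <= h2 x)%E ->
  (forall x, h2 x \is a fin_num) ->
  (forall E, S E -> \int[m1]_(x in E) h1 x = \int[m2]_(x in E) h2 x)%E ->
  (forall B, measurable B -> S (f @^-1` B)) -> (forall x, 0 <= f x)%E ->
  (\int[m1]_x (f x * h1 x) = \int[m2]_x (f x * h2 x))%E.
Proof.
move=> SM mh1 h10 fh1 mh2 h20 fh2 eqh Sf f0.
have mf : measurable_fun setT f by move=> _ B mB; rewrite setTI; exact/SM/Sf.
have mid : measurable_fun setT (maxe 0%E : \bar R -> \bar R).
  exact: measurable_maxe.
pose phi n := nnsfun_approx measurableT mid n.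
have cphi x : ((phi n (f x))%:E @[n --> \oo] --> f x)%E.
  rewrite -[X in _ --> X](max_r (f0 x)).
  apply: (@cvg_nnsfun_approx _ _ _ setT measurableT _ mid) => //.
  by move=> y _; rewrite le_max lexx.
have ndphi x : {homo (fun n => phi n x) : n m / (n <= m)%N >-> n <= m}.
  by move=> n m nm; exact/lefP/nd_nnsfun_approx.
have intE (m : {measure set T -> \bar R}) (h : T -> \bar R) :
    measurable_fun setT h -> (forall x, 0 <= h x)%E ->
    (forall x, h x \is a fin_num) ->
    (\int[m]_x (f x * h x) =
     limn (fun n => \int[m]_x ((phi n (f x))%:E * h x)))%E.
  move=> mh h0 fh; rewrite -monotone_convergence//.
  - apply: eq_integral => x _; apply/esym/cvg_lim => //.
    by apply: cvgeZr.
  - move=> n; apply: emeasurable_funM => //; apply/measurable_EFinP.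
    by apply: measurableT_comp mf => //; exact: measurable_funPT.
  - by move=> n x _; rewrite mule_ge0// lee_fin.
  - by move=> x _ n k nk; rewrite lee_wpmul2r// lee_fin ndphi.
rewrite !intE//; congr (limn _); apply/funext => n.
rewrite !integral_simple_comp_mul//; apply: eq_fsbigr => y _; congr (_ * _)%E.
apply: eqh; apply: Sf; rewrite -[X in measurable X]setTI; exact: measurable_funPT.
Qed.

Lemma expN_fin_num {R : realType} (y : \bar R) : (0 <= y)%E -> expN y \is a fin_num.
Proof.
move=> y0; rewrite ge0_fin_numE ?expN_ge0//.
by rewrite (le_lt_trans (expN_le1 y0))// ltry.
Qed.

Lemma ge0_integral_density {R : realType} d (T : measurableType d)
    (mu nu : {measure set T -> \bar R}) (D : set T) (w : T -> R)
    (f : T -> \bar R) :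
  measurable D -> measurable_fun setT w -> (forall x, D x -> 0 <= w x) ->
  (forall A, measurable A -> nu A = \int[mu]_(x in A `&` D) (w x)%:E)%E ->
  measurable_fun setT f -> (forall x, 0 <= f x)%E ->
  (\int[nu]_x f x = \int[mu]_(x in D) (f x * (w x)%:E))%E.
Proof.
move=> mD mw w0 nuE mf f0.
rewrite [RHS]integral_mkcond [LHS](_ : _ = \int[nu]_x (f x * cst 1 x))%E; last first.
  by under [RHS]eq_integral do rewrite mule1.
rewrite (@ge0_integral_sub_sigma _ _ _ measurable nu mu (cst 1%E)
  (fun x => (w x * \1_D x)%:E) f)//.
- apply: eq_integral => x _; rewrite epatch_indic/= EFinM muleA//.
- apply/measurable_EFinP; apply: measurable_funM => //.
- move=> x; rewrite lee_fin indicE; case: (boolP (x \in D)) => [xD|_].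
    by rewrite mulr1 w0//; exact/set_mem.
  by rewrite mulr0.
- move=> E mE; rewrite integral_cst// mul1e nuE//.
  rewrite integral_mkcondr; apply: eq_integral => x _.
  by rewrite epatch_indic/= EFinM.
by move=> B mB; rewrite -[X in measurable X]setTI; exact: mf.
Qed.

Lemma ge0_integral_esum_dom {R : realType} d (T : measurableType d) (V : countType)
    (m : {measure set T -> \bar R}) (D : set T) (f : V -> T -> \bar R) :
  measurable D ->
  (forall v, measurable_fun D (f v)) -> (forall v w, D w -> 0 <= f v w)%E ->
  (\int[m]_(w in D) (\esum_(v in [set: V]) f v w) =
   \esum_(v in [set: V]) \int[m]_(w in D) f v w)%E.
Proof.
move=> mD mf f0; rewrite esum_pickle; last by move=> v; apply: integral_ge0 => w; exact: f0.
under eq_integral => w /set_mem Dw do rewrite (esum_pickle (fun v => f0 v w Dw)).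
rewrite integral_nneseries//.
- apply: eq_eseriesr => n _; case: pickle_inv => //=.
  by rewrite integral0.
- by move=> n; case: pickle_inv => [v|] /=.
by move=> n w Dw; case: pickle_inv => [v|] //=; exact: f0.
Qed.

Lemma ge0_integral_esum {R : realType} d (T : measurableType d) (V : countType)
    (m : {measure set T -> \bar R}) (f : V -> T -> \bar R) :
  (forall v, measurable_fun setT (f v)) -> (forall v w, 0 <= f v w)%E ->
  (\int[m]_w (\esum_(v in [set: V]) f v w) =
   \esum_(v in [set: V]) \int[m]_w f v w)%E.
Proof. by move=> mf f0; exact: ge0_integral_esum_dom. Qed.

Lemma measurable_esum {R : realType} d (T : measurableType d) (V : countType)
    (f : V -> T -> \bar R) :
  (forall v, measurable_fun setT (f v)) -> (forall v w, 0 <= f v w)%E ->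
  measurable_fun setT (fun w => \esum_(v in [set: V]) f v w).
Proof.
move=> mf f0; under eq_fun do rewrite esum_pickle//.
apply: ge0_emeasurable_sum => [n w _ _|n _]; case: pickle_inv => //=.
Qed.

Lemma esum_indic_pred1 {R : realType} (V : choiceType) (a : V -> \bar R) (x : V) :
  (forall v, 0 <= a v)%E ->
  (\esum_(v in [set: V]) ((\1_[set v] x)%:E * a v) = a x)%E.
Proof.
move=> a0; rewrite -(esum_set1 (a0 x)) [RHS]esum_mkcond; apply: eq_esum => v _.
by rewrite indicE !in_set1 eq_sym; case: eqP => _; rewrite ?mul1e ?mul0e.
Qed.

Lemma ge0_esumZl {R : realType} (V : countType) (a : V -> \bar R) (k : R) :
  (forall v, 0 <= a v)%E -> 0 <= k ->
  (\esum_(v in [set: V]) (k%:E * a v) = k%:E * \esum_(v in [set: V]) a v)%E.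
Proof.
move=> a0 k0; rewrite !esum_pickle//; last first.
  by move=> v; rewrite mule_ge0.
rewrite -nneseriesZl//; last by move=> n _; case: pickle_inv => /=.
by apply: eq_eseriesr => n _; case: pickle_inv => //=; rewrite mule0.
Qed.

Lemma big_seq_fset_undup {R : Type} (idx : R) (op : Monoid.com_law idx)
    (I : choiceType) (t : seq I) (F : I -> R) : uniq t ->
  \big[op/idx]_(i <- [fset x in t]%fset) F i = \big[op/idx]_(i <- t) F i.
Proof.
move=> ut; apply/perm_big/uniq_perm => //.
by move=> i; rewrite !inE.
Qed.

Lemma integral_unit_interval {R : realType} d (T : measurableType d)
    (P : probability T R) (f : T -> R) :
  measurable_fun setT f -> (forall w, 0 <= f w <= 1) ->
  (0 <= \int[P]_w (f w)%:E <= 1)%E.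
Proof.
move=> mf f01; have f0 w : (0 <= (f w)%:E)%E by rewrite lee_fin; case/andP: (f01 w).
rewrite integral_ge0//= -(@probability_setT _ _ _ P) -[leRHS]mul1e -integral_cst//.
apply: ge0_le_integral => //; first exact/measurable_EFinP.
by move=> w _; rewrite lee_fin; case/andP: (f01 w).
Qed.

Section independence.
Context {R : realType} d (T : measurableType d) (P : probability T R).
Local Open Scope ereal_scope.

Lemma mutually_independent_seq (I : choiceType) (S : I -> set (set T))
    (t : seq I) (E : I -> set T) :
  mutually_independent P S -> uniq t -> (forall i, i \in t -> S i (E i)) ->
  P (\big[setI/setT]_(i <- t) E i) = (\prod_(i <- t) fine (P (E i)))%:E.
Proof.
move=> indS ut SE; have := indS [fset x in t]%fset E.
rewrite bigcap_fset !big_seq_fset_undup// => -> // i.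
by rewrite !inE; exact: SE.
Qed.

(** The factors leave the integral one at a time.  The induction carries events for
the indices already treated, and [ge0_integral_sub_sigma] replaces the event of
one index by a function of that index. *)
Lemma integral_prod_indep (I : choiceType) (S : I -> set (set T))
    (f : I -> T -> R) (s : seq I) :
  mutually_independent P S -> (forall i, S i `<=` measurable) ->
  (forall i (B : set R), measurable B -> S i (f i @^-1` B)) ->
  (forall i w, (0 <= f i w <= 1)%R) ->
  uniq s ->
  \int[P]_w (\prod_(i <- s) f i w)%:E = \prod_(i <- s) \int[P]_w (f i w)%:E.
Proof.
move=> indS SM Sf f01.
have f0 i w : (0 <= f i w)%R by case/andP: (f01 i w).
have f1 i w : (f i w <= 1)%R by case/andP: (f01 i w).
have mf i : measurable_fun setT (f i) by move=> _ B mB; rewrite setTI; exact/SM/Sf.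
have intf i : \int[P]_w (f i w)%:E \is a fin_num.
  have /andP[i0 i1] := integral_unit_interval P (mf i) (f01 i).
  by rewrite ge0_fin_numE// (le_lt_trans i1)// ltry.
suff claim (t : seq I) (E : I -> set T) : uniq (s ++ t) ->
    (forall j, j \in t -> S j (E j)) ->
    \int[P]_(w in \big[setI/setT]_(j <- t) E j) (\prod_(i <- s) f i w)%:E =
    (\prod_(i <- s) fine (\int[P]_w (f i w)%:E) *
     \prod_(j <- t) fine (P (E j)))%:E.
  move=> us; have := claim [::] (fun=> set0); rewrite cats0 !big_nil mulr1 => -> //.
  rewrite -prodEFin; apply: eq_bigr => i _; rewrite fineK//.
elim: s t E => [|i s ih] t E.
  rewrite cat0s => ut SE; rewrite big_nil mul1r -(mutually_independent_seq indS)//.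
  under eq_integral do rewrite big_nil.
  rewrite integral_cst ?mul1e//; rewrite big_seq; apply: bigsetI_measurable.
  by move=> j /SE/SM.
rewrite cat_cons/= mem_cat negb_or -andbA => /and3P[iNs iNt ust] SE.
have mEt : measurable (\big[setI/setT]_(j <- t) E j).
  by rewrite big_seq; apply: bigsetI_measurable => j /SE/SM.
set c := (\prod_(i <- s) fine (\int[P]_w (f i w)%:E) *
     \prod_(j <- t) fine (P (E j)))%R.
have c0 : (0 <= c)%R.
  rewrite mulr_ge0// prodr_ge0// => j _; rewrite fine_ge0//.
  by apply: integral_ge0 => w _; rewrite lee_fin.
have msf : measurable_fun setT (fun w => \prod_(i <- s) f i w)%R.
  by apply: measurable_prod => j _.
set h1 := fun w => (\1_(\big[setI/setT]_(j <- t) E j) w *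
  \prod_(i <- s) f i w)%R%:E.
have h10 w : 0 <= h1 w by rewrite lee_fin mulr_ge0// prodr_ge0.
have mh1 : measurable_fun setT h1.
  by apply/measurable_EFinP; apply: measurable_funM => //; exact: measurable_indic.
have h1E A : measurable A -> \int[P]_(w in A) h1 w =
    \int[P]_(w in A `&` \big[setI/setT]_(j <- t) E j) (\prod_(i <- s) f i w)%:E.
  move=> mA; rewrite [RHS]integral_mkcondr; apply: eq_integral => w _.
  by rewrite epatch_indic/= /h1 EFinM muleC.
have -> : \int[P]_(w in \big[setI/setT]_(j <- t) E j)
    (\prod_(i <- (i :: s)) f i w)%:E = \int[P]_w ((EFin \o f i) w * h1 w).
  rewrite integral_mkcond; apply: eq_integral => w _.
  by rewrite epatch_indic/= /h1 big_cons -!EFinM; congr EFin; ring.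
rewrite (@ge0_integral_sub_sigma _ _ _ (S i) P P h1 (cst c%:E) (EFin \o f i))//.
- under eq_integral do rewrite muleC.
  rewrite ge0_integralZl//; last 2 first.
    exact/measurable_EFinP.
    by move=> w _; rewrite lee_fin.
  rewrite big_cons (_ : \int[P]_x (EFin \o f i) x = (fine (\int[P]_w (f i w)%:E))%:E).
    by rewrite -EFinM /c; congr EFin; ring.
  by rewrite fineK.
- move=> A SA; have mA := SM i A SA; rewrite h1E ?integral_cst//.
  have := ih (i :: t) (fun j => if j == i then A else E j).
  rewrite !big_cons eqxx.
  have eqE j : j \in t -> (if j == i then A else E j) = E j.
    by move=> jt; case: eqP => // ji; rewrite -ji jt in iNt.
  rewrite (eq_big_seq E)// => ->.
  + rewrite [RHS](_ : _ = (c * fine (P A))%:E); last by rewrite EFinM fineK// fin_num_measure.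
    rewrite /c.
    rewrite [X in (_ * (_ * X))%R](_ : _ = \prod_(j <- t) fine (P (E j)))%R.
      by congr EFin; ring.
    by apply: eq_big_seq => j jt /=; rewrite eqE.
  + by rewrite uniq_catC/= mem_cat negb_or iNt iNs/= uniq_catC.
  + by move=> j; rewrite inE; case: eqP => [-> //|_] /= /SE.
- by move=> B mB; rewrite comp_preimage; apply: Sf; rewrite -[X in measurable X]setTI; exact:
  EFin_measurable.
- by move=> w /=; rewrite lee_fin.
Qed.
End independence.

(** * Integrating out conditionally independent variables *)

Lemma sigma_measurable_preimage d (T : measurableType d) d' (T' : measurableType d')
    (G : set (set T)) (f : T -> T') (B : set T') :
  measurable_fun setT (f : g_sigma_algebraType G -> T') ->
  measurable B -> <<s G >> (f @^-1` B).
Proof. by move=> mf mB; have := mf measurableT B mB; rewrite setTI. Qed.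

Lemma sigma_measurable_fun d (T : measurableType d) d' (T' : measurableType d')
    (G : set (set T)) (f : T -> T') :
  G `<=` measurable ->
  measurable_fun setT (f : g_sigma_algebraType G -> T') ->
  measurable_fun setT f.
Proof.
move=> GM mf _ B mB; rewrite setTI.
by apply: (smallest_sub (@sigma_algebra_measurable _ T) GM); exact: sigma_measurable_preimage.
Qed.

Section conditional_product.
Context {R : realType} d (T : measurableType d) (P : probability T R).
Local Open Scope ereal_scope.
Variables (G : set (set T)) (I V : countType).
Variables (xi : I -> T -> V) (p : I -> T -> V -> R) (c : I -> T -> V -> R)
  (u : I -> T -> \bar R).
Let TG := g_sigma_algebraType G.
Hypothesis GM : G `<=` measurable.
Hypothesis mxi : forall i v, measurable (xi i @^-1` [set v]).
Hypothesis mp : forall i v, measurable_fun setT (p i ^~ v : TG -> R).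
Hypothesis p0 : forall i w v, (0 <= p i w v)%R.
Hypothesis mc : forall i v, measurable_fun setT (c i ^~ v : TG -> R).
Hypothesis c0 : forall i w v, (0 <= c i w v)%R.
Hypothesis u0 : forall i w, 0 <= u i w.
Hypothesis mu : forall i, measurable_fun setT (u i).
Hypothesis cond_law : forall (s : seq I) (v : I -> V) (B : set T),
  uniq s -> <<s G >> B ->
  P (B `&` \big[setI/setT]_(i <- s) (xi i @^-1` [set v i])) =
  \int[P]_(w in B) (\prod_(i <- s) p i w (v i))%:E.
Hypothesis cond_laplace : forall i w,
  \esum_(v in [set: V]) (p i w v * expR (- c i w v))%:E = expN (u i w).

Let ind (t : seq I) (v : I -> V) : set T :=
  \big[setI/setT]_(j <- t) (xi j @^-1` [set v j]).

Let mind t v : measurable (ind t v).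
Proof. by apply: bigsetI_measurable. Qed.

Let Z i w : R := expR (- c i w (xi i w)).
Let U i w : R := fine (expN (u i w)).

Let Z0 i w : (0 <= Z i w)%R. Proof. exact: expR_ge0. Qed.
Let U0 i w : (0 <= U i w)%R. Proof. by rewrite fine_ge0// expN_ge0. Qed.

Let ZE i w : (Z i w)%:E =
  \esum_(v in [set: V]) ((\1_(xi i @^-1` [set v]) w * expR (- c i w v))%:E).
Proof.
have /(_ _)/esym := @esum_indic_pred1 R V (fun v => (expR (- c i w v))%:E) (xi i w).
by rewrite /Z => -> //; move=> v; rewrite lee_fin expR_ge0.
Qed.

Let mexpc i v : measurable_fun setT (fun w => expR (- c i w v) : R).
Proof.
apply: measurableT_comp => //; apply: measurableT_comp => //.
exact: (sigma_measurable_fun GM (mc i v)).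
Qed.

Let mexpcG i v : measurable_fun setT ((fun w => expR (- c i w v)) : TG -> R).
Proof. by apply: measurableT_comp => //; apply: measurableT_comp. Qed.

Let mpT i v : measurable_fun setT (p i ^~ v).
Proof. exact: (sigma_measurable_fun GM (mp i v)). Qed.

Let mZ i : measurable_fun setT (Z i).
Proof.
apply/measurable_EFinP.
rewrite (_ : EFin \o Z i = fun w => \esum_(v in [set: V])
  ((\1_(xi i @^-1` [set v]) w * expR (- c i w v))%:E)); last exact/funext/ZE.
apply: measurable_esum => [v|v w]; last by rewrite lee_fin mulr_ge0// expR_ge0.
apply/measurable_EFinP/measurable_funM => //; exact: measurable_indic.
Qed.

Let mU i : measurable_fun setT (U i).
Proof.
apply: measurableT_comp; first exact: fine_measurable.
exact: measurable_expN_comp.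
Qed.

Let claim (s t : seq I) (v : I -> V) (h : T -> R) :
  measurable_fun setT (h : TG -> R) -> (forall w, (0 <= h w)%R) ->
  uniq (s ++ t) ->
  \int[P]_w (h w * \1_(ind t v) w * \prod_(i <- s) Z i w)%:E =
  \int[P]_w (h w * \prod_(j <- t) p j w (v j) * \prod_(i <- s) U i w)%:E.
Proof.
have mTh (h' : T -> R) : measurable_fun setT (h' : TG -> R) -> measurable_fun setT h'.
  exact: (sigma_measurable_fun GM).
elim: s t v h => [|i s ih] t v h mh h0; first rewrite cat0s.
  move=> ut; under eq_integral do rewrite big_nil mulr1 EFinM.
  under [RHS]eq_integral do rewrite big_nil mulr1 EFinM.
  apply: (@ge0_integral_sub_sigma _ _ _ <<s G >> P P
    (EFin \o \1_(ind t v)) (fun w => (\prod_(j <- t) p j w (v j))%:E) (EFin \o h)).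
  - by apply: smallest_sub => //; exact: sigma_algebra_measurable.
  - by apply/measurable_EFinP/measurable_indic.
  - by move=> w /=; rewrite lee_fin.
  - by [].
  - by apply/measurable_EFinP; apply: measurable_prod => j _.
  - by move=> w; rewrite lee_fin prodr_ge0.
  - by [].
  - move=> B GB; rewrite -cond_law//.
    have mB : measurable B by apply: smallest_sub GB => //; exact: sigma_algebra_measurable.
    by rewrite integral_indic// setIC.
  - move=> B mB; rewrite comp_preimage; apply: sigma_measurable_preimage => //.
    by rewrite -[X in measurable X]setTI; exact: EFin_measurable.
  - by move=> w; rewrite lee_fin.
rewrite cat_cons/= mem_cat negb_or -andbA => /and3P[iNs iNt ust].
(* The value of xi_i is summed over: i moves from the costs to the events, with
   prescribed value x. *)
pose vx x j := if j == i then x else v j.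
have vxE x j : j \in t -> vx x j = v j.
  by rewrite /vx => jt; case: eqP => // ji; rewrite -ji jt in iNt.
have vxi x : vx x i = x by rewrite /vx eqxx.
have indE x w : (\1_(ind (i :: t) (vx x)) w = \1_(xi i @^-1` [set x]) w * \1_(ind t v) w :> R)%R.
  rewrite /ind big_cons indicI/= vxi; congr (_ * \1_(_) _)%R.
  by apply: eq_big_seq => j jt; rewrite vxE.
have h'0 x w : (0 <= h w * expR (- c i w x))%R by rewrite mulr_ge0// expR_ge0.
transitivity (\int[P]_w \esum_(x in [set: V])
  ((h w * expR (- c i w x)) * \1_(ind (i :: t) (vx x)) w * \prod_(j <- s) Z j w)%:E).
  apply: eq_integral => w _; rewrite big_cons.
  rewrite (_ : (_ * _)%:E = (h w * \1_(ind t v) w * \prod_(j <- s) Z j w)%:E * (Z i w)%:E);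
    last first.
    by rewrite -EFinM; congr EFin; ring.
  rewrite ZE -ge0_esumZl; last 2 first.
  - by move=> x; rewrite lee_fin mulr_ge0// expR_ge0.
  - by rewrite !mulr_ge0// prodr_ge0.
  by apply: eq_esum => x _; rewrite indE -EFinM; congr EFin; ring.
rewrite ge0_integral_esum; last 2 first.
- move=> x; apply/measurable_EFinP; apply: measurable_funM; last by apply: measurable_prod => j _.
  by apply: measurable_funM; [apply: measurable_funM => //; exact: mTh|exact: measurable_indic].
- by move=> x w; rewrite lee_fin !mulr_ge0// ?expR_ge0// prodr_ge0.
transitivity (\esum_(x in [set: V]) \int[P]_w
    (h w * expR (- c i w x) * \prod_(j <- i :: t) p j w (vx x j) * \prod_(i <- s) U i w)%:E).
  apply: eq_esum => x _; apply: ih => //.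
  - by apply: measurable_funM.
  - by rewrite uniq_catC/= mem_cat negb_or iNt iNs/= uniq_catC.
rewrite -ge0_integral_esum; last 2 first.
- move=> x; apply/measurable_EFinP; apply: measurable_funM; last by apply: measurable_prod => j _.
  by apply: measurable_funM; [apply: measurable_funM => //; exact: mTh|apply: measurable_prod
    => j _].
- by move=> x w; rewrite lee_fin !mulr_ge0// ?expR_ge0// prodr_ge0.
apply: eq_integral => w _; rewrite big_cons.
rewrite [RHS](_ : _ = (h w * \prod_(j <- t) p j w (v j) * \prod_(j <- s) U j w)%:E * (U i
  w)%:E); last first.
  by rewrite -EFinM; congr EFin; ring.
rewrite [(U i w)%:E]fineK ?expN_fin_num// -cond_laplace -ge0_esumZl; last 2 first.
- by move=> x; rewrite lee_fin mulr_ge0// expR_ge0.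
- by rewrite !mulr_ge0// prodr_ge0.
apply: eq_esum => x _; rewrite -EFinM big_cons vxi.
rewrite [in LHS](eq_big_seq (fun j => p j w (v j))); last by move=> j jt; rewrite vxE.
by congr EFin; ring.
Qed.

(** A Fubini argument for a countable family [xi] which is conditionally independent
given [G], with conditional mass functions [p]: the Laplace functional of the
costs [c] is the integral of the product of the conditional Laplace transforms
[expN (u i w)]. *)
Lemma laplace_conditional_product :
  \int[P]_w expN (\esum_(i in [set: I]) (c i w (xi i w))%:E) =
  \int[P]_w expN (\esum_(i in [set: I]) u i w).
Proof.
have mcxi i : measurable_fun setT (fun w => c i w (xi i w)).
  rewrite (_ : (fun w => _) = fun w => (- ln (Z i w))%R); last first.
    by apply/funext => w; rewrite /Z expRK opprK.
  by apply: measurableT_comp => //; apply: measurableT_comp.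
have L := @cvg_expN_integral _ _ _ P
  (fun r w => \sum_(i <- enum_upto I r) (c i w (xi i w))%:E)
  (fun w => \esum_(i in [set: I]) (c i w (xi i w))%:E).
have L' := @cvg_expN_integral _ _ _ P
  (fun r w => \sum_(i <- enum_upto I r) (u i w))
  (fun w => \esum_(i in [set: I]) u i w).
apply: (cvg_unique _ (L _ _ _) _) => //.
- move=> r; apply: emeasurable_sum => i; exact/measurable_EFinP.
- by move=> r w; apply: sume_ge0 => i _; rewrite lee_fin.
- by move=> w; apply: cvg_sum_enum_upto => i; rewrite lee_fin.
rewrite (_ : (fun r => _) = fun r => \int[P]_w expN (\sum_(i <- enum_upto I r) (u i w))).
  apply: L' => //.
  - by move=> r; apply: emeasurable_sum.
  - by move=> r w; apply: sume_ge0.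
  - by move=> w; apply: cvg_sum_enum_upto.
apply/funext => r.
have := claim (s := enum_upto I r) (t := [::]) (fun i => xi i point) (h := fun=> 1%R).
rewrite cats0 => /(_ _ _ (enum_upto_uniq _ _)) E.
transitivity (\int[P]_w (1 * \1_(ind [::] (fun i => xi i point)) w * \prod_(i <- enum_upto I r)
  Z i w)%:E).
  apply: eq_integral => w _; rewrite expN_sum; last by move=> i; rewrite lee_fin.
  rewrite /ind big_nil indicE in_setT !mul1r -prodEFin.
  by apply: eq_bigr => i _.
rewrite E//; apply: eq_integral => w _; rewrite expN_sum// big_nil !mul1r -prodEFin.
by apply: eq_bigr => i _; rewrite /U fineK// expN_fin_num.
Qed.

End conditional_product.

(** * Poisson laws and Poisson processes *)

Section poisson_law.
Context {R : realType}.
Implicit Types (r c : R) (x : nat).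

Lemma poisson_massE r x : 0 <= r ->
  poisson_mass r x = r ^+ x * x`!%:R^-1 * expR (- r).
Proof.
rewrite le_eqVlt => /predU1P[<-|r0]; rewrite /poisson_mass /poisson_prob.
  rewrite ltxx diracE oppr0 expR0 mulr1; case: x => [|x].
    by rewrite mem_set// expr0 fact0 invr1 mulr1.
  by rewrite memNset//= exprS !mul0r.
rewrite r0 esum_set1/= ?lee_fin ?poisson_pmf_ge0//.
by rewrite /poisson_pmf r0.
Qed.

Lemma poisson_mass_ge0 r x : 0 <= poisson_mass r x.
Proof. by rewrite fine_ge0. Qed.

Lemma poisson_probE r x : poisson_prob r 0 [set x] = (poisson_mass r x)%:E.
Proof. by rewrite /poisson_mass fineK// fin_num_measure. Qed.

Lemma esum_poisson_mass r : 0 <= r ->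
  (\esum_(x in [set: nat]) (poisson_mass r x)%:E = 1)%E.
Proof.
rewrite le_eqVlt => /predU1P[<-|r0].
  transitivity (\esum_(x in [set: nat]) ((\1_[set x] 0%N)%:E * cst (1 : \bar R) x)%E).
    apply: eq_esum => x _; rewrite -poisson_probE /poisson_prob ltxx mule1.
    by rewrite diracE indicE.
  by rewrite esum_indic_pred1.
have := @probability_setT _ _ _ (poisson_prob r 0 : probability nat R).
rewrite /= /poisson_prob r0 => <-.
by apply: eq_esum => x _; rewrite poisson_massE ?ltW// /poisson_pmf r0 -mulrA.
Qed.

(** Multiplying the terms by [q ^+ x] changes the rate from [r] to [r * q], up to a
constant; Poisson masses sum to 1. *)
Lemma poisson_pgf r q : 0 <= r -> 0 <= q ->
  (\esum_(x in [set: nat]) (poisson_mass r x * q ^+ x)%:E =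
   (expR (- (r * (1 - q))))%:E)%E.
Proof.
move=> r0 q0; have rq0 : 0 <= r * q by rewrite mulr_ge0.
transitivity (\esum_(x in [set: nat])
    ((expR (- (r * (1 - q))))%:E * (poisson_mass (r * q) x)%:E)%E).
  apply: eq_esum => x _; rewrite -EFinM; congr EFin.
  rewrite !poisson_massE// exprMn.
  have -> : - (r * (1 - q)) = r * q + - r by ring.
  rewrite expRD !expRN.
  by field; rewrite ?gt_eqF ?expR_gt0 ?ltr0n ?fact_gt0.
rewrite ge0_esumZl; last 2 first.
- by move=> x; rewrite lee_fin poisson_mass_ge0.
- by rewrite expR_ge0.
by rewrite esum_poisson_mass// mule1.
Qed.

Lemma poisson_laplace r c : 0 <= r ->
  (\esum_(x in [set: nat]) (poisson_mass r x * expR (- (c * x%:R)))%:E =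
   (expR (- (r * (1 - expR (- c)))))%:E)%E.
Proof.
move=> r0; rewrite -poisson_pgf ?expR_ge0//; apply: eq_esum => x _.
by rewrite -mulNr expRM_natr.
Qed.

(** A variable with Poisson masses at the natural numbers takes other values with
probability 0, since these masses already sum to 1. *)
Lemma poisson_ext_laplace d (T : measurableType d) (P : probability T R)
    (n : T -> \bar R) r c :
  measurable_fun setT n -> (forall w, 0 <= n w)%E -> 0 <= r -> 0 <= c ->
  (forall x, P [set w | n w = x%:R%:E] = (poisson_mass r x)%:E) ->
  (\int[P]_w expN (c%:E * n w) = (expR (- (r * (1 - expR (- c)))))%:E)%E.
Proof.
move=> mn n0 r0 c0 nP; pose A x := [set w | n w = x%:R%:E].
have mA x : measurable (A x).
  rewrite -[A x]setTI (_ : A x = n @^-1` [set x%:R%:E])//; exact: mn.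
pose B := \bigcup_x A x.
have mB : measurable B by exact: bigcupT_measurable.
have tA : trivIset setT A.
  apply/trivIsetP => i j _ _ ij; apply/seteqP; split => // w [].
  rewrite /A/= => -> [] /eqP; by rewrite eqr_nat (negbTE ij).
have PB : P B = 1%E.
  rewrite -(esum_poisson_mass r0) measure_bigcup//= nneseries_esum//.
  by rewrite set_mem_set; apply: eq_esum => x _; rewrite -nP.
rewrite -poisson_laplace//.
transitivity (\int[P]_w (\esum_(x in [set: nat]) (\1_(A x) w * expR (- (c * x%:R)))%:E))%E.
  apply: ge0_ae_eq_integral => //.
  - by apply: measurable_expN_comp; apply: emeasurable_funM.
  - apply: measurable_esum => x; last by move=> w; rewrite lee_fin mulr_ge0// expR_ge0.
    by apply/measurable_EFinP; apply: measurable_funM => //; exact: measurable_indic.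
  - by move=> w _; rewrite expN_ge0.
  - by move=> w _; apply: esum_ge0 => x _; rewrite lee_fin mulr_ge0// expR_ge0.
  exists (~` B); split; [exact: measurableC| |].
    by transitivity (1 - P B)%E; [exact: probability_setC|rewrite PB subee].
  move=> w /= /not_implyP[_ neq] [x _]; rewrite /A/= => nx; apply: neq.
  transitivity (\esum_(y in [set: nat]) ((\1_[set y] x)%:E * (expR (- (c * y%:R)))%:E)%E).
    rewrite (@esum_indic_pred1 _ _ (fun y => (expR (- (c * y%:R)))%:E)).
      by rewrite nx -EFinM.
    by move=> y; rewrite lee_fin expR_ge0.
  apply: eq_esum => y _; rewrite -EFinM; congr EFin; congr *%R.
  rewrite !indicE; congr (nat_of_bool _)%:R; apply/idP/idP; rewrite !inE.
    by move=> /= <-.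
  by rewrite /A /= nx => -[] /eqP; rewrite eqr_nat => /eqP.
rewrite ge0_integral_esum; last 2 first.
- move=> x; apply/measurable_EFinP; apply: measurable_funM => //; exact: measurable_indic.
- by move=> x w; rewrite lee_fin mulr_ge0// expR_ge0.
apply: eq_esum => x _; rewrite [RHS]EFinM -nP.
under eq_integral do rewrite mulrC EFinM.
rewrite ge0_integralZl; last 4 first.
- exact: measurableT.
- by apply/measurable_EFinP; exact: measurable_indic.
- by move=> w _; rewrite lee_fin.
- by rewrite lee_fin expR_ge0.
by rewrite integral_indic// setIT muleC.
Qed.

End poisson_law.

Lemma sum_indic_fibers {R : realType} (T : Type) (h : T -> R) (s : seq R)
    (phi : R -> R) (x : T) : uniq s -> h x \in s ->
  \sum_(y <- s) (phi y * \1_(h @^-1` [set y]) x) = phi (h x).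
Proof.
move=> us hs; rewrite (bigD1_seq (h x))//= big1 ?addr0 => [|y yh].
  by rewrite indicE mem_set// mulr1.
by rewrite indicE memNset ?mulr0// => hy; rewrite hy eqxx in yh.
Qed.

Lemma cvg_esum_nondecreasing {R : realType} (u : nat -> nat -> \bar R)
    (a : nat -> \bar R) :
  (forall n k, 0 <= u n k)%E ->
  (forall k, {homo u ^~ k : n m / (n <= m)%N >-> (n <= m)%E}) ->
  (forall k, u n k @[n --> \oo] --> a k) ->
  (\esum_(k in [set: nat]) u n k @[n --> \oo] --> \esum_(k in [set: nat]) a k).
Proof.
move=> u0 ndu cu.
have a0 k : (0 <= a k)%E by apply: (cvge_ge _ (cu k)); exact: nearW.
rewrite -nneseries_esumT// -ge0_integral_count//.
under eq_fun do rewrite -nneseries_esumT// -ge0_integral_count//.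
rewrite (_ : a = fun k => limn (u ^~ k)); last first.
  by apply/funext => k; apply/esym/cvg_lim.
by apply: cvg_monotone_convergence => // n k _; exact: ndu.
Qed.

Section poisson_process_laplace.
Context {R : realType} d d' (Omega : measurableType d) (T : measurableType d')
  (P : probability Omega R) (pt : nat -> Omega -> T)
  (mu : {measure set T -> \bar R}).
Local Open Scope ereal_scope.
Hypothesis ppp : poisson_process P pt mu.

Let mpt k : measurable_fun setT (pt k). Proof. by case: ppp. Qed.

Lemma point_countE w A : point_count pt w A = \esum_(k in [set: nat]) (\1_A (pt k w))%:E :> \bar R.
Proof. by apply: eq_esum => k _; rewrite mul1e diracE indicE. Qed.

Lemma measurable_point_count A : measurable A ->
  measurable_fun setT (fun w => point_count pt w A : \bar R).
Proof.
move=> mA; under eq_fun do rewrite point_countE.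
apply: measurable_esum => [k|k w]; last by rewrite lee_fin.
apply/measurable_EFinP; apply: measurableT_comp => //.
Qed.

Lemma esum_simple_point_count (h : {nnsfun T >-> R}) w :
  \esum_(k in [set: nat]) (h (pt k w))%:E =
  \sum_(y <- fset_set (range h)) y%:E * point_count pt w (h @^-1` [set y]).
Proof.
have hs x : h x \in fset_set (range h) by rewrite in_fset_set// inE; exists x.
rewrite [RHS]big_seq [RHS](_ : _ = \sum_(y <- fset_set (range h) | y \in fset_set (range h))
    \esum_(k in [set: nat]) (y%:E * (\1_(h @^-1` [set y]) (pt k w))%:E)); last first.
  apply: eq_bigr => y; rewrite in_fset_set// inE => -[x _ <-].
  by rewrite point_countE -ge0_esumZl.
rewrite -esum_sum; last first.
  move=> k y _; rewrite in_fset_set// inE => -[x _ <-].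
  by rewrite mule_ge0 ?lee_fin.
apply: eq_esum => k _; rewrite -big_seq -(@sum_indic_fibers _ _ h _ id _ _ (hs (pt k w)))//.
  by rewrite -sumEFin; apply: eq_bigr => y _; rewrite EFinM.
exact: fset_uniq.
Qed.

(** The fixed weights are independent of the counts of the ordinary points only, so
sums over the points have to be measurable for the sigma-algebra of the counts. *)
Lemma point_sum_sigma_measurable (g : T -> R) :
  measurable_fun setT g -> (forall x, 0 <= g x)%R ->
  measurable_fun setT
    ((fun w => \esum_(k in [set: nat]) (g (pt k w))%:E) :
      g_sigma_algebraType (\bigcup_(A : {A : set T | measurable A})
        g_sigma_algebra_preimage (fun w => point_count pt w (sval A) : \bar R)) ->
      \bar R).
Proof.
move=> mg g0; have meg : measurable_fun setT (EFin \o g) by exact/measurable_EFinP.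
pose h n := nnsfun_approx measurableT meg n.
set G := \bigcup_A _.
apply: (emeasurable_fun_cvg (fun n (w : g_sigma_algebraType G) => \esum_(k in [set: nat]) (h n
  (pt k w))%:E)).
  move=> n; under eq_fun do rewrite esum_simple_point_count.
  apply: emeasurable_sum => y; apply: emeasurable_funM => //.
  move=> _ B mB; rewrite setTI; apply: sub_sigma_algebra.
  have mA : measurable (h n @^-1` [set y]).
    by rewrite -[X in measurable X]setTI; exact: measurable_funPT.
  by exists (exist _ _ mA) => //; exists B => //; rewrite setTI.
move=> w _; apply: cvg_esum_nondecreasing.
- by move=> n k; rewrite lee_fin.
- by move=> k n m nm; rewrite lee_fin; exact/lefP/nd_nnsfun_approx.
- by move=> k; apply: (@cvg_nnsfun_approx _ _ _ setT measurableT _ meg) => // y _; rewrite lee_fin.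
Qed.

(** When [mu A] is infinite both sides are 0 unless [y] is 0, where both are 1. *)
Lemma poisson_count_laplace A (y : R) : measurable A -> (0 <= y)%R ->
  \int[P]_w expN (y%:E * point_count pt w A) = expN ((1 - expR (- y))%:E * mu A).
Proof.
move=> mA y0; have mc := measurable_point_count mA.
case: ppp => _ fin inf _.
have c0 w : 0 <= point_count pt w A :> \bar R.
  by rewrite point_countE; apply: esum_ge0 => k _; rewrite lee_fin.
have [muA|] := boolP (mu A \is a fin_num).
  rewrite (@poisson_ext_laplace _ _ _ _ _ (fine (mu A)))//; last first.
  - by apply: fin => //; rewrite ltey_eq muA.
  by rewrite -[in RHS](fineK muA) -EFinM expN_EFin mulrC.
rewrite ge0_fin_numE// -leNgt leye_eq => /eqP muA.
move: y0; rewrite le_eqVlt => /predU1P[<-|y0].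
  rewrite oppr0 expR0 subrr mul0e.
  under eq_integral do rewrite mul0e expN0.
  by rewrite expN0 integral_cst// mul1e; exact: probability_setT.
have ey : (0 < 1 - expR (- y))%R.
  by rewrite subr_gt0 -[ltRHS]expR0 ltr_expR oppr_lt0.
rewrite muA mulry gtr0_sg// mul1e [RHS]/=.
rewrite -[RHS](integral0 P setT); apply: ge0_ae_eq_integral => //.
- by apply: measurable_expN_comp; exact: emeasurable_funM.
- by move=> w _; rewrite expN_ge0.
pose I := [set w | point_count pt w A = +oo :> \bar R].
have mI : measurable I.
  rewrite -[X in measurable X]setTI.
  by rewrite (_ : I = (fun w => point_count pt w A : \bar R) @^-1` [set +oo])//; exact: mc.
exists (~` I); split.
- exact: measurableC.
- transitivity (1 - P I); first exact: probability_setC.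
  by rewrite inf// subee.
move=> w /= neq pA; apply: neq => _.
by rewrite pA mulry gtr0_sg// mul1e.
Qed.

(** A simple function sees the points only through the counts of its level sets,
which are disjoint, hence independent counts. *)
Lemma poisson_process_laplace_simple (h : {nnsfun T >-> R}) :
  \int[P]_w expN (\esum_(k in [set: nat]) (h (pt k w))%:E) =
  expN (\int[mu]_x (1 - expR (- h x))%:E).
Proof.
pose s : seq R := fset_set (range h).
have us : uniq s by exact: fset_uniq.
have hs x : h x \in s by rewrite /s in_fset_set// inE; exists x.
have s0 y : y \in s -> (0 <= y)%R by rewrite /s in_fset_set// inE => -[x _ <-].
pose m := size s.
pose y (i : 'I_m) := s`_i.
have y0 i : (0 <= y i)%R by apply: s0; exact: mem_nth.
pose A (i : 'I_m) := h @^-1` [set y i].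
have mA i : measurable (A i).
  by rewrite -[A i]setTI; exact: measurable_funPT.
have tA : trivIset setT A.
  apply/trivIsetP => i j _ _ ij; apply/seteqP; split => // x [] /=.
  rewrite /A/= => -> /eqP; rewrite nth_uniq//.
  by move/eqP/val_inj => ijE; rewrite ijE eqxx in ij.
have sumE (phi : R -> R) x : (\sum_(i < m) phi (y i) * \1_(A i) x = phi (h x))%R.
  rewrite -(@sum_indic_fibers _ _ h s phi x us (hs x)).
  by rewrite (big_nth 0%R) big_mkord.
have c0 i w : 0 <= (y i)%:E * point_count pt w (A i).
  by rewrite mule_ge0 ?lee_fin// point_countE esum_ge0// => k _; rewrite lee_fin.
transitivity (\int[P]_w (\prod_(i <- enum 'I_m)
    fine (expN ((y i)%:E * point_count pt w (A i))))%:E).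
  apply: eq_integral => w _; rewrite -prodEFin.
  under [RHS]eq_bigr do rewrite fineK ?expN_fin_num//.
  rewrite -expN_sum//; congr expN.
  by rewrite esum_simple_point_count (big_nth 0%R) big_mkord big_enum.
case: ppp => _ _ _ /(_ m A mA tA) ind.
rewrite (integral_prod_indep ind); last 4 first.
- move=> i _ [B mB <-]; exact: (measurable_point_count (mA i) measurableT mB).
- move=> i B mB.
  exists ((fun z => fine (expN ((y i)%:E * z))) @^-1` B); last by rewrite setTI.
  rewrite -[X in measurable X]setTI.
  have : measurable_fun setT (fun z : \bar R => fine (expN ((y i)%:E * z))).
    apply: measurableT_comp; first exact: fine_measurable.
    by apply: measurable_expN_comp; apply: emeasurable_funM.
  exact.
- move=> i w; rewrite fine_ge0 ?expN_ge0//= -lee_fin fineK ?expN_fin_num//.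
  exact: expN_le1.
- exact: enum_uniq.
transitivity (\prod_(i <- enum 'I_m) expN ((1 - expR (- y i))%:E * mu (A i))).
  apply: eq_bigr => i _; rewrite -poisson_count_laplace//.
  by apply: eq_integral => w _; rewrite fineK ?expN_fin_num.
have e0 i : (0 <= 1 - expR (- y i))%R.
  by rewrite subr_ge0 -[leRHS]expR0 ler_expR oppr_le0.
rewrite -expN_sum; last by move=> i; rewrite mule_ge0 ?lee_fin.
congr expN; transitivity (\int[mu]_x \sum_(i <- enum 'I_m)
    ((1 - expR (- y i))%:E * (\1_(A i) x)%:E)).
  rewrite ge0_integral_sum//; last first.
  - by move=> i x _; rewrite mule_ge0 ?lee_fin.
  - by move=> i; apply/measurable_EFinP; apply: measurable_funM => //; exact: measurable_indic.
  apply: eq_bigr => i _; rewrite ge0_integralZl ?lee_fin//; last first.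
  - by apply/measurable_EFinP; exact: measurable_indic.
  by rewrite integral_indic// setIT.
apply: eq_integral => x _; rewrite -(sumE (fun z => 1 - expR (- z))%R) -sumEFin big_enum/=.
by apply: eq_bigr.
Qed.

(** Campbell's formula, by monotone approximation from simple functions. *)
Lemma poisson_process_laplace (g : T -> R) :
  measurable_fun setT g -> (forall x, 0 <= g x)%R ->
  \int[P]_w expN (\esum_(k in [set: nat]) (g (pt k w))%:E) =
  expN (\int[mu]_x (1 - expR (- g x))%:E).
Proof.
move=> mg g0; have meg : measurable_fun setT (EFin \o g) by exact/measurable_EFinP.
pose h n := nnsfun_approx measurableT meg n.
have ch x : (h n x)%:E @[n --> \oo] --> (g x)%:E.
  by apply: (@cvg_nnsfun_approx _ _ _ setT measurableT _ meg) => // y _; rewrite lee_fin.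
have ndh x : {homo (fun n => h n x) : n m / (n <= m)%N >-> (n <= m)%R}.
  by move=> n m nm; exact/lefP/nd_nnsfun_approx.
have mon : forall x, (1 - expR (- h n x))%:E @[n --> \oo] --> (1 - expR (- g x))%:E.
  move=> x; apply: cvg_EFin; first exact: nearW.
  have /fine_cvgP[_ c] := ch x; apply: cvgB; first exact: cvg_cst.
  by apply: continuous_cvg; [exact: continuous_expR|apply: cvgN].
have lims (u : nat -> \bar R) (l : \bar R) : u @ \oo --> l -> limn u = l.
  by move=> ?; exact: cvg_lim.
have e0 n x : 0 <= (1 - expR (- h n x))%:E.
  by rewrite lee_fin subr_ge0 -[leRHS]expR0 ler_expR oppr_le0.
have L := @cvg_expN_integral _ _ _ P
  (fun n w => \esum_(k in [set: nat]) (h n (pt k w))%:E)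
  (fun w => \esum_(k in [set: nat]) (g (pt k w))%:E).
apply: (cvg_unique _ (L _ _ _) _) => //.
- move=> n; apply: measurable_esum => [k|k w]; last by rewrite lee_fin.
  by apply/measurable_EFinP; apply: measurableT_comp => //; exact: measurable_funPT.
- by move=> n w; apply: esum_ge0 => k _; rewrite lee_fin.
- move=> w; apply: cvg_esum_nondecreasing => //.
  + by move=> n k; rewrite lee_fin.
  + by move=> k n m nm; rewrite lee_fin ndh.
rewrite (_ : (fun n => _) = fun n => expN (\int[mu]_x (1 - expR (- h n x))%:E)); last first.
  by apply/funext => n; rewrite poisson_process_laplace_simple.
apply: cvg_expN; first by move=> n; apply: integral_ge0.
rewrite (_ : \int[mu]_x (1 - expR (- g x))%:E =
             \int[mu]_x limn (fun n => (1 - expR (- h n x))%:E)); last first.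
  by apply: eq_integral => x _; rewrite (lims _ _ (mon x)).
apply: cvg_monotone_convergence => //.
- move=> n; apply/measurable_EFinP; apply: measurable_funB => //.
  apply: measurableT_comp => //; apply: measurableT_comp => //.
- by move=> x _ n m nm; rewrite lee_fin lerB// ler_expR lerN2 ndh.
Qed.

End poisson_process_laplace.

(** * Gamma integrals *)

Section half_line_positivity.
Context {R : realType}.
Local Notation mu := (@lebesgue_measure R).
Local Open Scope ereal_scope.

Lemma half_line_integral_gt0 (g : R -> R) : measurable_fun (`]0%R, +oo[%classic : set R) g ->
  (forall t, (0 < t)%R -> (0 < g t)%R) ->
  0 < \int[mu]_(t in `]0%R, +oo[) (g t)%:E.
Proof.
move=> mg g0; have ge0 t : t \in `]0%R, +oo[%classic -> 0 <= (g t)%:E.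
  by rewrite inE/= in_itv/= andbT lee_fin => /g0/ltW.
rewrite lt_def integral_ge0 ?andbT; last by move=> t t0; apply: ge0; rewrite inE.
apply/eqP => I0.
have mf : measurable_fun (`]0%R, +oo[%classic : set R) (fun t => (g t)%:E).
  exact/measurable_EFinP.
have /ae_eq_integral_abs : \int[mu]_(t in `]0%R, +oo[) `|(g t)%:E| = 0.
  by rewrite -I0; apply: eq_integral => t t0; rewrite gee0_abs// ge0.
move=> /(_ (measurable_itv _) mf) [A [mA A0 sub]].
have : mu (`]0%R, +oo[%classic : set R) <= mu A.
  apply: le_measure; rewrite ?inE//.
  apply: subset_trans sub => t /= t0 /(_ t0) [] /eqP.
  rewrite in_itv/= andbT in t0.
  by rewrite gt_eqF// g0.
by rewrite A0 lebesgue_measure_itv/= ltry.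
Qed.

End half_line_positivity.

Section gamma_integrals.
Context {R : realType}.
Implicit Types (a b c t : R).
Local Notation mu := (@lebesgue_measure R).

Lemma ge0_integral_scale c (f : R -> \bar R) : 0 < c ->
  measurable_fun setT f -> (forall t, 0 <= f t)%E ->
  (\int[mu]_(t in `]0%R, +oo[) f t =
   c%:E * \int[mu]_(t in `]0%R, +oo[) f (c * t)%R)%E.
Proof.
move=> c0 mf f0.
have mc : measurable_fun setT ( *%R c : R -> measurableTypeR R).
  exact: measurable_funM.
pose C : {nonneg R} := NngNum (ltW c0).
pose nu := mscale C (measure_function_pushforward__canonical__measure_function_Measure mu mc).
have E A : measurable A -> mu A = nu A.
  move=> mA; apply: lebesgue_measure_unique => // _ [[x y]] _ <- /=.
  rewrite /nu /mscale/= /pushforward.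
  rewrite [X in _ = (_ * lebesgue_measure X)%E](_ : _ = `]x / c, y / c]%classic).
    rewrite !lebesgue_measure_itv/= !lte_fin ltr_pM2r ?invr_gt0//.
    case: ifP => _; last by rewrite mule0.
    by rewrite -!EFinB -EFinM -mulrBl mulrC mulfVK// gt_eqF.
  apply/seteqP; split => z /=; rewrite !in_itv/=.
    by rewrite ltr_pdivrMr// ler_pdivlMr// mulrC.
  by rewrite ltr_pdivrMr// ler_pdivlMr// mulrC.
rewrite (@eq_measure_integral _ _ _ _ nu); last by move=> A mA _; exact: E.
rewrite /nu ge0_integral_mscale//; last exact: measurable_funTS.
congr (_ * _)%E.
rewrite ge0_integral_pushforward//; last exact: measurable_funTS.
by congr (integral _ _ _); apply/seteqP; split => z /=; rewrite !in_itv/= !andbT pmulr_rgt0.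
Qed.

Definition gamma_integral a b : \bar R :=
  (\int[mu]_(t in `]0%R, +oo[) (t `^ (a - 1) * expR (- (b * t)))%:E)%E.

Lemma measurable_gamma_integrand a b :
  measurable_fun setT (fun t => t `^ (a - 1) * expR (- (b * t))).
Proof.
apply: measurable_funM; first exact: measurable_powR.
by apply: measurableT_comp => //; apply: measurableT_comp => //; exact: measurable_funM.
Qed.

Lemma gamma_integrand_ge0 a b t : 0 <= t `^ (a - 1) * expR (- (b * t)).
Proof. by rewrite mulr_ge0// ?powR_ge0 ?expR_ge0. Qed.

(** The primitive is taken on the intervals [1 / n, 1], where the integrand is
continuous even for a < 1. *)
Lemma powR_integral_near0 a : 0 < a ->
  (\int[mu]_(t in `]0%R, 1%R]) (t `^ (a - 1))%:E <= (a^-1)%:E)%E.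
Proof.
move=> a0; pose F n := [set` `[(n.+1%:R : R)^-1, 1]].
have FE : `]0, 1]%classic = \bigcup_n F n.
  apply/seteqP; split => [t /=|t [n _]]; rewrite /F/= !in_itv/=.
    move=> /andP[t0 t1]; exists (Num.truncn t^-1) => //=.
    rewrite in_itv/= t1 andbT -[leRHS]invrK lef_pV2 ?posrE ?invr_gt0//.
    by apply/ltW/truncnS_gt.
  by move=> /andP[nt ->]; rewrite andbT (lt_le_trans _ nt)// invr_gt0.
rewrite FE.
have mf : measurable_fun setT (fun t : R => (t `^ (a - 1))%:E).
  by apply/measurable_EFinP; exact: measurable_powR.
have nd : nondecreasing_seq F.
  move=> n m nm; apply/subsetPset => t; rewrite /F/= !in_itv/= => /andP[nt ->].
  by rewrite andbT (le_trans _ nt)// lef_pV2 ?posrE// ler_nat.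
have C : (\int[mu]_(t in F n) (t `^ (a - 1))%:E @[n --> \oo] -->
    \int[mu]_(t in \bigcup_n F n) (t `^ (a - 1))%:E)%E.
  apply: ge0_nondecreasing_set_cvg_integral => //.
  - by move=> n; exact: measurable_itv.
  - by move=> n; exact: measurable_funTS.
  - by move=> n t _; rewrite lee_fin powR_ge0.
rewrite -(cvg_lim _ C)//; apply: lime_le.
  by apply/cvg_ex; eexists; exact: C.
apply: nearW => n.
have [n1|n1] := leP 1 (n.+1%:R^-1 : R).
  rewrite (integral_Sset1 1) ?lee_fin ?invr_ge0 ?(ltW a0)// => t.
  rewrite /F/= in_itv/= => /andP[nt t1].
  by apply/eqP; rewrite eq_le t1 (le_trans n1 nt).
have n0 : 0 < n.+1%:R^-1 :> R by rewrite invr_gt0.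
have dF t : 0 < t -> is_derive t (1:R) (fun x : R => a^-1 * x `^ a) (t `^ (a - 1)).
  move=> t0; have := is_derive1_powR a t0 => D.
  have := @is_deriveZ R R _ (@powR R ^~ a) a^-1 t 1 (a * t `^ (a - 1)) D.
  rewrite /GRing.scale/= mulrA mulVf ?mul1r ?gt_eqF//.
have cont (p t : R) : 0 < t -> {for t, continuous (fun x : R => x `^ p)}.
  move=> t0; apply: differentiable_continuous; apply/derivable1_diffP.
  by apply: derivable_powR; rewrite in_itv/= t0.
rewrite (@continuous_FTC2 _ _ (fun t => a^-1 * t `^ a) _ _ n1).
- by rewrite powR1 mulr1 -EFinB lee_fin gerBl mulr_ge0 ?powR_ge0 ?invr_ge0 ?(ltW a0).
- apply: continuous_in_subspaceT => t /set_mem/=; rewrite in_itv/= => /andP[nt _].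
  by apply: cont; rewrite (lt_le_trans n0 nt).
- split.
  + move=> t; rewrite in_itv/= => /andP[nt _].
    by have [] := dF t (lt_trans n0 nt).
  + apply: cvg_at_right_filter; apply: cvgMr; exact: cont.
  + apply: cvg_at_left_filter; apply: cvgMr; exact: cont.
- move=> t; rewrite in_itv/= => /andP[nt _].
  by rewrite derive1E; have [_ ->] := dF t (lt_trans n0 nt).
Qed.

End gamma_integrals.

Section gamma_integral_value.
Context {R : realType}.
Implicit Types (a b c t : R).
Local Notation mu := (@lebesgue_measure R).

(** Near 0 the exponential is at most 1.  On [1, +oo[ the power is dominated by a
multiple of exp(t / 2), which leaves an exponential density of rate 1/2. *)
Lemma gamma_integral_lty a : 0 < a -> (gamma_integral a 1 < +oo)%E.
Proof.
move=> a0; rewrite /gamma_integral.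
have mg := @measurable_gamma_integrand R a 1.
have meg : measurable_fun setT (fun t => (t `^ (a - 1) * expR (- (1 * t)))%:E).
  exact/measurable_EFinP.
rewrite (_ : `]0%R, +oo[%classic = `]0%R, 1%R] `|` `]1%R, +oo[); last first.
  by rewrite -itv_bndbnd_setU// bnd_simp.
rewrite ge0_integral_setU//=; last 3 first.
- exact: measurable_funTS.
- by move=> t _; rewrite lee_fin gamma_integrand_ge0.
- apply/disj_setPRL => t /=; rewrite !in_itv/= andbT => t1.
  by apply/negP; rewrite negb_and -!real_ltNge ?num_real// t1 orbT.
apply: lte_add_pinfty.
  apply: (@le_lt_trans _ _ (a^-1)%:E); last exact: ltry.
  apply: le_trans (powR_integral_near0 a0).
  apply: ge0_le_integral => //.
  - by move=> t _; rewrite lee_fin gamma_integrand_ge0.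
  - exact: measurable_funTS.
  - by apply/measurable_EFinP/measurable_funTS; exact: measurable_powR.
  move=> t; rewrite /= in_itv/= => /andP[t0 _]; rewrite lee_fin ler_piMr ?powR_ge0//.
  by rewrite -[leRHS]expR0 ler_expR mul1r oppr_le0 ltW.
(* t ^ (a - 1) <= t ^ (n + 1) for t >= 1, and (t / 2) ^ (n + 1) / (n + 1)! is at most
   exp(t / 2). *)
pose n := Num.truncn a.
pose C : R := (n.+1)`!%:R * 2 ^+ n.+1.
have C0 : 0 <= C by rewrite mulr_ge0.
apply: (@le_lt_trans _ _ (\int[mu]_(t in `]1%R, +oo[)
    ((C * 2)%:E * (exponential_pdf 2^-1 t)%:E))%E).
  apply: ge0_le_integral => //.
  - by move=> t _; rewrite lee_fin gamma_integrand_ge0.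
  - exact: measurable_funTS.
  - apply/measurable_EFinP/measurable_funTS/measurable_funM => //.
    exact: measurable_exponential_pdf.
  move=> t; rewrite /= in_itv/= andbT => t1.
  have t0 : 0 < t by apply: lt_trans t1.
  rewrite -EFinM lee_fin (exponential_pdfE _ (ltW t0)) mul1r.
  rewrite (_ : C * 2 * _ = C * expR (t / 2) * expR (- t)); last first.
    rewrite -[RHS]mulrA -expRD.
    rewrite [in X in _ = _ * X](_ : t / 2 - t = - 2^-1 * t); last by field.
    by rewrite -mulrA; congr (_ * _); rewrite mulrA mulfV// mul1r.
  rewrite ler_wpM2r ?expR_ge0//.
  have /(le_trans _) := expR_ge1Dxn n (ltW (divr_gt0 t0 (ltr0n R 2))) => E.
  apply: (@le_trans _ _ (t ^+ n.+1)).
    rewrite -powR_mulrn ?(ltW t0)// ler_powR// ?(ltW t1)//.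
    by apply: le_trans (ltW (truncnS_gt a)); rewrite gerBl.
  have {}E : (t / 2) ^+ n.+1 / (n.+1)`!%:R <= expR (t / 2).
    by apply: E; rewrite lerDr.
  rewrite ler_pdivrMr ?ltr0n ?fact_gt0// in E.
  rewrite expr_div_n ler_pdivrMr ?exprn_gt0// in E.
  by apply: le_trans E _; rewrite /C mulrC mulrA [X in _ <= X * _]mulrC mulrAC.
rewrite ge0_integralZl//; last 3 first.
- by apply/measurable_EFinP/measurable_funTS; exact: measurable_exponential_pdf.
- by move=> t _; rewrite lee_fin exponential_pdf_ge0.
- by rewrite lee_fin mulr_ge0.
apply: lte_mul_pinfty; rewrite ?lee_fin ?mulr_ge0//.
apply: (@le_lt_trans _ _ 1%E); last exact: ltry.
rewrite -(@integral_exponential_pdf R 2^-1)//.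
apply: ge0_subset_integral => //.
- by apply/measurable_EFinP; exact: measurable_exponential_pdf.
- by move=> t _; rewrite lee_fin exponential_pdf_ge0.
Qed.

Lemma gamma_integral_gt0 a b : (0 < gamma_integral a b)%E.
Proof.
apply: half_line_integral_gt0 => [|t t0].
  by apply: measurable_funTS; exact: measurable_gamma_integrand.
by rewrite mulr_gt0 ?powR_gt0 ?expR_gt0.
Qed.

Lemma Gamma_funE a : 0 < a -> (Gamma_fun a)%:E = gamma_integral a 1.
Proof.
move=> a0; rewrite /Gamma_fun /Rintegral (_ : integral _ _ _ = gamma_integral a 1).
  by rewrite fineK// ge0_fin_numE ?gamma_integral_lty// ltW// gamma_integral_gt0.
by apply: eq_integral => t _; rewrite mul1r.
Qed.

Lemma Gamma_fun_gt0 a : 0 < a -> 0 < Gamma_fun a.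
Proof. by move=> a0; rewrite -lte_fin Gamma_funE// gamma_integral_gt0. Qed.

Lemma gamma_integralE a b : 0 < a -> 0 < b ->
  gamma_integral a b = (Gamma_fun a / b `^ a)%:E.
Proof.
move=> a0 b0; rewrite mulrC EFinM Gamma_funE//.
rewrite /gamma_integral [in RHS](ge0_integral_scale b0); last 2 first.
- by apply/measurable_EFinP; exact: measurable_gamma_integrand.
- by move=> t; rewrite lee_fin gamma_integrand_ge0.
rewrite muleA -EFinM -ge0_integralZl//; last 3 first.
- apply/measurable_EFinP/measurable_funTS.
  apply: measurableT_comp (@measurable_gamma_integrand R a 1) _.
  exact: measurable_funM.
- by move=> t _; rewrite lee_fin gamma_integrand_ge0.
- by rewrite lee_fin mulr_ge0 ?invr_ge0 ?powR_ge0 ?ltW.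
apply: eq_integral => t; rewrite inE/= in_itv/= andbT => t0.
rewrite -EFinM; congr EFin; rewrite powRM ?ltW// mul1r.
have -> : b `^ a = b `^ (a - 1) * b.
  have := @powRD R b (a - 1) 1; rewrite subrK powRr1 ?(ltW b0)// => -> //.
  by rewrite (gt_eqF b0) implybT.
by field; rewrite !gt_eqF ?powR_gt0.
Qed.

End gamma_integral_value.

(** * Countable sums and measures on products *)

Section esum_types.
Context {R : realType}.
Local Open Scope ereal_scope.

Lemma esum_pair (I J : choiceType) (a : I -> J -> \bar R) :
  (forall i j, 0 <= a i j) ->
  \esum_(q in [set: I * J]) a q.1 q.2 =
  \esum_(i in [set: I]) \esum_(j in [set: J]) a i j.
Proof.
move=> a0; rewrite (esum_esum (J := fun=> setT))//.
by congr esum; apply/seteqP; split => -[].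
Qed.

Lemma esum_exchange (I J : choiceType) (a : I -> J -> \bar R) :
  (forall i j, 0 <= a i j) ->
  \esum_(i in [set: I]) (\esum_(j in [set: J]) a i j) =
  \esum_(j in [set: J]) \esum_(i in [set: I]) a i j.
Proof.
move=> a0; rewrite -esum_pair// -(@esum_pair J I (fun j i => a i j))//.
rewrite (@reindex_esum _ _ _ [set: J * I] [set: I * J] (fun q => (q.2, q.1)))//.
split => //=; first by move=> [i j] [k l] _ _ /= [-> ->].
by move=> [i j] _ /=; exists (j, i).
Qed.

Lemma esum_finType (I : finType) (a : I -> \bar R) : (forall i, 0 <= a i) ->
  \esum_(i in [set: I]) a i = \sum_i a i.
Proof.
move=> a0.
rewrite -(eq_esum (a := fun i => \sum_(j : I) ((\1_[set j] i)%:E * a j))); last first.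
  move=> i _; rewrite (bigD1 i)//= big1 ?adde0 ?indicE ?mem_set// ?mul1e//.
  by move=> j ji; rewrite indicE memNset ?mul0e// => /= ij; rewrite ij eqxx in ji.
rewrite esum_sum//; last by move=> i j _ _; rewrite mule_ge0 ?lee_fin.
apply: eq_bigr => j _.
under eq_esum do rewrite muleC.
transitivity (\esum_(i in [set: I]) (\1_[set i] j)%:E * cst (a j) i).
  by apply: eq_esum => i _; rewrite muleC !indicE !in_set1 eq_sym.
by rewrite esum_indic_pred1 //= => v; exact: a0.
Qed.

Lemma esum_sumType (I J : choiceType) (a : I + J -> \bar R) :
  (forall i, 0 <= a i) ->
  \esum_(q in [set: I + J]) a q =
  \esum_(i in [set: I]) a (inl i) + \esum_(j in [set: J]) a (inr j).
Proof.
move=> a0; rewrite (esumID (range inl))//; congr (_ + _).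
  by rewrite setTI esum_image// => x y _ _ [].
rewrite setTI (_ : ~` range inl = range inr) ?esum_image//; first by move=> x y _ _ [].
apply/seteqP; split => [[i|j] //=|[i|j] /= [k _]//]; last by move=> _ [].
- by case; exists i.
- by move=> _; exists j.
Qed.

End esum_types.

Section density_measure.
Context {R : realType} d (T : measurableType d) (mu : {measure set T -> \bar R})
  (w : T -> \bar R).
Hypothesis mw : measurable_fun setT w.
Hypothesis w0 : forall x, (0 <= w x)%E.

Definition density_measure (A : set T) : \bar R := (\int[mu]_(x in A) w x)%E.

Let density_measure0 : density_measure set0 = 0%E.
Proof. exact: integral_set0. Qed.

Let density_measure_ge0 A : (0 <= density_measure A)%E.
Proof. exact: integral_ge0. Qed.

Let density_measure_sigma_additive : semi_sigma_additive density_measure.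
Proof.
move=> F mF tF mUF; rewrite /density_measure ge0_integral_bigcup//; last exact: measurable_funTS.
by apply: is_cvg_nneseries => n _ _; exact: integral_ge0.
Qed.

HB.instance Definition _ := isMeasure.Build _ _ _ density_measure
  density_measure0 density_measure_ge0 density_measure_sigma_additive.

Definition density : {measure set T -> \bar R} := density_measure.

End density_measure.

Section half_line_product.
Context {R : realType} d (T : measurableType d) (G : probability T R) (w : R -> R).
Local Open Scope ereal_scope.
Hypothesis mw : measurable_fun setT w.
Hypothesis w0 : forall t, (0 <= w t)%R.

Let W (z : measurableTypeR R * T) : R := if (0 < z.1)%R then w z.1 else 0%R.

Let mW : measurable_fun setT W.
Proof.
apply: measurable_fun_ifT => //; last exact: measurableT_comp mw measurable_fst.
by apply: measurable_fun_ltr => //; exact: measurable_fst.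
Qed.

Let W0 z : (0 <= W z)%R. Proof. by rewrite /W; case: ifP. Qed.

Let meW : measurable_fun setT (EFin \o W). Proof. exact/measurable_EFinP. Qed.

Let to_R (z : measurableTypeR R * T) : R * T := z.

Let mto_R : measurable_fun setT to_R.
Proof.
apply/measurable_fun_pairP; split; [exact: measurable_fst|exact: measurable_snd].
Qed.

(** The Lebesgue measure lives on a copy of [R] with its own sigma-algebra instance; the
push-forward along the identity moves the product to [R * T]. *)
Definition half_line_product : {measure set (R * T) -> \bar R} :=
  measure_function_pushforward__canonical__measure_function_Measure
    (density ((@lebesgue_measure R) \x G)%E meW W0) mto_R.

Lemma ge0_integral_half_line_product (phi : R * T -> \bar R) :
  measurable_fun setT phi -> (forall z, 0 <= phi z) ->
  \int[half_line_product]_z phi z =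
  \int[lebesgue_measure]_(t in `]0%R, +oo[) ((w t)%:E * \int[G]_x phi (t, x)).
Proof.
move=> mphi phi0.
have mphi' : measurable_fun setT (phi \o to_R) by exact: measurableT_comp mphi mto_R.
rewrite ge0_integral_pushforward//= preimage_setT.
rewrite (@ge0_integral_density _ _ _ (lebesgue_measure \x G) _ setT W)//; last first.
  by move=> A mA; rewrite setIT.
rewrite fubini_tonelli1//; last 2 first.
- by apply: emeasurable_funM.
- by move=> z; apply: mule_ge0; [exact: phi0|rewrite lee_fin].
rewrite [RHS]integral_mkcond; apply: eq_integral => t _.
rewrite /fubini_F patchE; case: ifPn => [|/negP]; rewrite inE/= in_itv/= andbT => t0.
  rewrite -ge0_integralZl ?lee_fin//; last first.
    exact: measurableT_comp mphi (measurable_pair1 t).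
  by apply: eq_integral => x _; rewrite /W/= t0 muleC.
rewrite integral0_eq// => x _; rewrite /W/=; case: ifPn => // _.
by rewrite mule0.
Qed.

Lemma half_line_productE A : measurable A ->
  half_line_product A =
  \int[lebesgue_measure]_(t in `]0%R, +oo[) ((w t)%:E * G (xsection A t)).
Proof.
move=> mA; transitivity (\int[half_line_product]_z (\1_A z)%:E).
  by rewrite integral_indic// setIT.
rewrite ge0_integral_half_line_product//; last first.
  by apply/measurable_EFinP; exact: measurable_indic.
apply: eq_integral => t _; congr (_ * _).
rewrite -[xsection A t]setIT -integral_indic//; last exact: measurable_xsection.
apply: eq_integral => x _; congr EFin.
by rewrite !indicE; congr (nat_of_bool _)%:R; apply/idP/idP; rewrite !inE /xsection/= ?inE.
Qed.

End half_line_product.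

Lemma poisson_process_eq {R : realType} d d' (Omega : measurableType d)
    (T : measurableType d') (P : probability Omega R) (pt : nat -> Omega -> T)
    (m1 m2 : set T -> \bar R) :
  (forall A, measurable A -> m1 A = m2 A) ->
  poisson_process P pt m1 -> poisson_process P pt m2.
Proof.
move=> m12 [mpt fin inf ind]; split => // A mA; rewrite -m12//.
- exact: fin.
- exact: inf.
Qed.

Section half_line.
Context {R : realType}.
Local Notation mu := (@lebesgue_measure R).
Local Open Scope ereal_scope.

Lemma half_line_swap d (T : measurableType d) (G : probability T R)
    (phi : R * T -> \bar R) :
  measurable_fun setT phi -> (forall t p, (0 < t)%R -> 0 <= phi (t, p)) ->
  \int[mu]_(t in `]0%R, +oo[) \int[G]_p phi (t, p) =
  \int[G]_p \int[mu]_(t in `]0%R, +oo[) phi (t, p).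
Proof.
move=> mphi phi0.
pose f (z : measurableTypeR R * T) : \bar R :=
  if (0 < z.1)%R then phi (z.1, z.2) else 0.
have mf : measurable_fun setT f.
  apply: measurable_fun_ifT => //.
    by apply: measurable_fun_ltr => //; exact: measurable_fst.
  apply: measurableT_comp mphi _; apply/measurable_fun_pairP; split.
    exact: measurable_fst.
  exact: measurable_snd.
have f0 z : 0 <= f z by rewrite /f; case: ifP => // /phi0.
have /= := @fubini_tonelli _ _ _ _ R (@lebesgue_measure R) G f mf f0.
rewrite /fubini_F /fubini_G => E.
transitivity (\int[mu]_t \int[G]_p f (t, p)).
  rewrite integral_mkcond; apply: eq_integral => t _.
  rewrite patchE; case: ifPn => [|/negP]; rewrite inE/= in_itv/= andbT => t0.
    by apply: eq_integral => p _; rewrite /f/= t0.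
  by rewrite integral0_eq// => p _; rewrite /f/=; case: ifPn.
rewrite E; apply: eq_integral => p _.
rewrite [RHS]integral_mkcond; apply: eq_integral => t _.
rewrite patchE /f; case: ifPn => [t0|/negP t0].
  by rewrite mem_set//= in_itv/= t0.
by rewrite memNset//= in_itv/= andbT.
Qed.

End half_line.

(** * The Laplace functional of the likelihood process *)

Section poisson_likelihood_laplace.
Context {R : realType} {dPsi : measure_display} {Psi : measurableType dPsi}
  {N K : nat} {dOmega : measure_display} {Omega : measurableType dOmega}
  (P : probability Omega R) (psifix : 'I_K -> Psi) (a : crm_atoms Omega Psi R K)
  (gam xi lam : R) (G : probability Psi R) (xifix lamfix : 'I_K -> R)
  (x : 'I_N -> 'I_K + nat -> {mfun Omega >-> nat}).
Hypothesis Theta_gamma : is_gamma_process P a gam xi lam G xifix lamfix.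
Hypothesis X_poisson : poisson_likelihood P a x.
Local Notation J := ('I_K + nat)%type.
Local Notation theta := (fun (j : J) w => (atom_weight a j w)%:num).
Local Notation loc := (atom_loc psifix a).
Variable sigma : 'I_N -> Psi -> R.
Hypothesis msigma : forall n, measurable_fun setT (sigma n).
Hypothesis sigma0 : forall n p, 0 <= sigma n p.

(** A weight theta produces a count n with Laplace transform
exp(- theta (1 - exp(- sigma n))); the rounds multiply these factors. *)
Definition thinned_rate (p : Psi) : R := \sum_(n < N) (1 - expR (- sigma n p)).

Local Notation f := thinned_rate.

Lemma one_minus_expN_ge0 (y : R) : 0 <= y -> 0 <= 1 - expR (- y).
Proof. by move=> y0; rewrite subr_ge0 -[leRHS]expR0 ler_expR oppr_le0. Qed.

Lemma thinned_rate_ge0 p : 0 <= f p.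
Proof. by apply: sumr_ge0 => n _; exact: one_minus_expN_ge0. Qed.

Lemma measurable_thinned_rate : measurable_fun setT f.
Proof.
apply: measurable_sum => n; apply: measurable_funB => //.
by apply: measurableT_comp => //; apply: measurableT_comp.
Qed.

Let atomG : set (set Omega) := \bigcup_(i : J) match i with
    | inl k => g_sigma_algebra_preimage (fix_weight_num a k)
    | inr k => g_sigma_algebra_preimage (ord_point a k)
    end.

Let mfix k : measurable_fun setT (fix_weight_num a k).
Proof. by case: Theta_gamma. Qed.

Let mord k : measurable_fun setT (ord_point a k).
Proof. by case: Theta_gamma => _ _ [+ _ _ _] _; exact. Qed.

Let atomGM : atomG `<=` measurable.
Proof. by move=> A [[k|k] _ [B mB <-]]; [exact: mfix|exact: mord]. Qed.

Let mfixG k : measurable_fun setT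
  (fix_weight_num a k : g_sigma_algebraType atomG -> R).
Proof.
move=> _ B mB; rewrite setTI; apply: sub_sigma_algebra.
by exists (inl k) => //; exists B => //; rewrite setTI.
Qed.

Let mordG k : measurable_fun setT
  (ord_point a k : g_sigma_algebraType atomG -> (R * Psi)%type).
Proof.
move=> _ B mB; rewrite setTI; apply: sub_sigma_algebra.
by exists (inr k) => //; exists B => //; rewrite setTI.
Qed.

Let mthetaG (j : J) : measurable_fun setT (theta j : g_sigma_algebraType atomG -> R).
Proof.
by case: j => k; [exact: mfixG|exact: measurableT_comp measurable_fst (mordG k)].
Qed.

Let mlocG (j : J) : measurable_fun setT (loc j : g_sigma_algebraType atomG -> Psi).
Proof.
by case: j => k; [exact: measurable_cst|exact: measurableT_comp measurable_snd (mordG k)].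
Qed.

(** The counts are conditionally independent Poisson variables given the atoms, so
[laplace_conditional_product] integrates them out. *)
Lemma laplace_counts_given_atoms :
  (\int[P]_w expN (\esum_(q in [set: 'I_N * J])
     (sigma q.1 (loc q.2 w) * (x q.1 q.2 w)%:R)%:E) =
   \int[P]_w expN (\esum_(j in [set: J]) (theta j w * f (loc j w))%:E))%E.
Proof.
rewrite (@laplace_conditional_product R _ Omega P atomG ('I_N * J)%type nat
  (fun q => x q.1 q.2) (fun q w v => poisson_mass (theta q.2 w) v)
  (fun q w v => sigma q.1 (loc q.2 w) * v%:R)
  (fun q w => (theta q.2 w * (1 - expR (- sigma q.1 (loc q.2 w))))%:E))//.
- apply: eq_integral => w _; congr expN.
  rewrite (@esum_pair _ _ _ (fun n j => (theta j w * (1 - expR (- sigma n (loc j w))))%:E)).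
    rewrite esum_exchange//; last first.
      by move=> n j; rewrite lee_fin mulr_ge0// one_minus_expN_ge0.
    apply: eq_esum => j _; rewrite esum_finType; last first.
      by move=> n; rewrite lee_fin mulr_ge0// one_minus_expN_ge0.
    by rewrite sumEFin -mulr_sumr.
  by move=> n j; rewrite lee_fin mulr_ge0// one_minus_expN_ge0.
- move=> [n j] v /=.
  by rewrite -[X in measurable X]setTI; exact: measurable_funPT.
- move=> [n j] v /=.
  rewrite (_ : (fun w => _) = fun w => theta j w ^+ v * v`!%:R^-1 * expR (- theta j w)).
    apply: measurable_funM; first by apply: measurable_funM => //; exact: measurable_funX.
    by apply: measurableT_comp => //; apply: measurableT_comp.
  by apply/funext => w; rewrite poisson_massE.
- by move=> q w v; exact: poisson_mass_ge0.
- move=> [n j] v /=; apply: measurable_funM => //.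
  exact: measurableT_comp (msigma n) (mlocG j).
- by move=> q w v; rewrite mulr_ge0.
- by move=> q w; rewrite lee_fin mulr_ge0// one_minus_expN_ge0.
- move=> [n j] /=; apply/measurable_EFinP; apply: measurable_funM.
    exact: sigma_measurable_fun atomGM (mthetaG j).
  apply: measurable_funB => //; apply: measurableT_comp => //; apply: measurableT_comp => //.
  apply: measurableT_comp (msigma n) _; exact: sigma_measurable_fun atomGM (mlocG j).
- move=> s v B us sB; have := X_poisson [fset q in s]%fset v sB.
  rewrite bigcap_fset big_seq_fset_undup// => ->.
  by apply: eq_integral => w _; rewrite big_seq_fset_undup.
- move=> [n j] w /=; by rewrite poisson_laplace.
Qed.

End poisson_likelihood_laplace.

Section gamma_process_laplace.
Context {R : realType} {dPsi : measure_display} {Psi : measurableType dPsi}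
  {K : nat} {dOmega : measure_display} {Omega : measurableType dOmega}
  (P : probability Omega R) (psifix : 'I_K -> Psi) (a : crm_atoms Omega Psi R K)
  (gam xi lam : R) (G : probability Psi R) (xifix lamfix : 'I_K -> R).
Hypothesis gam_gt0 : 0 < gam.
Hypothesis xifix_gt : forall k, -1 < xifix k.
Hypothesis Theta_gamma : is_gamma_process P a gam xi lam G xifix lamfix.
Local Notation J := ('I_K + nat)%type.
Variable f : Psi -> R.
Hypothesis mf : measurable_fun setT f.
Hypothesis f0 : forall p, 0 <= f p.

Definition fixed_laplace (k : 'I_K) : \bar R :=
  (\int[lebesgue_measure]_(t in `]0%R, +oo[)
    (gamma_pdf (xifix k + 1) (lamfix k) t * expR (- (t * f (psifix k))))%:E)%E.

Definition ordinary_exponent : \bar R :=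
  (\int[lebesgue_measure]_(t in `]0%R, +oo[)
    ((gam * t `^ xi * expR (- (lam * t)))%:E *
     \int[G]_p (1 - expR (- (t * f p)))%:E))%E.

Let mfix k : measurable_fun setT (fix_weight_num a k).
Proof. by case: Theta_gamma. Qed.

Let w (t : R) : R := gam * t `^ xi * expR (- (lam * t)).

Let mw : measurable_fun setT w.
Proof.
apply: measurable_funM; first by apply: measurable_funM => //; exact: measurable_powR.
by apply: measurableT_comp => //; apply: measurableT_comp => //; exact: measurable_funM.
Qed.

Let w0 t : 0 <= w t.
Proof. by rewrite !mulr_ge0 ?powR_ge0 ?expR_ge0// ltW. Qed.

(* The truncation at 0 makes g nonnegative everywhere; the rate measure only charges
   positive weights. *)
Let g (z : R * Psi) : R := Num.max z.1 0 * f z.2.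

Let mg : measurable_fun setT g.
Proof.
apply: measurable_funM.
  by apply: measurable_maxr => //; exact: measurable_fst.
exact: measurableT_comp mf measurable_snd.
Qed.

Let g0 z : 0 <= g z.
Proof. by rewrite mulr_ge0// le_max lexx orbT. Qed.

Let ppp : poisson_process P (ord_point a) (half_line_product G mw w0).
Proof.
case: Theta_gamma => _ _ + _; apply: poisson_process_eq => A mA.
by rewrite half_line_productE.
Qed.

Lemma gamma_pdf_ge0 b c t : 0 < b -> 0 <= gamma_pdf b c t :> R.
Proof.
move=> b0; rewrite /gamma_pdf !mulr_ge0 ?powR_ge0 ?expR_ge0// invr_ge0.
by rewrite ltW// Gamma_fun_gt0.
Qed.

Lemma measurable_gamma_pdf b c : measurable_fun setT (@gamma_pdf R b c).
Proof.
apply: measurable_funM; first by apply: measurable_funM => //; exact: measurable_powR.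
by apply: measurableT_comp => //; apply: measurableT_comp => //; exact: measurable_funM.
Qed.

Lemma fixed_weight_laplace k :
  (\int[P]_w (expR (- (fix_weight_num a k w * f (psifix k))))%:E =
   fixed_laplace k)%E.
Proof.
case: Theta_gamma => _ law _ _.
have b0 : 0 < xifix k + 1 by have := xifix_gt k; lra.
pose phi (t : R) : \bar R := (expR (- (t * f (psifix k))))%:E.
have mphi : measurable_fun setT phi.
  apply/measurable_EFinP; apply: measurableT_comp => //; apply: measurableT_comp => //.
  exact: measurable_funM.
have m' : measurable_fun setT (fix_weight_num a k : Omega -> measurableTypeR R).
  exact: mfix.
pose nu := measure_function_pushforward__canonical__measure_function_Measure P m'.
transitivity (\int[nu]_t phi t)%E.
  by rewrite ge0_integral_pushforward // => t _; rewrite lee_fin expR_ge0.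
rewrite (@ge0_integral_density _ _ _ lebesgue_measure _ `]0%R, +oo[%classic
  (gamma_pdf (xifix k + 1) (lamfix k)))//.
- by apply: eq_integral => t _; rewrite /phi -EFinM mulrC.
- exact: measurable_gamma_pdf.
- by move=> t _; exact: gamma_pdf_ge0.
- by move=> A mA; exact: law.
- by move=> t; rewrite lee_fin expR_ge0.
Qed.

(** The fixed weights and the ordinary component are independent; the former have
gamma densities and the latter is a Poisson process on weights and locations. *)
Lemma gamma_process_laplace :
  (\int[P]_w expN (\esum_(j in [set: J])
    ((atom_weight a j w)%:num * f (atom_loc psifix a j w))%:E) =
   \prod_(k < K) fixed_laplace k * expN ordinary_exponent)%E.
Proof.
pose ord w := (\esum_(k in [set: nat]) (g (ord_point a k w))%:E)%E.
have ord0 v : (0 <= ord v)%E by apply: esum_ge0 => k _; rewrite lee_fin.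
have mord := @point_sum_sigma_measurable _ _ _ _ _ (ord_point a) g mg g0.
pose F (i : option 'I_K) (v : Omega) : R :=
  if i is Some k then expR (- (fix_weight_num a k v * f (psifix k)))
  else fine (expN (ord v)).
case: (Theta_gamma) => _ _ _ ind.
have fw0 k v : 0 <= fix_weight_num a k v by rewrite /fix_weight_num.
have FM i v : (F i v)%:E = expN (if i is Some k then
    (fix_weight_num a k v * f (psifix k))%:E else ord v).
  by case: i => [k|] //=; rewrite fineK// expN_fin_num.
transitivity (\int[P]_v (\prod_(i <- enum {: option 'I_K}) F i v)%:E)%E.
  apply: eq_integral => v _; rewrite -prodEFin.
  under [RHS]eq_bigr do rewrite FM.
  rewrite -expN_sum; last first.
    by case => [k|] //; rewrite lee_fin mulr_ge0.
  congr expN; rewrite big_enum/= (bigD1 None)//= esum_sumType//; last first.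
    by move=> j; rewrite lee_fin mulr_ge0.
  rewrite addeC; congr (_ + _)%E.
    apply: eq_esum => k _; congr EFin; rewrite /g/= max_l//.
  rewrite esum_finType; last by move=> j; rewrite lee_fin mulr_ge0.
  rewrite (reindex_omap Some id) /=; last by case.
  by apply: eq_big => // k; rewrite eqxx.
rewrite (integral_prod_indep ind); last 4 first.
- move=> [k|]; first by move=> _ [B mB <-]; exact: mfix.
  apply: smallest_sub; first exact: sigma_algebra_measurable.
  move=> _ [[A mA] _ [B mB <-]].
  exact: (measurable_point_count ppp mA).
- move=> [k|] B mB.
    exists ((fun t => expR (- (t * f (psifix k)))) @^-1` B); last by rewrite setTI.
    rewrite -[X in measurable X]setTI.
    have : measurable_fun setT (fun t : R => expR (- (t * f (psifix k)))).
      by apply: measurableT_comp => //; apply: measurableT_comp => //; exact: measurable_funM.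
    exact.
  apply: sigma_measurable_preimage => //.
  apply: measurableT_comp; first exact: fine_measurable.
  by apply: measurableT_comp mord; exact: measurable_expN.
- move=> i v; rewrite -!lee_fin FM expN_ge0/= expN_le1//.
  by case: i => [k|] //; rewrite lee_fin mulr_ge0.
- exact: enum_uniq.
rewrite big_enum/= (bigD1 None)//= muleC; congr (_ * _)%E.
  rewrite (reindex_omap Some id) /=; last by case.
  apply: eq_big => // [k|k _]; first by rewrite eqxx.
  exact: fixed_weight_laplace.
transitivity (\int[P]_v expN (ord v))%E.
  by apply: eq_integral => v _; rewrite fineK// expN_fin_num.
rewrite (poisson_process_laplace ppp mg g0); congr expN.
rewrite ge0_integral_half_line_product; last 2 first.
- apply/measurable_EFinP; apply: measurable_funB => //.
  by apply: measurableT_comp => //; apply: measurableT_comp.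
- by move=> z; rewrite lee_fin subr_ge0 -[leRHS]expR0 ler_expR oppr_le0.
apply: eq_integral => t; rewrite inE/= in_itv/= andbT => t0; congr (_ * _)%E.
by apply: eq_integral => p _; rewrite /g/= max_l// ltW.
Qed.

End gamma_process_laplace.

(** * Gamma mixtures of Poisson histories *)

Section history_sums.
Context {R : realType}.

Let cons_ffun N (q : nat * {ffun 'I_N -> nat}) : {ffun 'I_N.+1 -> nat} :=
  [ffun i => oapp q.2 q.1 (unlift ord0 i)].

Let cons_ffun0 N q : @cons_ffun N q ord0 = q.1.
Proof. by rewrite ffunE unlift_none. Qed.

Let cons_ffunS N q i : @cons_ffun N q (lift ord0 i) = q.2 i.
Proof. by rewrite ffunE liftK. Qed.

Let cons_ffun_bij N : set_bij setT setT (@cons_ffun N).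
Proof.
split => // [[x g] [y h] _ _ /ffunP E|v _].
  have xy : x = y by have := E ord0; rewrite !cons_ffun0.
  rewrite xy; congr (_, _); apply/ffunP => i.
  by have := E (lift ord0 i); rewrite !cons_ffunS.
exists (v ord0, [ffun i => v (lift ord0 i)]) => //.
apply/ffunP => i; case: (unliftP ord0 i) => [j|] ->.
  by rewrite cons_ffunS ffunE.
by rewrite cons_ffun0.
Qed.

(** Distributivity of a finite product over countable sums. *)
Lemma esum_prod_ffun N (a : 'I_N -> nat -> R) (A : 'I_N -> R) :
  (forall n x, 0 <= a n x) ->
  (forall n, \esum_(x in [set: nat]) (a n x)%:E = (A n)%:E) ->
  \esum_(v in [set: {ffun 'I_N -> nat}]) (\prod_n a n (v n))%:E = (\prod_n A n)%:E.
Proof.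
elim: N a A => [|N ih] a A a0 aA.
  rewrite big_ord0; pose v0 : {ffun 'I_0 -> nat} := [ffun=> 0%N].
  rewrite (_ : setT = [set v0]); last first.
    by apply/seteqP; split => // v _ /=; apply/ffunP => -[].
  by rewrite esum_set1 big_ord0// lee_fin.
rewrite (@reindex_esum _ _ _ _ _ _ _ (cons_ffun_bij N)).
transitivity (\esum_(q in [set: nat * {ffun 'I_N -> nat}])
    ((a ord0 q.1)%:E * (\prod_n a (lift ord0 n) (q.2 n))%:E)%E).
  apply: eq_esum => q _; rewrite big_ord_recl cons_ffun0 EFinM; congr (_ * _%:E)%E.
  by apply: eq_bigr => n _; rewrite cons_ffunS.
rewrite (@esum_pair _ _ _ (fun x (g : {ffun 'I_N -> nat}) => (a ord0 x)%:E * (\prod_n a (lift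
  ord0 n) (g n))%:E)%E); last first.
  by move=> x g; rewrite mule_ge0// lee_fin// prodr_ge0.
transitivity (\esum_(x in [set: nat]) ((\prod_n A (lift ord0 n))%:E * (a ord0 x)%:E)%E).
  apply: eq_esum => x _; rewrite ge0_esumZl//; last by move=> g; rewrite lee_fin prodr_ge0.
  by rewrite (ih (fun n => a (lift ord0 n)) (fun n => A (lift ord0 n)))// muleC.
have A0 n : 0 <= A n.
  by rewrite -lee_fin -aA; apply: esum_ge0 => x _; rewrite lee_fin.
rewrite ge0_esumZl; last 2 first.
- by move=> x; rewrite lee_fin.
- by rewrite prodr_ge0.
by rewrite aA -EFinM big_ord_recl mulrC.
Qed.

End history_sums.

Section polya.
Context {R : realType} (N : nat) (a b : R) (v : 'I_N -> nat).
Local Notation mu := (@lebesgue_measure R).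

Definition past_sum (n : nat) : nat := (\sum_(l < N | (l < n)%N) v l)%N.

Lemma past_sumS (n : 'I_N) : past_sum n.+1 = (past_sum n + v n)%N.
Proof.
rewrite /past_sum (bigD1 n)//= addnC; congr (_ + _)%N; apply: eq_bigl => l.
by rewrite ltnS [RHS]ltn_neqAle andbC.
Qed.

Definition poisson_history (n : nat) (t : R) : R :=
  \prod_(l < N | (l < n)%N) poisson_mass t (v l).

Lemma poisson_historyS (n : 'I_N) t :
  poisson_history n.+1 t = poisson_history n t * poisson_mass t (v n).
Proof.
rewrite /poisson_history (bigD1 n)//= mulrC; congr (_ * _); apply: eq_bigl => l.
by rewrite ltnS [RHS]ltn_neqAle andbC.
Qed.

Definition history_fact (n : nat) : R := \prod_(l < N | (l < n)%N) (v l)`!%:R.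

Lemma history_factS (n : 'I_N) : history_fact n.+1 = history_fact n * (v n)`!%:R.
Proof.
rewrite /history_fact (bigD1 n)//= mulrC; congr (_ * _); apply: eq_bigl => l.
by rewrite ltnS [RHS]ltn_neqAle andbC.
Qed.

Lemma history_fact_gt0 n : 0 < history_fact n.
Proof. by apply: prodr_gt0 => l _; rewrite ltr0n fact_gt0. Qed.

Lemma poisson_historyE n t : (n <= N)%N -> 0 <= t ->
  poisson_history n t =
  t ^+ past_sum n * expR (- (n%:R * t)) / history_fact n.
Proof.
move=> + t0; elim: n => [_|n ih nN].
  by rewrite /poisson_history /past_sum /history_fact !big_pred0// expr0 mul0r oppr0 expR0
    !mul1r invr1.
have -> : n = Ordinal nN by [].
rewrite poisson_historyS past_sumS history_factS ih ?(ltnW nN)//= poisson_massE//.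
rewrite exprD -natr1 mulrDl mul1r opprD expRD; field.
by rewrite !gt_eqF ?history_fact_gt0// ltr0n fact_gt0.
Qed.

(** The integral of t ^ (a - 1) e ^ (- b t) against the Poisson probability of the
counts before round [n], in closed form ([polya_weight_integral]): the marginal
probability of these counts, up to a constant factor. *)
Definition polya_weight (n : nat) : R :=
  Gamma_fun (a + (past_sum n)%:R) /
  ((b + n%:R) `^ (a + (past_sum n)%:R) * history_fact n).

(** The Poisson likelihood multiplies the gamma integrand by t ^ S e ^ (- n t), with
S the sum of the past counts: gamma conjugacy. *)
Lemma polya_weight_integral n : (n <= N)%N -> 0 < b -> 0 < a + (past_sum n)%:R ->
  (\int[mu]_(t in `]0%R, +oo[)
     (t `^ (a - 1) * expR (- (b * t)) * poisson_history n t)%:E =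
   (polya_weight n)%:E)%E.
Proof.
move=> nN b0 a0; set S := past_sum n in a0 *.
have bn0 : 0 < b + n%:R by rewrite ltr_wpDr.
transitivity ((history_fact n)^-1%:E * gamma_integral (a + S%:R) (b + n%:R))%E.
  rewrite /gamma_integral -ge0_integralZl//; last 3 first.
  - by apply/measurable_EFinP/measurable_funTS; exact: measurable_gamma_integrand.
  - by move=> t _; rewrite lee_fin gamma_integrand_ge0.
  - by rewrite lee_fin invr_ge0 ltW// history_fact_gt0.
  apply: eq_integral => t; rewrite inE/= in_itv/= andbT => t0.
  rewrite -EFinM; congr EFin; rewrite poisson_historyE ?(ltW t0)// -/S.
  have -> : t `^ (a + S%:R - 1) = t `^ (a - 1) * t ^+ S.
    have := @powRD R t (a - 1) S%:R; rewrite powR_mulrn ?(ltW t0)// addrAC => -> //.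
    by rewrite (gt_eqF t0) implybT.
  by rewrite mulrDl opprD expRD; field; rewrite gt_eqF// history_fact_gt0.
rewrite gamma_integralE// -EFinM; congr EFin; rewrite /polya_weight -/S.
by field; rewrite !gt_eqF ?history_fact_gt0 ?powR_gt0.
Qed.

(** The ratio of successive marginal probabilities is the predictive probability of
the next count, a negative binomial with updated parameters. *)
Lemma polya_weightS (n : 'I_N) : 0 < b -> 0 < a + (past_sum n)%:R ->
  polya_weight n.+1 = polya_weight n *
    negbin_pmf (a + (past_sum n)%:R) (b + n.+1%:R)^-1 (v n).
Proof.
move=> b0 a0; rewrite /polya_weight /negbin_pmf past_sumS history_factS.
set r := a + (past_sum n)%:R; set x := v n.
have bn0 : 0 < b + n%:R by rewrite ltr_wpDr.
have bn1 : 0 < b + n.+1%:R by rewrite ltr_wpDr.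
have -> : a + (past_sum n + x)%:R = r + x%:R by rewrite natrD addrA.
have -> : 1 - (b + n.+1%:R)^-1 = (b + n%:R) / (b + n.+1%:R).
  by rewrite -natr1 addrA; field; rewrite -addrA natr1 gt_eqF.
rewrite powRM ?invr_ge0 ?(ltW bn0) ?(ltW bn1)//.
have -> : (b + n.+1%:R)^-1 `^ r = ((b + n.+1%:R) `^ r)^-1.
  by rewrite -[in LHS]powR_inv1 ?(ltW bn1)// -powRrM mulN1r powRN.
have -> : (b + n.+1%:R) `^ (r + x%:R) = (b + n.+1%:R) `^ r * (b + n.+1%:R) ^+ x.
  have := @powRD R (b + n.+1%:R) r x%:R; rewrite powR_mulrn ?(ltW bn1)// => -> //.
  by rewrite (gt_eqF bn1) implybT.
rewrite exprVn.
field.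
by rewrite !gt_eqF ?powR_gt0 ?history_fact_gt0 ?exprn_gt0 ?Gamma_fun_gt0 ?ltr0n ?fact_gt0.
Qed.

Lemma polya_weight_gt0 n : 0 < b -> 0 < a + (past_sum n)%:R -> 0 < polya_weight n.
Proof.
move=> b0 a0; rewrite divr_gt0 ?Gamma_fun_gt0// mulr_gt0 ?history_fact_gt0//.
by rewrite powR_gt0// ltr_wpDr.
Qed.

End polya.

(** * The histories of the labels given the new draws *)

(** The maps [f1] and [f2] compare measures on two different spaces through their
images in the bare type [U]. *)
Lemma pi_system_ext {R : realType} (U : Type) (G : set (set U))
    d1 (T1 : measurableType d1) d2 (T2 : measurableType d2)
    (m1 : {measure set T1 -> \bar R})
    (m2 : {measure set T2 -> \bar R}) (f1 : T1 -> U) (f2 : T2 -> U) :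
  setI_closed G ->
  (forall E, G E -> measurable (f1 @^-1` E)) ->
  (forall E, G E -> measurable (f2 @^-1` E)) ->
  (m1 setT < +oo)%E -> m1 setT = m2 setT ->
  (forall E, G E -> m1 (f1 @^-1` E) = m2 (f2 @^-1` E)) ->
  forall E, <<s G >> E -> m1 (f1 @^-1` E) = m2 (f2 @^-1` E).
Proof.
move=> GI mG1 mG2 fin1 mT eqG E sE.
have fin2 : (m2 setT < +oo)%E by rewrite -mT.
suff: [set E | [/\ measurable (f1 @^-1` E), measurable (f2 @^-1` E) &
    m1 (f1 @^-1` E) = m2 (f2 @^-1` E)]] E by case.
have : <<d G >> E by rewrite setI_closed_g_dynkin_g_sigma_algebra.
apply: smallest_sub => [|A GA]; last by split; [exact: mG1|exact: mG2|exact: eqG].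
split=> [|A [mA1 mA2 eqA]|F tF mF].
- by split; rewrite ?preimage_setT.
- split; rewrite -?preimage_setC; try exact: measurableC.
  rewrite -!setTD !measureD// ?setTI.
  + by congr (_ - _)%E; [exact: mT|exact: eqA].
have mF1 n : measurable (f1 @^-1` F n) by case: (mF n).
have mF2 n : measurable (f2 @^-1` F n) by case: (mF n).
have tpre (T : Type) (f : T -> U) : trivIset setT (fun n => f @^-1` F n).
  apply/trivIsetP => i j _ _ ij.
  by rewrite -preimage_setI ((trivIsetP.1 tF) i j)// preimage_set0.
split; rewrite ?preimage_bigcup; try exact: bigcupT_measurable.
rewrite !measure_bigcup//; apply: eq_eseriesr => n _.
by case: (mF n).
Qed.

Section sigma_closure.
Context {T : pointedType} (G : set (set T)).

Lemma g_sigma_setI A B : <<s G >> A -> <<s G >> B -> <<s G >> (A `&` B).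
Proof. exact: (@measurableI _ (g_sigma_algebraType G)). Qed.

Lemma g_sigma_bigsetI I (s : seq I) (P : pred I) (A : I -> set T) :
  (forall i, P i -> <<s G >> (A i)) -> <<s G >> (\big[setI/setT]_(i <- s | P i) A i).
Proof. exact: (@bigsetI_measurable _ (g_sigma_algebraType G)). Qed.

End sigma_closure.

Lemma bigsetI_seqP (I : choiceType) (T : Type) (r : seq I) (P : pred I)
    (A : I -> set T) (w : T) :
  (\big[setI/setT]_(i <- r | P i) A i) w <-> (forall i, i \in r -> P i -> A i w).
Proof.
rewrite -bigcap_seq_cond; split=> [Aw i ir Pi|Aw i /= /andP[ir Pi]].
  by apply: Aw; rewrite /= ir.
exact: Aw.
Qed.

Section history_law.
Context {R : realType} {dPsi : measure_display} {Psi : measurableType dPsi}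
  {N K : nat} {dO : measure_display} {O : measurableType dO}
  (Q : probability O R) (s : marginal_draws O Psi N K)
  (xi lam : R) (xifix lamfix : 'I_K -> R).
Hypothesis Y_step_one : step_one Q s xi lam xifix lamfix.
Local Notation label := (atom_label (N := N) (K := K)).
Implicit Types (i : label) (n m l : 'I_N) (v : 'I_N -> nat) (w : O).

Definition old (n : 'I_N) (i : label) : bool :=
  if i is inr (m, _, _) then (m < n)%N else true.

(** Weights at the rounds where the label is not yet an existing atom: the round m
at which it appears fixes its weight to x.+1, and before that it has none. *)
Definition first_weight (n : 'I_N) (i : label) : nat :=
  if i is inr (m, x, _) then if m == n then x.+1 else 0%N else 0%N.

Definition polya_prob (n : 'I_N) (i : label) v : R :=
  negbin_pmf (label_xi xi xifix i + (past_sum v n)%:R + 1)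
    (label_lam lam lamfix i + n.+1%:R)^-1 (v n).

(** The conditional mass function, at [v n], of the weight at round [n] of a label that
denotes an atom, given its weights [v] at the earlier rounds. *)
Definition step_prob (n : 'I_N) (i : label) v : R :=
  if old n i then polya_prob n i v else (v n == first_weight n i)%:R.

(** The part of the event that [i] is a real label that is decided by the new draws
of round [n]. *)
Definition label_event (n : 'I_N) (i : label) : set O :=
  if i is inr (m, _, _) then if m == n then [set w | is_label s i w] else setT
  else setT.

Lemma label_event_new n i : new_draws s n (label_event n i).
Proof.
case: i => [k|[[m x] j]] /=; first exact: (@measurableT _ (g_sigma_algebraType _)).
case: eqP => [->|_]; last exact: (@measurableT _ (g_sigma_algebraType _)).
apply: sub_sigma_algebra; left; exists x => //.
by exists [set c | (j < c)%N] => //; rewrite setTI.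
Qed.

Lemma new_draws_past n m : (m < n)%N -> new_draws s m `<=` past s n.
Proof.
move=> mn; apply: smallest_sub; first exact: smallest_sigma_algebra.
by move=> A [GA|GA]; apply: sub_sigma_algebra; exists m => //; left; [left|right].
Qed.

Lemma past_weight n m i x : (m < n)%N -> past s n [set w | label_weight s m i w = x].
Proof.
move=> mn; apply: sub_sigma_algebra; exists m => //; right; exists i => //.
by exists [set x] => //; rewrite setTI.
Qed.

Lemma measurable_label_weight n i : measurable_fun setT (label_weight s n i).
Proof.
have mc m x : measurable_fun setT (new_count s m x) by exact: measurable_funPT.
have md : measurable_fun setT (cond_draw s n i) by exact: measurable_funPT.
have ml : measurable_fun setT (is_label s i).
  case: i {md} => [k|[[m x] j]] /=; first exact: measurable_cst.
  apply: (measurable_fun_bool true); rewrite setTI.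
  by rewrite -[X in measurable X]setTI; apply: (mc m x measurableT [set c | (j < c)%N]).
rewrite /label_weight; apply: measurable_fun_ifT => //.
  by apply: measurable_and => //; case: i {md ml} => [|[[m x] j]] /=; exact: measurable_cst.
case: i {md} ml => [k|[[m x] j]] ml; first exact: measurable_cst.
by apply: measurable_fun_ifT => //; apply: measurable_and.
Qed.

Lemma past_measurable n : past s n `<=` measurable.
Proof.
apply: smallest_sub; first exact: sigma_algebra_measurable.
move=> A [m _ [[[x _]|[x _ [j _]]]|[i _]]] [B mB <-].
- exact: measurable_funPT.
- exact: measurable_funPT.
- exact: measurable_label_weight.
Qed.

Lemma new_draws_measurable n : new_draws s n `<=` measurable.
Proof.
apply: smallest_sub; first exact: sigma_algebra_measurable.
move=> A [[x _]|[x _ [j _]]] [B mB <-]; exact: measurable_funPT.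
Qed.

Section fixed_labels.
Variables (F : seq label) (v : label -> 'I_N -> nat) (C : 'I_N -> set O).
Hypothesis uF : uniq F.
Hypothesis newC : forall n, new_draws s n (C n).

Let C' n := C n `&` \big[setI/setT]_(i <- F) label_event n i.
Let W n := \big[setI/setT]_(i <- F) [set w | label_weight s n i w = v i n].
Let B (n : nat) := \big[setI/setT]_(m < N | (m < n)%N) C' m.
Let D (n : nat) := \big[setI/setT]_(m < N | (m < n)%N) (C' m `&` W m).

Let newC' n : new_draws s n (C' n).
Proof.
apply: g_sigma_setI; first exact: newC.
by apply: g_sigma_bigsetI => i _; exact: label_event_new.
Qed.

Let pastB n : past s n (B n).
Proof.
by apply: g_sigma_bigsetI => m mn; apply: (new_draws_past mn).
Qed.

Let pastD n : past s n (D n).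
Proof.
apply: g_sigma_bigsetI => m mn; apply: g_sigma_setI; first exact: (new_draws_past mn).
by apply: g_sigma_bigsetI => i _; exact: past_weight.
Qed.

Let FP (A : label -> set O) w :
  (\big[setI/setT]_(i <- F) A i) w <-> (forall i, i \in F -> A i w).
Proof. by split=> [/bigsetI_seqP H i iF|H]; [exact: H|apply/bigsetI_seqP => i iF _; exact: H]. Qed.

Let NP (A : 'I_N -> set O) (n : nat) w :
  (\big[setI/setT]_(m < N | (m < n)%N) A m) w <-> (forall m, (m < n)%N -> A m w).
Proof.
split=> [/bigsetI_seqP H i iF|H]; first by apply: H => //; rewrite mem_index_enum.
by apply/bigsetI_seqP => i _; exact: H.
Qed.

Let BS n : B n.+1 = B n `&` C' n.
Proof.
apply/seteqP; split => w; rewrite /B.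
  by move=> /NP H; split; [apply/NP => m mn; apply: H; exact: ltnW|exact: H].
move=> [/NP H Cw]; apply/NP => m; rewrite ltnS leq_eqVlt => /predU1P[/val_inj ->//|].
exact: H.
Qed.

Let DS n : D n.+1 = D n `&` (C' n `&` W n).
Proof.
apply/seteqP; split => w; rewrite /D.
  by move=> /NP H; split; [apply/NP => m mn; apply: H; exact: ltnW|exact: H].
move=> [/NP H Cw]; apply/NP => m; rewrite ltnS leq_eqVlt => /predU1P[/val_inj ->//|].
exact: H.
Qed.

Let old_existing n i w : D n w -> i \in F -> old n i -> existing s n i w.
Proof.
move=> /NP Dw iF; case: i iF => [k|[[m x] j]] iF //= mn.
rewrite /existing mn andbT; have [[_ /FP /(_ _ iF) H] _] := Dw m mn.
by move: H; rewrite /= eqxx.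
Qed.

Let new_weight n i w : C' n w -> i \in F -> ~~ old n i ->
  label_weight s n i w = first_weight n i.
Proof.
move=> [_ /FP Cw] iF; case: i iF => [k|[[m x] j]] iF //= nmn.
rewrite /label_weight /existing (negbTE nmn) andbF.
have := Cw _ iF; rewrite /=; case: eqP => [->|_ _]; last by rewrite andbF.
by rewrite /= => ->.
Qed.

(** The case of no label in the hypothesis on the existing atoms. *)
Lemma independent_rounds n C0 B0 : past s n B0 -> new_draws s n C0 ->
  Q (B0 `&` C0) = (Q B0 * Q C0)%E.
Proof.
move=> pB nC; have mB : measurable B0 by apply: (@past_measurable n).
have := @Y_step_one n fset0 (fun=> 0%N) B0 C0 pB nC.
rewrite bigcap_fset big_nil setIT => -> //; rewrite muleC; congr (_ * _)%E.
under eq_integral do rewrite big_nil.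
by rewrite integral_cst// mul1e.
Qed.

Let claim_step n :
  Q (D n.+1) = (Q (D n) * Q (C' n) * (\prod_(i <- F) step_prob n i (v i))%:E)%E.
Proof.
have mD : measurable (D n) by apply: (@past_measurable n); exact: pastD.
rewrite DS; set Fo := [seq i <- F | old n i].
(* If v contradicts a forced weight then both sides are 0. *)
have [ok|/allPn/=[i iF]] := boolP (all (fun i => old n i || (v i n == first_weight n i)) F);
  last first.
  rewrite negb_or => /andP[oi vi].
  rewrite [X in Q X](_ : _ = set0) ?measure0; last first.
    apply/seteqP; split => // w [_ [Cw /FP/(_ _ iF)/=]].
    by rewrite (new_weight Cw iF oi) => E; rewrite E eqxx in vi.
  rewrite (big_rem i)//= /step_prob (negbTE oi).
  by rewrite (negbTE vi) mul0r mule0.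
have okP i : i \in F -> ~~ old n i -> v i n = first_weight n i.
  by move=> iF oi; have := allP ok _ iF; rewrite (negbTE oi) => /eqP.
rewrite [X in Q X](_ : _ = D n `&` C' n `&`
    \bigcap_(i in [set` [fset i in Fo]%fset]) [set w | label_weight s n i w = v i n]); last first.
  rewrite setIA; apply/seteqP; split => w [[Dw Cw] H]; split => //.
    by move=> i /=; rewrite !inE mem_filter => /andP[_ iF]; move/FP: H; exact.
  apply/FP => i iF /=; have [oi|oi] := boolP (old n i).
    by apply: (H i); rewrite /= !inE mem_filter oi.
  by rewrite (new_weight Cw iF oi) okP.
rewrite Y_step_one//; last first.
  by move=> w i Dw; rewrite !inE mem_filter => /andP[oi iF]; exact: old_existing.
rewrite [RHS]muleAC muleC; congr (_ * _)%E.
transitivity (\int[Q]_(w in D n) cst (\prod_(i <- F) step_prob n i (v i))%:E w)%E; last first.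
  by rewrite integral_cst// muleC.
apply: eq_integral => w /set_mem Dw; congr EFin.
rewrite big_seq_fset_undup ?filter_uniq// big_filter [RHS](bigID (old n))/=.
rewrite [X in _ = _ * X]big1_seq ?mulr1 => [|i /andP[oi iF]]; last first.
  by rewrite /step_prob (negbTE oi) okP// eqxx.
rewrite big_seq_cond [RHS]big_seq_cond; apply: eq_bigr => i /andP[iF oi].
rewrite /step_prob oi /h_cond /polya_prob /past_sum.
do 4 f_equal; apply: eq_bigr => m mn; move/NP: Dw => /(_ m mn)[_ /FP/(_ i iF)]; exact.
Qed.

(** Round by round: the past only enters through the weights already fixed by [v],
and the new draws of a round are independent of its past ([independent_rounds]). *)
Lemma history_law_rounds :
  Q (\big[setI/setT]_(n < N) (C' n `&` W n)) =
  (Q (\big[setI/setT]_(n < N) C' n) * (\prod_n \prod_(i <- F) step_prob n i (v i))%:E)%E.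
Proof.
have claim (n : nat) : (n <= N)%N -> Q (D n) =
    (Q (B n) * (\prod_(m < N | (m < n)%N) \prod_(i <- F) step_prob m i (v i))%:E)%E.
  elim: n => [_|n ih nN]; first by rewrite /D /B !big_pred0// mule1.
  pose n' := Ordinal nN.
  rewrite -[n]/(val n') claim_step ih ?(ltnW nN)// (BS n') (@independent_rounds n')//.
  rewrite [in RHS](bigD1 n')//= EFinM.
  rewrite [X in _ = (_ * (_ * X%:E))%E](eq_bigl (fun m : 'I_N => (m < n)%N)); last first.
    by move=> m; rewrite ltnS [RHS]ltn_neqAle andbC.
  by rewrite (muleAC _ _ (Q (C' n'))) -[LHS]muleA; congr (_ * _)%E; rewrite muleC.
have all_lt : (fun m : 'I_N => (m < N)%N) =1 xpredT by move=> m; rewrite ltn_ord.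
by have := claim N (leqnn N); rewrite /D /B !(eq_bigl _ _ all_lt).
Qed.

End fixed_labels.

End history_law.

Section histories_given_draws.
Context {R : realType} {dPsi : measure_display} {Psi : measurableType dPsi}
  {N K : nat} {dO : measure_display} {O : measurableType dO}
  (Q : probability O R) (s : marginal_draws O Psi N K)
  (xi lam : R) (xifix lamfix : 'I_K -> R).
Hypothesis Y_step_one : step_one Q s xi lam xifix lamfix.
Local Notation label := (atom_label (N := N) (K := K)).
Local Notation hist := {ffun 'I_N -> nat}.
Implicit Types (i : label) (n m l : 'I_N) (v : label -> hist) (w : O).

Definition history (i : label) (w : O) : hist := [ffun n => label_weight s n i w].

Definition history_prob (i : label) (h : hist) : R :=
  \prod_n step_prob xi lam xifix lamfix n i h.

Hypothesis step_prob_ge0 : forall n i (h : hist), 0 <= step_prob xi lam xifix lamfix n i h.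

Definition draws_gen : set (set O) :=
  \bigcup_(i : 'I_N * nat + 'I_N * nat * nat) match i with
    | inl (n, x) => g_sigma_algebra_preimage (new_count s n x)
    | inr (n, x, j) => g_sigma_algebra_preimage (new_loc s n x j)
    end.

(** A label beyond the number of new atoms denotes no atom; its history is then 0. *)
Definition history_given_label (i : label) (w : O) (h : hist) : R :=
  if is_label s i w then history_prob i h else (h == [ffun=> 0%N])%:R.

Let isl i : set O := [set w | is_label s i w].
Let L (F : seq label) := \big[setI/setT]_(i <- F) isl i.
Let X (F : seq label) v := \big[setI/setT]_(i <- F) (history i @^-1` [set v i]).

Lemma history_prob_ge0 i h : 0 <= history_prob i h.
Proof. exact: prodr_ge0. Qed.

Lemma draws_gen_measurable : draws_gen `<=` measurable.
Proof. by move=> A [[[n x]|[[n x] j]] _ [B mB <-]]; exact: measurable_funPT. Qed.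

Let SM : <<s draws_gen>> `<=` measurable.
Proof.
by apply: smallest_sub draws_gen_measurable; exact: sigma_algebra_measurable.
Qed.

Lemma label_in_draws i : <<s draws_gen>> [set w | is_label s i w].
Proof.
case: i => [k|[[m x] j]].
  rewrite (_ : [set w | _] = setT); last by apply/seteqP; split.
  exact: (@measurableT _ (g_sigma_algebraType _)).
apply: sub_sigma_algebra; exists (inl (m, x)) => //.
by exists [set c | (j < c)%N] => //; rewrite setTI.
Qed.

Lemma measurable_history i h : measurable (history i @^-1` [set h]).
Proof.
rewrite (_ : _ @^-1` _ = \big[setI/setT]_(n < N) (label_weight s n i @^-1` [set h n])).
  apply: bigsetI_measurable => n _; rewrite -[X in measurable X]setTI.
  exact: measurable_label_weight.
apply/seteqP; split => w.
  by move=> /= <-; apply/bigsetI_seqP => n _ _; rewrite /= ffunE.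
move=> /bigsetI_seqP H; apply/ffunP => n; rewrite ffunE.
by apply: H => //; rewrite mem_index_enum.
Qed.

Let mL F : measurable (L F).
Proof. by apply: bigsetI_measurable => i _; apply: SM; exact: label_in_draws. Qed.

Let mX F v : measurable (X F v).
Proof. by apply: bigsetI_measurable => i _; exact: measurable_history. Qed.

Let rounds : set (set O) := [set A | exists C : 'I_N -> set O,
  (forall n, new_draws s n (C n)) /\ A = \big[setI/setT]_(n < N) C n].

Let rounds_setI : setI_closed rounds.
Proof.
move=> _ _ [C [nC ->]] [C1 [nC1 ->]]; exists (fun n => C n `&` C1 n); split.
  by move=> n; apply: g_sigma_setI; [exact: nC|exact: nC1].
by rewrite big_split.
Qed.

Let newT n : new_draws s n setT. Proof. exact: (@measurableT _ (g_sigma_algebraType _)). Qed.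

Let one_round n A : new_draws s n A -> rounds A.
Proof.
move=> nA; exists (fun m => if m == n then A else setT); split.
  by move=> m; case: eqP => [->|_].
by rewrite (bigD1 n)//= eqxx big1 ?setIT// => m /negbTE ->.
Qed.

Let draws_rounds : <<s draws_gen>> `<=` <<s rounds >>.
Proof.
apply: sub_smallest2r => // A [[[n x]|[[n x] j]] _ GA].
  by apply: (@one_round n); apply: sub_sigma_algebra; left; exists x.
by apply: (@one_round n); apply: sub_sigma_algebra; right; exists x => //; exists j.
Qed.

Let roundsM : rounds `<=` measurable.
Proof.
move=> A [C [nC ->]]; apply: bigsetI_measurable => n _.
exact: (@new_draws_measurable _ _ _ _ _ _ s n).
Qed.

Let big_label_event (F : seq label) (C : 'I_N -> set O) :
  \big[setI/setT]_(n < N) (C n `&` \big[setI/setT]_(i <- F) label_event s n i) =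
  (\big[setI/setT]_(n < N) C n) `&` L F.
Proof.
rewrite big_split/=; congr (_ `&` _); apply/seteqP; split => w.
  move=> /bigsetI_seqP H; apply/bigsetI_seqP => -[k|[[m x] j]] iF _ //.
  have /bigsetI_seqP := H m (mem_index_enum _) isT => /(_ _ iF isT).
  by rewrite /= eqxx.
move=> /bigsetI_seqP H; apply/bigsetI_seqP => n _ _; apply/bigsetI_seqP => i iF _.
by have := H _ iF isT; case: i {iF} => [k|[[m x] j]] //=; case: ifP.
Qed.

Let big_weights (F : seq label) v :
  \big[setI/setT]_(n < N) \big[setI/setT]_(i <- F) [set w | label_weight s n i w = v i n] =
  X F v.
Proof.
apply/seteqP; split => w.
  move=> /bigsetI_seqP H; apply/bigsetI_seqP => i iF _ /=; apply/ffunP => n.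
  by rewrite ffunE; have /bigsetI_seqP := H n (mem_index_enum _) isT => /(_ _ iF isT).
move=> /bigsetI_seqP H; apply/bigsetI_seqP => n _ _; apply/bigsetI_seqP => i iF _ /=.
by have /= <- := H _ iF isT; rewrite ffunE.
Qed.

(** Products of new draws of the rounds form a pi-system that generates all draws, so
[history_law_rounds] extends to every event of the draws. *)
Lemma history_law_labels (F : seq label) v B : uniq F -> <<s draws_gen>> B ->
  Q (B `&` (L F `&` X F v)) =
  (Q (B `&` L F) * (\prod_(i <- F) history_prob i (v i))%:E)%E.
Proof.
move=> uF /draws_rounds sB.
have q0 : 0 <= \prod_(i <- F) history_prob i (v i) by apply: prodr_ge0 => i _; exact:
  history_prob_ge0.
have mLX : measurable (L F `&` X F v) by exact: measurableI.
pose m1 : {measure set O -> \bar R} := mrestr Q mLX.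
pose m2 : {measure set O -> \bar R} := mscale (NngNum q0) (mrestr Q (mL F)).
have m1E A : m1 A = Q (A `&` (L F `&` X F v)) by [].
have m2E A : m2 A = ((\prod_(i <- F) history_prob i (v i))%:E * Q (A `&` L F))%E by [].
have eqm A : rounds A -> m1 A = m2 A.
  move=> [C [nC ->]].
  have := @history_law_rounds R _ _ _ _ _ _ Q s xi lam xifix lamfix Y_step_one F v C uF nC.
  rewrite big_label_event => E; rewrite m1E m2E muleC /history_prob exchange_big/= -E.
  congr (Q _); rewrite setIA -big_label_event -big_weights -big_split/=.
  by apply: eq_bigr.
have mT : m1 setT = m2 setT.
  by apply: eqm; exists (fun=> setT); split => //; rewrite big1.
have := @pi_system_ext R O rounds _ _ _ _ m1 m2 id id rounds_setI roundsM roundsM _ mT eqm _ sB.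
rewrite m2E m1E muleC; apply.
by rewrite setTI -ge0_fin_numE// fin_num_measure.
Qed.

Let mprob i h : measurable_fun setT (history_given_label i ^~ h).
Proof.
apply: measurable_fun_ifT => //; apply: (measurable_fun_bool true).
by rewrite setTI; apply: SM; exact: label_in_draws.
Qed.

Let pge0 i w h : 0 <= history_given_label i w h.
Proof. by rewrite /history_given_label; case: ifP => // _; exact: history_prob_ge0. Qed.

Let not_label_history i w : ~~ is_label s i w -> history i w = [ffun=> 0%N].
Proof.
move=> il; apply/ffunP => n; rewrite !ffunE /label_weight /existing (negbTE il)/=.
by case: i il => [//|[[m x] j] _].
Qed.

Let claim s1 s2 v B : uniq (s1 ++ s2) -> <<s draws_gen>> B ->
  (Q (B `&` (L s2 `&` X (s1 ++ s2) v)) =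
   \int[Q]_(w in B `&` L s2)
     (\prod_(i <- s1) history_given_label i w (v i) *
      \prod_(i <- s2) history_prob i (v i))%:E)%E.
Proof.
elim: s1 s2 B => [|i s1 ih] s2 B.
  rewrite cat0s => u sB; rewrite history_law_labels//.
  under eq_integral do rewrite big_nil mul1r.
  by rewrite integral_cst; [rewrite muleC|apply: measurableI => //; exact: SM].
rewrite cat_cons => u sB.
have mB : measurable B by exact: SM.
have sI : <<s draws_gen>> (isl i) by exact: label_in_draws.
have mI : measurable (isl i) by exact: SM.
set g := fun w => (\prod_(i <- i :: s1) history_given_label i w (v i) *
      \prod_(i <- s2) history_prob i (v i))%:E.
have mg : measurable_fun setT g.
  apply/measurable_EFinP; apply: measurable_funM => //.
  by apply: measurable_prod => j _; exact: mprob.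
have g0 w : (0 <= g w)%E.
  by rewrite lee_fin mulr_ge0// prodr_ge0// => j _; rewrite history_prob_ge0.
have u' : uniq (s1 ++ i :: s2) by rewrite uniq_catC/= mem_cat orbC -mem_cat uniq_catC.
have u'' : uniq (s1 ++ s2) by case/andP: u.
have XE : X (i :: s1 ++ s2) v = X (s1 ++ i :: s2) v.
  rewrite /X; apply: perm_big; apply/seq.permP => p; rewrite /= !count_cat/=; lia.
transitivity (Q ((B `&` L s2 `&` X (i :: s1 ++ s2) v) `&` isl i) +
   Q ((B `&` L s2 `&` X (i :: s1 ++ s2) v) `&` ~` isl i))%E.
  rewrite setIA -measureU//; last 3 first.
  - by apply: measurableI => //; apply: measurableI => //; exact: measurableI.
  - apply: measurableI; last exact: measurableC.
    by apply: measurableI => //; exact: measurableI.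
  - by rewrite setIACA setICr setI0.
  by rewrite -setIUr setUCr setIT.
transitivity (\int[Q]_(w in B `&` L s2 `&` isl i) g w +
    \int[Q]_(w in B `&` L s2 `&` ~` isl i) g w)%E; last first.
  rewrite -ge0_integral_setU//.
  - by rewrite -setIUr setUCr setIT.
  - by apply: measurableI => //; exact: measurableI.
  - by apply: measurableI; [exact: measurableI|exact: measurableC].
  - exact: measurable_funTS.
  - by apply/disj_setPS; rewrite setIACA setICr setI0.
congr (_ + _)%E.
  have := ih (i :: s2) B u' sB; rewrite /L !big_cons -/(L s2) => E.
  rewrite XE [X in Q X](_ : _ = B `&` (isl i `&` L s2 `&` X (s1 ++ i :: s2) v)); last first.
    by rewrite [isl i `&` _]setIC !setIA [LHS]setIAC.
  rewrite E (_ : B `&` (isl i `&` L s2) = B `&` L s2 `&` isl i); last first.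
    by rewrite [isl i `&` _]setIC setIA.
  apply: eq_integral => w /set_mem[_ li]; rewrite /g; congr EFin.
  by rewrite !big_cons {2}/history_given_label li; ring.
(* Off the label event the history of i is 0. *)
have [vi|vi] := eqVneq (v i) [ffun=> 0%N].
  have := ih s2 (B `&` ~` isl i) u'' (g_sigma_setI sB (@sigma_algebraC _ _ _ sI)) => E.
  rewrite [X in Q X](_ : _ = B `&` ~` isl i `&` (L s2 `&` X (s1 ++ s2) v)); last first.
    apply/seteqP; split => w.
      by rewrite /X big_cons => -[[[Bw Lw] [_ Xw]] nw].
    move=> [[Bw nw] [Lw Xw]]; split => //; split => //; rewrite /X big_cons; split => //.
    by rewrite /= vi; apply: not_label_history; exact/negP.
  rewrite E (_ : B `&` ~` isl i `&` L s2 = B `&` L s2 `&` ~` isl i); last by rewrite setIAC.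
  apply: eq_integral => w /set_mem[_ /negP/negbTE li]; rewrite /g; congr EFin.
  by rewrite big_cons [in RHS]/history_given_label li vi eqxx mul1r.
rewrite [X in Q X](_ : _ = set0); last first.
  apply/seteqP; split => // w [[_]]; rewrite /X big_cons => -[/= hv _] /negP li.
  by rewrite -hv not_label_history ?eqxx// in vi.
rewrite measure0 integral0_eq// => w [_ /negP/negbTE li].
by rewrite /g big_cons {1}/history_given_label li (negbTE vi) !mul0r.
Qed.

(** Each label is split off according to whether it denotes an atom: on that event
[history_law_labels] applies, off it the history is 0. *)
Lemma history_cond_law (F : seq label) v B : uniq F -> <<s draws_gen>> B ->
  (Q (B `&` \big[setI/setT]_(i <- F) (history i @^-1` [set v i])) =
   \int[Q]_(w in B) (\prod_(i <- F) history_given_label i w (v i))%:E)%E.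
Proof.
move=> uF sB; have := @claim F [::] v B; rewrite cats0.
have -> : L [::] = setT by rewrite /L big_nil.
rewrite setIT setTI => -> //.
by apply: eq_integral => w _; rewrite big_nil mulr1.
Qed.

End histories_given_draws.

(** * The Laplace transform of a history *)

Lemma negbin_pmf_ge0 {R : realType} (r p : R) x : 0 <= p -> 0 <= negbin_pmf r p x.
Proof.
move=> p0; have Gamma_ge0 a : 0 <= Gamma_fun a :> R.
  by apply: Rintegral_ge0 => t _; rewrite mulr_ge0 ?powR_ge0 ?expR_ge0.
by rewrite !mulr_ge0 ?invr_ge0 ?mulr_ge0 ?powR_ge0 ?exprn_ge0 ?ler0n.
Qed.

Section poisson_mass_half_line.
Context {R : realType}.

Lemma poisson_mass_gt0 (t : R) x : 0 < t -> 0 < poisson_mass t x.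
Proof.
move=> t0; rewrite poisson_massE ?ltW// mulr_gt0 ?expR_gt0// divr_gt0 ?exprn_gt0//.
Qed.

Lemma measurable_poisson_mass x :
  measurable_fun (`]0, +oo[%classic : set R) (fun t : R => poisson_mass t x).
Proof.
apply: (@eq_measurable_fun _ _ _ _ _ (fun t : R => t ^+ x / x`!%:R * expR (- t))).
  by move=> t; rewrite inE/= in_itv/= andbT => /ltW t0; rewrite poisson_massE.
apply: measurable_funTS; apply: measurable_funM.
  by apply: measurable_funM => //; exact: measurable_funX.
by apply: measurableT_comp => //; exact: measurableT_comp.
Qed.

End poisson_mass_half_line.

Section label_laplace.
Context {R : realType} {N K : nat}.
Variables (xi lam : R) (xifix lamfix : 'I_K -> R).
Hypothesis xi_gt : -2 < xi.
Hypothesis lam_gt0 : 0 < lam.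
Hypothesis xifix_gt : forall k, -1 < xifix k.
Hypothesis lamfix_gt0 : forall k, 0 < lamfix k.
Local Notation label := (atom_label (N := N) (K := K)).
Local Notation hist := {ffun 'I_N -> nat}.
Local Notation mu := (@lebesgue_measure R).
Local Notation stepp := (step_prob xi lam xifix lamfix).
Implicit Types (i : label) (n m l : 'I_N) (h : hist) (sigma : 'I_N -> R).

Let lam_i i : 0 < label_lam lam lamfix i.
Proof. by rewrite /label_lam; case: i => [k|_]. Qed.

Lemma step_prob_ge0 n i h : 0 <= stepp n i h.
Proof.
rewrite /step_prob; case: ifP => // _; apply: negbin_pmf_ge0.
by rewrite invr_ge0 addr_ge0// ltW.
Qed.

(** The first round at which the label is an existing atom, see [oldE]. *)
Definition start i : nat := if i is inr (m, _, _) then m.+1 else 0.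

Lemma oldE n i : old n i = (start i <= n)%N.
Proof. by case: i => [k|[[m x] j]]. Qed.

Lemma start_le i : (start i <= N)%N.
Proof. by case: i => [k|[[m x] j]] //=. Qed.

(** The weights before [start i], which the label itself determines. *)
Definition birth i : hist := [ffun n => first_weight n i].

Local Notation shape i := (label_xi xi xifix i + 1).
Local Notation rate i := (label_lam lam lamfix i).

Lemma past_sum_birth i : past_sum (birth i) (start i) =
  if i is inr (_, x, _) then x.+1 else 0%N.
Proof.
rewrite /past_sum; case: i => [k|[[m x] j]] /=; first by rewrite big_pred0.
rewrite (bigD1 m)//= ffunE /= eqxx big1 ?addn0// => l /andP[_ lm].
by rewrite ffunE/= eq_sym (negbTE lm).
Qed.

Let shape_gt0 i : 0 < shape i + (past_sum (birth i) (start i))%:R.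
Proof.
rewrite past_sum_birth; case: i => [k|[[m x] j]] /=.
  by rewrite addr0 -ltrBlDr sub0r.
have : 0 <= x%:R :> R by [].
have -> : x.+1%:R = x%:R + 1 :> R by rewrite natr1.
move: xi_gt; lra.
Qed.

(** Normalises the mixing density over theta: for a fixed location the gamma
integral, for a new atom [new_atom_mean] divided by [gam] ([new_atom_meanE]). *)
Definition birth_weight i : R := polya_weight (shape i) (rate i) (birth i) (start i).

Lemma birth_weight_gt0 i : 0 < birth_weight i.
Proof. exact: polya_weight_gt0. Qed.

Definition born h i := [forall l : 'I_N, (l < start i)%N ==> (h l == birth i l)].

Let shape_past_gt0 i h (n : nat) : born h i -> (start i <= n)%N ->
  0 < shape i + (past_sum h n)%:R.
Proof.
move=> /forallP hb sn; apply: (lt_le_trans (shape_gt0 i)).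
rewrite lerD2l ler_nat /past_sum/= big_mkcond [leqRHS]big_mkcond/=.
apply: leq_sum => l _; case: ifPn => // ls; have := hb l; rewrite ls => /eqP ->.
by rewrite (leq_trans ls).
Qed.

Lemma eq_polya_weight (a b : R) (v v' : 'I_N -> nat) (n : nat) :
  (forall l : 'I_N, (l < n)%N -> v l = v' l) ->
  polya_weight a b v n = polya_weight a b v' n.
Proof.
move=> vv; rewrite /polya_weight; have -> : past_sum v n = past_sum v' n by apply: eq_bigr => l /vv.
suff -> : history_fact v n = history_fact v' n :> R by [].
by apply: eq_bigr => l /vv ->.
Qed.

Let partial_prob i h (n : nat) : born h i -> (start i <= n <= N)%N ->
  birth_weight i * \prod_(l < N | (l < n)%N) stepp l i h =
  polya_weight (shape i) (rate i) h n.
Proof.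
move=> bh; have /forallP hb := bh; elim: n => [|n ih] /andP[]; rewrite leq_eqVlt =>
  /predU1P[n0|n0] nN.
- rewrite big_pred0 ?mulr1// /birth_weight n0.
  by apply: eq_polya_weight => l.
- by rewrite ltn0 in n0.
- rewrite big1 ?mulr1.
    rewrite /birth_weight n0; apply: eq_polya_weight => l ln.
    by have := hb l; rewrite n0 ln => /eqP.
  move=> l ln; rewrite /step_prob oldE leqNgt n0 ln/=.
  by have := hb l; rewrite n0 ln ffunE => /eqP ->; rewrite eqxx.
- have -> : n = Ordinal nN by [].
  rewrite polya_weightS ?lam_i//; last exact: (shape_past_gt0 bh).
  have /= <- := ih _; last by rewrite -ltnS n0 ltnW.
  rewrite -[RHS]mulrA; congr (_ * _).
  rewrite (bigD1 (Ordinal nN))//= mulrC; congr (_ * _).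
    apply: eq_bigl => l; rewrite ltnS [RHS]ltn_neqAle andbC.
    by congr (_ && _).
  rewrite /step_prob oldE /= -ltnS n0 /polya_prob /=.
  by rewrite addrAC.
Qed.

Local Notation base i t := (t `^ (shape i - 1) * expR (- (rate i * t))).

(** Before the label is an existing atom, its weight is forced; the Poisson factor
then accounts for the probability of that weight in the mixture. *)
Definition history_kernel i n (t : R) (y : nat) : R :=
  poisson_mass t y * (if old n i then 1 else (y == birth i n)%:R).

(** The negative binomial probabilities multiply up to a ratio of [polya_weight]s by
[polya_weightS], and these are integrals of Poisson histories.  A history that
contradicts the label has probability 0 on both sides. *)
Lemma history_prob_mixture i h :
  ((birth_weight i * history_prob xi lam xifix lamfix i h)%:E =
   \int[mu]_(t in `]0%R, +oo[) (base i t * \prod_n history_kernel i n t (h n))%:E)%E.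
Proof.
have [hb|hb] := boolP (born h i).
  have := @partial_prob i h N hb; rewrite start_le leqnn => /(_ isT).
  rewrite (eq_bigl xpredT); last by move=> l; rewrite ltn_ord.
  rewrite -/(history_prob _ _ _ _ i h) => ->.
  rewrite -polya_weight_integral//; last exact: (shape_past_gt0 hb (start_le i)).
  apply: eq_integral => t _; congr (_ * _)%:E.
  rewrite /poisson_history [LHS](eq_bigl xpredT); last by move=> l; rewrite ltn_ord.
  apply: eq_bigr => l _; rewrite /history_kernel oldE leqNgt.
  case: ltnP => ls /=; rewrite ?mulr1//.
  by have /forallP/(_ l) := hb; rewrite ls => /= ->; rewrite mulr1.
move: hb; rewrite negb_forall => /existsP[l]; rewrite negb_imply => /andP[ls /negbTE hl].
rewrite /history_prob (bigD1 l)//= {1}/step_prob oldE leqNgt ls/=.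
rewrite ffunE in hl; rewrite hl mul0r mulr0 integral0_eq// => t _.
by rewrite (bigD1 l)//= {1}/history_kernel oldE leqNgt ls/= ffunE hl mulr0 mul0r mulr0.
Qed.

Definition label_laplace i sigma : \bar R :=
  \esum_(h in [set: hist])
    (history_prob xi lam xifix lamfix i h * expR (- \sum_n sigma n * (h n)%:R))%:E.

Definition step_laplace i sigma n (t : R) : R :=
  if old n i then expR (- (t * (1 - expR (- sigma n))))
  else poisson_mass t (birth i n) * expR (- (sigma n * (birth i n)%:R)).

Let step_laplaceE i sigma n t : 0 < t -> 0 <= sigma n ->
  \esum_(y in [set: nat]) (history_kernel i n t y * expR (- (sigma n * y%:R)))%:E
  = (step_laplace i sigma n t)%:E.
Proof.
move=> t0 s0; rewrite /step_laplace /history_kernel; case: ifPn => _.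
  rewrite -poisson_laplace ?(ltW t0)//.
  by apply: eq_esum => y _; rewrite mulr1.
rewrite (esumID [set birth i n])//; last first.
  by move=> y _; rewrite lee_fin !mulr_ge0 ?poisson_mass_ge0 ?expR_ge0.
rewrite setTI esum_set1 ?eqxx ?mulr1//; last first.
  by rewrite lee_fin mulr_ge0 ?poisson_mass_ge0 ?expR_ge0.
rewrite esum1 ?adde0// => y [_ /= /eqP/negbTE ->].
by rewrite mulr0 mul0r.
Qed.

Let base_ge0 i t : 0 <= base i t.
Proof. by rewrite mulr_ge0 ?powR_ge0 ?expR_ge0. Qed.

Let mbase i : measurable_fun (`]0, +oo[%classic : set R) (fun t => base i t).
Proof. by apply: measurable_funTS; exact: measurable_gamma_integrand. Qed.

Let kernel_ge0 i n t y : 0 <= history_kernel i n t y.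
Proof. by rewrite mulr_ge0 ?poisson_mass_ge0//; case: ifP. Qed.

(** Under the mixture the rounds are independent given theta, so the sum over
histories factors into one sum for each round. *)
Lemma label_laplaceE i sigma : (forall n, 0 <= sigma n) ->
  ((birth_weight i)%:E * label_laplace i sigma =
   \int[mu]_(t in `]0%R, +oo[) (base i t * \prod_n step_laplace i sigma n t)%:E)%E.
Proof.
move=> s0.
transitivity (\int[mu]_(t in `]0%R, +oo[)
   (\esum_(h in [set: hist]) (base i t *
      \prod_n (history_kernel i n t (h n) * expR (- (sigma n * (h n)%:R))))%:E))%E; last first.
  apply: eq_integral => t; rewrite inE/= in_itv/= andbT => t0.
  under eq_esum do rewrite EFinM.
  rewrite ge0_esumZl//; last first.
    by move=> h; rewrite lee_fin prodr_ge0// => n _; rewrite mulr_ge0 ?expR_ge0.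
  rewrite (@esum_prod_ffun _ _ (fun n y => history_kernel i n t y * expR (- (sigma n * y%:R)))
    (fun n => step_laplace i sigma n t))//.
    by move=> n y; rewrite mulr_ge0 ?expR_ge0.
  by move=> n; exact: step_laplaceE.
rewrite ge0_integral_esum_dom//; last 2 first.
- move=> h; apply/measurable_EFinP; apply: measurable_funM; first exact: mbase.
  apply: measurable_prod => n _; apply: measurable_funM => //.
  by apply: measurable_funM => //; exact: measurable_poisson_mass.
- move=> h t _; rewrite lee_fin mulr_ge0// prodr_ge0// => n _.
  by rewrite mulr_ge0 ?expR_ge0.
have bw := birth_weight_gt0 i.
rewrite /label_laplace -ge0_esumZl ?(ltW bw)//; last first.
  by move=> h; rewrite lee_fin mulr_ge0 ?expR_ge0// prodr_ge0// => n _; exact: step_prob_ge0.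
apply: eq_esum => h _; rewrite -EFinM mulrA EFinM history_prob_mixture muleC.
rewrite -ge0_integralZl//; last 2 first.
- apply/measurable_EFinP; apply: measurable_funM; first exact: mbase.
  apply: measurable_prod => n _.
  by apply: measurable_funM => //; exact: measurable_poisson_mass.
- by move=> t _; rewrite lee_fin mulr_ge0// prodr_ge0.
apply: eq_integral => t _; rewrite -EFinM; congr EFin.
rewrite -sumrN expR_sum mulrCA -big_split/=; congr (_ * _).
by apply: eq_bigr => n _; rewrite mulrC.
Qed.

(** The zero exponent shows that [history_prob] has total mass 1. *)
Lemma label_laplace0 i : label_laplace i (fun=> 0) = 1%E.
Proof.
have E := @label_laplaceE i (fun=> 0) (fun=> lexx 0); move: E.
rewrite (_ : integral _ _ _ = (birth_weight i)%:E).
  have bw := birth_weight_gt0 i.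
  move=> /(congr1 (fun z => (birth_weight i)^-1%:E * z)%E).
  by rewrite muleA -EFinM mulVf ?gt_eqF// mul1e.
rewrite /birth_weight -polya_weight_integral ?start_le//.
apply: eq_integral => t _; congr (_ * _)%:E.
rewrite /poisson_history [RHS]big_mkcond/=; apply: eq_bigr => n _.
rewrite /step_laplace oldE leqNgt; case: ltnP => _ /=.
  by rewrite mul0r oppr0 expR0 mulr1.
by rewrite oppr0 expR0 subrr mulr0 oppr0 expR0.
Qed.

Lemma label_laplace_le1 i sigma : (forall n, 0 <= sigma n) ->
  (label_laplace i sigma <= 1)%E.
Proof.
move=> s0; rewrite -(label_laplace0 i); apply: le_esum => h _; rewrite lee_fin.
apply: ler_wpM2l; first by apply: prodr_ge0 => n _; exact: step_prob_ge0.
rewrite ler_expR lerN2; apply: ler_sum => n _.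
by rewrite mul0r mulr_ge0.
Qed.

Lemma measurable_step_product i sigma :
  measurable_fun (`]0, +oo[%classic : set R)
    (fun t => base i t * \prod_n step_laplace i sigma n t).
Proof.
apply: measurable_funM; first exact: mbase.
apply: measurable_prod => n _; rewrite /step_laplace; case: (old n i).
  apply: measurable_funTS; apply: measurableT_comp => //.
  by apply: measurableT_comp => //; exact: measurable_funM.
by apply: measurable_funM => //; exact: measurable_poisson_mass.
Qed.

Lemma label_laplace_gt0 i sigma : (forall n, 0 <= sigma n) ->
  (0 < label_laplace i sigma)%E.
Proof.
move=> s0; have bw := birth_weight_gt0 i.
rewrite -(@pmule_rgt0 _ (birth_weight i)%:E)// label_laplaceE//.
apply: half_line_integral_gt0.
  exact: measurable_step_product.
move=> t t0; rewrite mulr_gt0//.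
  by rewrite mulr_gt0 ?powR_gt0 ?expR_gt0.
apply: prodr_gt0 => n _; rewrite /step_laplace; case: ifP => _; first exact: expR_gt0.
by rewrite mulr_gt0 ?poisson_mass_gt0 ?expR_gt0.
Qed.

End label_laplace.

(** * Compound Poisson sums *)

Section compound_poisson.
Context {R : realType} {d : measure_display} {T : measurableType d}
  {dPsi : measure_display} {Psi : measurableType dPsi} {H : countType}
  (P : probability T R) (G : probability Psi R).
Variables (cnt : H -> T -> nat) (loc : H -> nat -> T -> Psi)
  (M : H -> R) (gamma : H -> Psi -> R).
Hypothesis M0 : forall g, 0 <= M g.
Hypothesis mcnt : forall g, measurable_fun setT (cnt g).
Hypothesis mloc : forall g j, measurable_fun setT (loc g j).
Hypothesis mgamma : forall g, measurable_fun setT (gamma g).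
Hypothesis gamma01 : forall g p, 0 < gamma g p <= 1.
Hypothesis cnt_law : forall g v, P (cnt g @^-1` [set v]) = (poisson_mass (M g) v)%:E.
Hypothesis loc_law : forall g j A, measurable A -> P (loc g j @^-1` A) = G A.
Let S (i : (H + H * nat)%type) : set (set T) :=
  match i with
  | inl g => g_sigma_algebra_preimage (cnt g)
  | inr (g, j) => g_sigma_algebra_preimage (loc g j)
  end.
Hypothesis indS : mutually_independent P S.

Let gamma0 g p : 0 < gamma g p. Proof. by case/andP: (gamma01 g p). Qed.
Let gamma_ge0 g p : 0 <= gamma g p. Proof. exact: ltW. Qed.
Let gamma1 g p : gamma g p <= 1. Proof. by case/andP: (gamma01 g p). Qed.

Definition mean_gamma g : \bar R := (\int[G]_p (gamma g p)%:E)%E.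

Let mean_gamma01 g : (0 <= mean_gamma g <= 1)%E.
Proof.
apply: integral_unit_interval => // p.
by rewrite gamma_ge0 gamma1.
Qed.

Let gbar g : R := fine (mean_gamma g).

Let gbarE g : (gbar g)%:E = mean_gamma g.
Proof.
have /andP[m0 m1] := mean_gamma01 g.
by rewrite fineK// ge0_fin_numE// (le_lt_trans m1)// ltry.
Qed.

Let gbar0 g : 0 <= gbar g.
Proof. by rewrite -lee_fin gbarE; case/andP: (mean_gamma01 g). Qed.

Let gbar1 g : gbar g <= 1.
Proof. by rewrite -lee_fin gbarE; case/andP: (mean_gamma01 g). Qed.

Let F (v : H -> nat) (i : (H + H * nat)%type) (w : T) : R :=
  match i with
  | inl g => (cnt g w == v g)%:R
  | inr (g, j) => gamma g (loc g j w)
  end.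

Let mF v i : measurable_fun setT (F v i).
Proof.
case: i => [g|[g j]]; last exact: measurableT_comp (mgamma g) (mloc g j).
have m1 : measurable_fun setT (fun n : nat => (n == v g)%:R : R) by [].
exact: measurableT_comp m1 (mcnt g).
Qed.

Let block v g w : R := (cnt g w == v g)%:R * \prod_(j < v g) gamma g (loc g j w).
Let W g w : R := \prod_(j < cnt g w) gamma g (loc g j w).

Let base r v : uniq r ->
  (\int[P]_w (\prod_(g <- r) block v g w)%:E =
   \prod_(g <- r) (poisson_mass (M g) (v g) * gbar g ^+ v g)%:E)%E.
Proof.
move=> ur.
(* The variables of the block of g: its count, then its first v g locations. *)
pose e g k : (H + H * nat)%type := if k is j.+1 then inr (g, j) else inl g.
pose t := [seq e g k | g <- r, k <- iota 0 (v g).+1].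
have iota1E n : iota 1 n = index_iota 1 n.+1 by rewrite /index_iota subn1.
have ut : uniq t.
  apply: allpairs_uniq_dep => //; first by move=> g _; exact: iota_uniq.
  move=> [g k] [g' k'] _ _ /=; rewrite /e.
  by case: k k' => [|k] [|k'] // [->] // ->.
transitivity (\int[P]_w (\prod_(i <- t) F v i w)%:E)%E.
  apply: eq_integral => w _; congr EFin; rewrite big_allpairs_dep/=.
  apply: eq_bigr => g _; rewrite big_cons/= /block; congr (_ * _).
  by rewrite iota1E big_add1/= big_mkord.
rewrite (@integral_prod_indep _ _ _ _ _ S)//; first last.
- move=> [g|[g j]] w /=; last by rewrite gamma_ge0 gamma1.
  by case: eqP; rewrite ?lexx ?ler01.
- move=> [g|[g j]] B mB /=.
    exists [set n : nat | B (n == v g)%:R] => //.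
    by rewrite setTI.
  exists (gamma g @^-1` B); last by rewrite setTI.
  by rewrite -[X in measurable X]setTI; exact: mgamma.
- by move=> [g|[g j]] A [B mB <-]; [exact: mcnt|exact: mloc].
rewrite big_allpairs_dep/=; apply: eq_bigr => g _.
rewrite big_cons/= EFinM; congr (_ * _)%E.
  rewrite -cnt_law -[RHS]mul1e -integral_cst; last first.
    by rewrite -[X in measurable X]setTI; exact: mcnt.
  rewrite integral_mkcond; apply: eq_integral => w _.
  rewrite patchE; have [wv|wv] := eqVneq (cnt g w) (v g); first by rewrite mem_set.
  by rewrite memNset//=; exact/eqP.
rewrite iota1E big_add1/= big_mkord.
rewrite (eq_bigr (fun=> (gbar g)%:E)) ?prodEFin ?prodr_const ?card_ord// => j _.
rewrite gbarE /mean_gamma.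
transitivity (\int[pushforward P (loc g j)]_p (gamma g p)%:E)%E.
  rewrite ge0_integral_pushforward//; first exact/measurable_EFinP.
  by move=> p _; rewrite lee_fin.
by apply: eq_measure_integral => A mA _; exact: loc_law.
Qed.

Let block0 x h w : 0 <= block x h w.
Proof. by rewrite mulr_ge0 ?ler0n ?prodr_ge0. Qed.

Let W0 h w : 0 <= W h w. Proof. by rewrite prodr_ge0. Qed.

Let mblock x h : measurable_fun setT (block x h).
Proof.
apply: measurable_funM; first exact: (mF x (inl h)).
by apply: measurable_prod => j _; exact: (mF x (inr (h, nat_of_ord j))).
Qed.

Let mW h : measurable_fun setT (W h).
Proof.
have -> : W h = (fun w => fine (\esum_(x in [set: nat]) (block (fun=> x) h w)%:E)).
  apply/funext => w; rewrite (esumID [set cnt h w])//; last first.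
    by move=> x _; rewrite lee_fin.
  rewrite setTI esum_set1 ?lee_fin// esum1 ?adde0 ?/block ?eqxx ?mul1r//.
  by move=> x [_ /= /eqP/negbTE xg]; rewrite /block eq_sym xg mul0r.
apply: measurableT_comp => //; apply: measurable_esum => x.
  exact/measurable_EFinP.
by move=> w; rewrite lee_fin.
Qed.

Let claim s r v : uniq (s ++ r) ->
  (\int[P]_w (\prod_(g <- s) W g w * \prod_(g <- r) block v g w)%:E =
   \prod_(g <- s) (expR (- (M g * (1 - gbar g))))%:E *
   \prod_(g <- r) (poisson_mass (M g) (v g) * gbar g ^+ v g)%:E)%E.
Proof.
elim: s r v => [|g s ih] r v /=.
  move=> ur; rewrite big_nil mul1e -base//.
  by apply: eq_integral => w _; rewrite big_nil mul1r.
move=> /andP[gsr usr].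
(* The count of g is summed over: g moves from the random products to the blocks
   with prescribed count x. *)
pose vx x h := if h == g then x else v h.
have gr h : h \in r -> h == g = false.
  move=> hr; apply/negbTE; apply: contraNneq gsr => <-.
  by rewrite mem_cat hr orbT.
have E x w : \prod_(h <- g :: r) block (vx x) h w =
    (cnt g w == x)%:R * (\prod_(j < x) gamma g (loc g j w)) * \prod_(h <- r) block v h w.
  have vxg : vx x g = x by rewrite /vx eqxx.
  rewrite big_cons {1}/block vxg; congr (_ * _).
  by apply: eq_big_seq => h /gr hg; rewrite /block /vx hg.
transitivity (\int[P]_w \esum_(x in [set: nat])
    (\prod_(h <- s) W h w * \prod_(h <- g :: r) block (vx x) h w)%:E)%E.
  apply: eq_integral => w _.
  rewrite (esumID [set cnt g w])//; last first.
    by move=> x _; rewrite lee_fin mulr_ge0 ?prodr_ge0.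
  rewrite setTI esum_set1; last by rewrite lee_fin mulr_ge0 ?prodr_ge0.
  rewrite esum1 ?adde0; last first.
    move=> x [_ /= /eqP/negbTE xg]; rewrite E eq_sym xg !mul0r mulr0//.
  by rewrite E eqxx mul1r big_cons /W; congr EFin; rewrite -mulrA mulrCA.
rewrite ge0_integral_esum//; last 2 first.
- move=> x; apply/measurable_EFinP; apply: measurable_funM; apply: measurable_prod => h _ //.
- by move=> x w; rewrite lee_fin mulr_ge0 ?prodr_ge0.
have u' : uniq (s ++ g :: r) by rewrite uniq_catC/= mem_cat orbC -mem_cat uniq_catC gsr.
under eq_esum do rewrite (ih _ _ u').
set A := (\prod_(h <- s) _)%E.
set B := (\prod_(h <- r) (poisson_mass (M h) (v h) * gbar h ^+ v h))%R.
transitivity (\esum_(x in [set: nat]) ((A * B%:E) * (poisson_mass (M g) x * gbar g ^+ x)%:E))%E.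
  apply: eq_esum => x _; rewrite big_cons /vx eqxx -muleA; congr (_ * _)%E.
  rewrite muleC; congr (_ * _)%E; rewrite prodEFin; congr EFin.
  by apply: eq_big_seq => h /gr ->.
have -> : A = (\prod_(h <- s) expR (- (M h * (1 - gbar h))))%:E by rewrite /A prodEFin.
set a := \prod_(h <- s) _.
have a0 : 0 <= a by apply: prodr_ge0 => h _; exact: expR_ge0.
have B0 : 0 <= B.
  by apply: prodr_ge0 => h _; rewrite mulr_ge0 ?poisson_mass_ge0 ?exprn_ge0.
rewrite -EFinM ge0_esumZl ?mulr_ge0//; last first.
  by move=> x; rewrite lee_fin mulr_ge0 ?poisson_mass_ge0 ?exprn_ge0.
rewrite poisson_pgf// !prodEFin -!EFinM big_cons -/a -/B; congr EFin; ring.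
Qed.

Lemma compound_poisson_pgf s : uniq s ->
  (\int[P]_w (\prod_(g <- s) \prod_(j < cnt g w) gamma g (loc g j w))%:E =
   \prod_(g <- s) expN ((M g)%:E * (1 - mean_gamma g)))%E.
Proof.
move=> us; have := @claim s [::] (fun=> 0%N); rewrite cats0 => /(_ us).
rewrite big_nil mule1 (eq_integral (fun w => (\prod_(g <- s) W g w)%:E)); last first.
  by move=> w _; rewrite big_nil mulr1.
by move=> ->; apply: eq_bigr => g _; rewrite -gbarE -EFinB -EFinM expN_EFin.
Qed.

Definition compound_exponent : \bar R :=
  (\esum_(g in [set: H]) ((M g)%:E * (1 - mean_gamma g)))%E.

(** For finitely many groups, expanding over the values of the counts leaves a product
of functions of independent variables; each group then sums to a Poisson
generating function at the mean of [gamma].  Countably many groups are reached by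
dominated convergence. *)
Lemma compound_poisson_laplace :
  (\int[P]_w expN (\esum_(g in [set: H])
      (\sum_(j < cnt g w) - ln (gamma g (loc g j w)))%:E) =
   expN compound_exponent)%E.
Proof.
pose u (g : H) w : R := \sum_(j < cnt g w) - ln (gamma g (loc g j w)).
have u0 g w : 0 <= u g w by rewrite sumr_ge0// => j _; rewrite oppr_ge0 ln_le0.
have uE g w : expN (u g w)%:E = (W g w)%:E.
  rewrite expN_EFin -sumrN expR_sum; congr EFin; apply: eq_bigr => j _.
  by rewrite opprK lnK// posrE.
have mu g : measurable_fun setT (u g).
  have -> : u g = (fun w => - ln (W g w)).
    apply/funext => w; have [<-] := uE g w.
    by rewrite expRK opprK.
  by apply: measurableT_comp => //; apply: measurableT_comp => //.
have d0 g : (0 <= (M g)%:E * (1 - mean_gamma g))%E.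
  by rewrite mule_ge0 ?lee_fin// -gbarE -EFinB lee_fin subr_ge0.
have H1 := @cvg_expN_integral R _ T P
  (fun r w => \sum_(g <- enum_upto H r) (u g w)%:E)%E
  (fun w => \esum_(g in [set: H]) (u g w)%:E)%E.
have H2 : expN (\sum_(g <- enum_upto H r) ((M g)%:E * (1 - mean_gamma g)))%E
    @[r --> \oo] --> expN compound_exponent.
  apply: cvg_expN; last exact: cvg_sum_enum_upto.
  by move=> r; apply: sume_ge0 => g _.
apply: (cvg_unique _ (H1 _ _ _) _) => //.
- by move=> r; apply: emeasurable_sum => g; exact/measurable_EFinP.
- by move=> r w; apply: sume_ge0 => g _; rewrite lee_fin.
- by move=> w; apply: cvg_sum_enum_upto => g; rewrite lee_fin.
apply: cvg_trans H2; apply: near_eq_cvg; apply: nearW => r.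
rewrite expN_sum// -compound_poisson_pgf ?enum_upto_uniq//.
apply: eq_integral => w _; rewrite expN_sum; last by move=> g; rewrite lee_fin.
by rewrite -prodEFin; apply: eq_bigr => g _; exact/esym/uE.
Qed.

End compound_poisson.

(** * The Laplace functional of the construction *)

Lemma esum_nat_lt {R : realType} (f : nat -> R) n :
  (forall j, (j < n)%N -> 0 <= f j) ->
  \esum_(j in [set: nat]) (if (j < n)%N then f j else 0)%:E = (\sum_(j < n) f j)%:E.
Proof.
move=> f0; have g0 j : (0 <= (if (j < n)%N then f j else 0)%:E)%E.
  by rewrite lee_fin; case: ifP => // /f0.
rewrite -nneseries_esumT// (nneseries_split 0 n)// add0n eseries0 ?adde0.
  by rewrite big_mkord -sumEFin; apply: eq_bigr => j _; rewrite ltn_ord.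
by move=> j nj _; rewrite ltnNge nj.
Qed.

Section marginal_laplace.
Context {R : realType} {dPsi : measure_display} {Psi : measurableType dPsi}
  {N K : nat} {dO : measure_display} {O : measurableType dO}
  (Q : probability O R) (psifix : 'I_K -> Psi) (s : marginal_draws O Psi N K)
  (gam xi lam : R) (G : probability Psi R) (xifix lamfix : 'I_K -> R).
Hypothesis gam_gt0 : 0 < gam.
Hypothesis xi_gt : -2 < xi.
Hypothesis lam_gt0 : 0 < lam.
Hypothesis xifix_gt : forall k, -1 < xifix k.
Hypothesis lamfix_gt0 : forall k, 0 < lamfix k.
Hypothesis Y_step_one : step_one Q s xi lam xifix lamfix.
Hypothesis Y_step_two : step_two Q s gam xi lam G.
Variable sigma : 'I_N -> Psi -> R.
Hypothesis msigma : forall n, measurable_fun setT (sigma n).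
Hypothesis sigma0 : forall n p, 0 <= sigma n p.
Local Notation label := ('I_K + 'I_N * nat * nat)%type.
Local Notation hist := {ffun 'I_N -> nat}.
Local Notation LL i p := (label_laplace xi lam xifix lamfix i (sigma ^~ p)).
Local Notation loc := (label_loc psifix s).
Implicit Types (i : label) (w : O) (p : Psi).

Definition atom_laplace i p : R := fine (LL i p).

Lemma label_laplace_atom i p : LL i p = (atom_laplace i p)%:E.
Proof.
rewrite /atom_laplace fineK// ge0_fin_numE.
  by rewrite (@le_lt_trans _ _ 1%E) ?ltry// label_laplace_le1.
by rewrite ltW// label_laplace_gt0.
Qed.

Lemma atom_laplace01 i p : 0 < atom_laplace i p <= 1.
Proof.
by rewrite -lte_fin -lee_fin -!label_laplace_atom label_laplace_gt0//= label_laplace_le1.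
Qed.

Let atom_laplace0 i p : 0 < atom_laplace i p.
Proof. by case/andP: (atom_laplace01 i p). Qed.

Lemma measurable_atom_laplace i : measurable_fun setT (atom_laplace i).
Proof.
apply: measurableT_comp => //; apply: measurable_esum => h.
  apply/measurable_EFinP; apply: measurable_funM => //.
  apply: measurableT_comp => //; apply: measurableT_comp => //.
  by apply: measurable_sum => n; exact: measurable_funM.
move=> p; rewrite lee_fin mulr_ge0 ?expR_ge0//.
by apply: history_prob_ge0 => *; exact: step_prob_ge0.
Qed.

Let DG := g_sigma_algebraType (draws_gen s).

Let mlocG i : measurable_fun setT (loc i : DG -> Psi).
Proof.
case: i => [k|[[m x] j]]; first exact: measurable_cst.
move=> _ B mB; rewrite setTI; apply: sub_sigma_algebra; exists (inr (m, x, j)) => //.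
by exists B => //; rewrite setTI.
Qed.

Let mloc i : measurable_fun setT (loc i).
Proof. exact: sigma_measurable_fun (@draws_gen_measurable _ _ _ _ _ _ s) (mlocG i). Qed.

Let mis i : measurable_fun setT (is_label s i : DG -> bool).
Proof.
by apply: (measurable_fun_bool true); rewrite setTI; exact: label_in_draws.
Qed.

Let u i w : \bar R := (if is_label s i w then - ln (atom_laplace i (loc i w)) else 0)%:E.

Let ln_atom_ge0 i p : 0 <= - ln (atom_laplace i p).
Proof. by rewrite oppr_ge0 ln_le0//; case/andP: (atom_laplace01 i p). Qed.

Let u0 i w : (0 <= u i w)%E.
Proof. by rewrite lee_fin; case: ifP. Qed.

Let mu i : measurable_fun setT (u i).
Proof.
apply/measurable_EFinP; apply: measurable_fun_ifT => //.
  exact: sigma_measurable_fun (@draws_gen_measurable _ _ _ _ _ _ s) (mis i).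
apply: measurableT_comp => //; apply: measurableT_comp => //.
exact: measurableT_comp (measurable_atom_laplace i) (mloc i).
Qed.

Let new_group (g : 'I_N * nat) : atom_label (N := N) (K := K) := inr (g, 0%N).

(** The histories are conditionally independent given the new draws, so
[laplace_conditional_product] integrates them out. *)
Lemma laplace_labels_given_draws :
  (\int[Q]_w expN (\esum_(i in [set: label])
     (\sum_n sigma n (loc i w) * (label_weight s n i w)%:R)%:E) =
   \int[Q]_w expN (\esum_(i in [set: label]) u i w))%E.
Proof.
have sp0 n (i : atom_label (N := N) (K := K)) (h : hist) :
  0 <= step_prob xi lam xifix lamfix n i h by exact: step_prob_ge0.
rewrite -(@laplace_conditional_product R _ O Q (draws_gen s) label hist
  (history s) (history_given_label s xi lam xifix lamfix)
  (fun i w h => \sum_n sigma n (loc i w) * (h n)%:R) u)//.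
- apply: eq_integral => w _; congr expN; apply: eq_esum => i _; congr EFin.
  by apply: eq_bigr => n _; rewrite ffunE.
- exact: draws_gen_measurable.
- by move=> i h; exact: measurable_history.
- move=> i h; apply: measurable_fun_ifT => //; exact: mis.
- move=> i w h; rewrite /history_given_label; case: ifP => // _.
  exact: history_prob_ge0.
- move=> i h; apply: measurable_sum => n; apply: measurable_funM => //.
  exact: measurableT_comp (msigma n) (mlocG i).
- by move=> i w h; apply: sumr_ge0 => n _; rewrite mulr_ge0.
- by move=> F v B uF sB; exact: history_cond_law.
- move=> i w; rewrite /u /history_given_label; case: ifP => _.
    by rewrite expN_EFin opprK lnK ?posrE// -label_laplace_atom.
  rewrite expN0 (esumID [set [ffun=> 0%N]]); last by move=> h _; rewrite lee_fin mulr_ge0 ?expR_ge0.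
  rewrite setTI esum_set1; last by rewrite lee_fin mulr_ge0 ?expR_ge0.
  rewrite eqxx mul1r esum1 ?adde0; last first.
    by move=> h [_ /= /eqP/negbTE ->]; rewrite mul0r.
  rewrite big1 ?oppr0 ?expR0// => n _.
  by rewrite ffunE mulr0.
Qed.

Definition new_atom_exponent : \bar R :=
  compound_exponent G
    (fun g : 'I_N * nat => new_atom_mean gam xi lam g.1.+1 g.2.+1)
    (fun g => atom_laplace (new_group g)).

(** This is where the mean number of new atoms comes from: it is the rate measure
integrated against the probability of having count 0 before the round and x + 1 at
it. *)
Lemma new_atom_meanE (g : 'I_N * nat) :
  new_atom_mean gam xi lam g.1.+1 g.2.+1 = gam * birth_weight xi lam xifix lamfix (new_group g).
Proof.
case: g => m x; rewrite /birth_weight /polya_weight past_sum_birth/=.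
have -> : history_fact (birth (N := N) (K := K) (new_group (m, x))) m.+1 = (x.+1)`!%:R :> R.
  rewrite /history_fact (bigD1 m)//= ffunE /= eqxx big1 ?mulr1// => l /andP[_ lm].
  by rewrite ffunE/= eq_sym (negbTE lm).
rewrite /new_atom_mean/= [xi + x.+1%:R + 1]addrAC invfM -!mulrA; congr (_ * _).
by rewrite mulrCA [_^-1 / _]mulrC.
Qed.

(** The fixed locations give a constant factor; the labels of the new atoms, grouped
by round and weight, give a compound Poisson sum. *)
Lemma marginal_laplace :
  (\int[Q]_w expN (\esum_(i in [set: label])
     (\sum_n sigma n (loc i w) * (label_weight s n i w)%:R)%:E) =
   (\prod_(k < K) LL (inl k) (psifix k)) * expN new_atom_exponent)%E.
Proof.
rewrite laplace_labels_given_draws.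
(* Contribution of the fixed locations to the exponent. *)
pose c : R := \sum_(k < K) - ln (atom_laplace (inl k) (psifix k)).
have c0 : 0 <= c by exact: sumr_ge0.
transitivity (\int[Q]_w (expN c%:E * expN (\esum_(g in [set: 'I_N * nat])
   (\sum_(j < new_count s g.1 g.2 w)
      - ln (atom_laplace (new_group g) (new_loc s g.1 g.2 j w)))%:E)))%E.
  apply: eq_integral => w _; rewrite -expND ?lee_fin//; last first.
    apply: esum_ge0 => -[m x] _; rewrite lee_fin; exact: sumr_ge0.
  congr expN; rewrite esum_sumType//; congr (_ + _)%E.
    by rewrite esum_finType// sumEFin.
  transitivity (\esum_(q in [set: 'I_N * nat * nat]) (fun g j => u (inr (g, j)) w) q.1 q.2).
    by apply: eq_esum => -[g j].
  apply: (etrans (@esum_pair _ _ _ (fun (g : 'I_N * nat) j => u (inr (g, j)) w) _)) => //.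
  apply: eq_esum => -[m x] _ /=.
  rewrite -(@esum_nat_lt R (fun j => - ln (atom_laplace (new_group (m, x)) (new_loc s m x j w))))//.
rewrite ge0_integralZl//; last 3 first.
- apply: measurable_expN_comp; apply: measurable_esum => [[m x]|[m x] w]; last first.
    by rewrite lee_fin sumr_ge0.
  rewrite [X in measurable_fun _ X](_ : _ = fun w => \esum_(j in [set: nat]) u (inr (m, x, j)) w).
    2: by apply/funext => w; rewrite -(@esum_nat_lt R (fun j => - ln (atom_laplace (new_group
      (m, x)) (new_loc s m x j w)))).
  apply: measurable_esum => [j|j w]; last exact: u0.
  exact: mu.
- by move=> w _; exact: expN_ge0.
- exact: expN_ge0.
congr (_ * _)%E.
  rewrite expN_EFin /c -sumrN expR_sum -prodEFin; apply: eq_bigr => k _.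
  by rewrite opprK lnK ?posrE// label_laplace_atom.
have [cl ll ind] := Y_step_two.
rewrite (@compound_poisson_laplace _ _ _ _ _ _ Q G
  (fun g w => new_count s g.1 g.2 w) (fun g j w => new_loc s g.1 g.2 j w)
  (fun g => new_atom_mean gam xi lam g.1.+1 g.2.+1)
  (fun g => atom_laplace (new_group g)))//.
- move=> g; rewrite new_atom_meanE mulr_ge0 ?(ltW gam_gt0)//.
  by rewrite ltW// birth_weight_gt0.
- move=> g; exact: measurable_atom_laplace.
- by move=> g p; exact: atom_laplace01.
- by move=> g v; rewrite cl poisson_probE.
- by move=> g j A mA; exact: ll.
- move=> F E SE; apply: ind => i iF; have := SE i iF.
  by case: i {iF} => [[m x]|[[m x] j]].
Qed.

End marginal_laplace.

(** * Matching the exponents *)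

(** The sum over all counts minus the term of the count 0. *)
Lemma esum_poisson_thinning {R : realType} (t c E : R) :
  0 <= t -> 0 <= c -> 0 <= E <= 1 ->
  \esum_(x in [set: nat]) (poisson_mass t x.+1 * (1 - E * expR (- (c * x.+1%:R))))%:E =
  ((1 - expR (- t)) - E * (expR (- (t * (1 - expR (- c)))) - expR (- t)))%:E.
Proof.
move=> t0 c0 /andP[E0 E1].
have e1 x : E * expR (- (c * x%:R)) <= 1.
  by rewrite mulr_ile1 ?expR_ge0// -[leRHS]expR0 ler_expR oppr_le0 mulr_ge0.
pose a x : R := poisson_mass t x * (1 - E * expR (- (c * x%:R))).
have a0 x : 0 <= a x by rewrite mulr_ge0 ?poisson_mass_ge0// subr_ge0.
have Ea : (\esum_(x in [set: nat]) (a x)%:E + (E * expR (- (t * (1 - expR (- c)))))%:E = 1)%E.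
  rewrite EFinM -poisson_laplace// -ge0_esumZl//; last first.
    by move=> x; rewrite lee_fin mulr_ge0 ?poisson_mass_ge0 ?expR_ge0.
  rewrite -esumD; last 2 first.
  - by move=> x _; rewrite lee_fin.
  - by move=> x _; rewrite mule_ge0 ?lee_fin// mulr_ge0 ?poisson_mass_ge0 ?expR_ge0.
  rewrite -(@esum_poisson_mass R t)//; apply: eq_esum => x _.
  by rewrite -EFinM -EFinD; congr EFin; rewrite /a; ring.
have -> : (\esum_(x in [set: nat]) (poisson_mass t x.+1 * (1 - E * expR (- (c * x.+1%:R))))%:E =
    \esum_(x in [set: nat]) (a x)%:E - (a 0%N)%:E)%E.
  rewrite -nneseries_esumT//; last by move=> x; rewrite lee_fin; exact: (a0 x.+1).
  rewrite -[in RHS]nneseries_esumT// [in RHS]nneseries_recl//; last by move=> x _; rewrite lee_fin.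
  rewrite addeAC subee// add0e -(@nneseries_addn _ _ 1%N)//.
  by apply: eq_eseriesr => x _; rewrite addn1.
have -> : \esum_(x in [set: nat]) (a x)%:E = (1 - E * expR (- (t * (1 - expR (- c)))))%:E.
  by rewrite EFinB -Ea addeK.
rewrite -EFinB; congr EFin; rewrite /a poisson_massE// mulr0 oppr0 expR0 expr0 fact0 invr1; ring.
Qed.

Section new_atoms_telescope.
Context {R : realType} {N K : nat}.
Variables (sigma : 'I_N -> R) (t : R).
Hypothesis t0 : 0 < t.

Definition thinned_tail (n : nat) : R := \sum_(l < N | (n <= l)%N) (1 - expR (- sigma l)).

Lemma step_product_new (m : 'I_N) x j :
  \prod_n step_laplace (inr (m, x, j) : atom_label (N := N) (K := K)) sigma n t =
  expR (- (m%:R * t)) * expR (- (t * thinned_tail m.+1)) *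
  (poisson_mass t x.+1 * expR (- (sigma m * x.+1%:R))).
Proof.
rewrite (bigD1 m)//= mulrC; congr (_ * _); last first.
  by rewrite /step_laplace/= ltnn ffunE/= eqxx.
rewrite (bigID (fun n : 'I_N => (n < m)%N))/=; congr (_ * _).
  transitivity (\prod_(n < N | (n < m)%N) expR (- t)).
    apply: eq_big => [n|n /andP[nm ltnm]].
      by case: ltngtP => [nm|nm|/val_inj ->]; rewrite ?andbF ?andbT// -val_eqE/= ltn_eqF.
    rewrite /step_laplace/= ltnNge (ltnW ltnm)/= ffunE/= eq_sym (negbTE nm).
    by rewrite mulr0 oppr0 expR0 mulr1 poisson_massE ?ltW// expr0 fact0 invr1 !mul1r.
  rewrite -(big_ord_widen N (fun=> expR (- t)) (ltnW (ltn_ord m))) prodr_const card_ord.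
  by rewrite -expRM_natl mulrN.
rewrite /thinned_tail mulr_sumr -sumrN expR_sum; apply: eq_big => [n|n].
  by case: ltngtP => [nm|nm|/val_inj ->]; rewrite ?andbF ?andbT ?eqxx// -val_eqE/= gtn_eqF.
by move=> /andP[nm]; rewrite -leqNgt leq_eqVlt eq_sym val_eqE (negbTE nm)/= /step_laplace/= => ->.
Qed.

End new_atoms_telescope.

Section new_atoms_sum.
Context {R : realType} {N K : nat}.
Variables (sigma : 'I_N -> R) (t : R).
Hypothesis sigma0 : forall n, 0 <= sigma n.
Hypothesis t0 : 0 < t.
Local Notation new_label g := (inr (g, 0%N) : atom_label (N := N) (K := K)).

Let f0 n : 0 <= 1 - expR (- sigma n).
Proof. by rewrite subr_ge0 -[leRHS]expR0 ler_expR oppr_le0. Qed.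

Let tail0 n : 0 <= thinned_tail sigma n.
Proof. by apply: sumr_ge0. Qed.

(** Probability that an atom of weight [t] is first seen at round [g.1] with weight
[g.2.+1], minus the same probability weighted by the Laplace factors of that round
and of the later ones. *)
Definition step_loss (g : 'I_N * nat) : R :=
  \prod_n step_laplace (new_label g) (fun=> 0) n t -
  \prod_n step_laplace (new_label g) sigma n t.

Lemma step_lossE g : step_loss g = expR (- (g.1%:R * t)) *
  (poisson_mass t g.2.+1 * (1 - expR (- (t * thinned_tail sigma g.1.+1)) * expR (- (sigma g.1 *
    g.2.+1%:R)))).
Proof.
case: g => m x; rewrite /step_loss !step_product_new//=.
rewrite [thinned_tail (fun=> 0) _]big1 ?mul0r ?mulr0 ?oppr0 ?expR0; first by ring.
by move=> l _; rewrite subrr.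
Qed.

Lemma step_loss_ge0 g : 0 <= step_loss g.
Proof.
rewrite step_lossE mulr_ge0 ?expR_ge0// mulr_ge0 ?poisson_mass_ge0// subr_ge0.
rewrite -expRD -[leRHS]expR0 ler_expR -opprD oppr_le0 addr_ge0 ?mulr_ge0//.
exact: ltW.
Qed.

(** With T m the exponential of - t times [thinned_tail m], the sum over the weights
at round m is the difference of e ^ (- m t) (1 - T m) between m and m.+1; the sum
telescopes, and T N is 1. *)
Lemma esum_step_loss :
  \esum_(g in [set: 'I_N * nat]) (step_loss g)%:E =
  (1 - expR (- (t * \sum_(n < N) (1 - expR (- sigma n)))))%:E.
Proof.
pose r (n : nat) : R := expR (- (n%:R * t)) * (expR (- (t * thinned_tail sigma n)) - 1).
transitivity (\esum_(g in [set: 'I_N * nat]) (fun m x => (step_loss (m, x))%:E) g.1 g.2).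
  by apply: eq_esum => -[].
apply: (etrans (@esum_pair _ _ _ (fun m x => (step_loss (m, x))%:E) _)).
  by move=> m x; rewrite lee_fin step_loss_ge0.
rewrite esum_finType; last first.
  by move=> m; apply: esum_ge0 => x _; rewrite lee_fin step_loss_ge0.
transitivity (\sum_(m < N) (r m.+1 - r m)%:E)%E.
  apply: eq_bigr => m _.
  transitivity (\esum_(x in [set: nat]) ((expR (- (m%:R * t)))%:E *
    (poisson_mass t x.+1 * (1 - expR (- (t * thinned_tail sigma m.+1)) * expR (- (sigma m *
      x.+1%:R))))%:E)%E).
    by apply: eq_esum => x _; rewrite step_lossE.
  have E1 : expR (- (t * thinned_tail sigma m.+1)) <= 1.
    by rewrite -[leRHS]expR0 ler_expR oppr_le0 mulr_ge0 ?(ltW t0).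
  rewrite ge0_esumZl ?expR_ge0//; last first.
    move=> x; rewrite lee_fin mulr_ge0 ?poisson_mass_ge0// subr_ge0.
    by rewrite mulr_ile1 ?expR_ge0// -[leRHS]expR0 ler_expR oppr_le0 mulr_ge0.
  rewrite esum_poisson_thinning ?expR_ge0 ?E1 ?(ltW t0)//.
  rewrite -EFinM; congr EFin; rewrite /r.
  have -> : thinned_tail sigma m = (1 - expR (- sigma m)) + thinned_tail sigma m.+1.
    rewrite /thinned_tail (bigD1 m)//=; congr (_ + _); apply: eq_bigl => l.
    by rewrite ltn_neqAle andbC eq_sym.
  have eD A B : expR (- (t * (A + B))) = expR (- (t * A)) * expR (- (t * B)).
    by rewrite mulrDr opprD expRD.
  rewrite [X in _ = _ - _ * (X - 1)]eD.
  have -> : expR (- (m.+1%:R * t)) = expR (- (m%:R * t)) * expR (- t).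
    by rewrite -natr1 mulrDl mul1r opprD expRD.
  ring.
rewrite sumEFin -(big_mkord xpredT (fun m => r m.+1 - r m)) telescope_sumr//.
rewrite /r [thinned_tail _ N]big_pred0; last by move=> l; rewrite leqNgt ltn_ord.
by rewrite mulr0 oppr0 expR0 subrr mulr0 mul0r oppr0 expR0 mul1r sub0r opprB.
Qed.

End new_atoms_sum.

Section marginal_laplace_formula.
Context {R : realType} {dPsi : measure_display} {Psi : measurableType dPsi}
  {N K : nat} (psifix : 'I_K -> Psi)
  (gam xi lam : R) (G : probability Psi R) (xifix lamfix : 'I_K -> R).
Hypothesis gam_gt0 : 0 < gam.
Hypothesis xi_gt : -2 < xi.
Hypothesis lam_gt0 : 0 < lam.
Hypothesis xifix_gt : forall k, -1 < xifix k.
Hypothesis lamfix_gt0 : forall k, 0 < lamfix k.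
Variable sigma : 'I_N -> Psi -> R.
Hypothesis msigma : forall n, measurable_fun setT (sigma n).
Hypothesis sigma0 : forall n p, 0 <= sigma n p.
Local Notation label := (atom_label (N := N) (K := K)).
Local Notation mu := (@lebesgue_measure R).
Local Notation LL i p := (label_laplace xi lam xifix lamfix i (sigma ^~ p)).
Local Notation AL i p := (atom_laplace xi lam xifix lamfix sigma i p).
Local Notation base i t := (t `^ (label_xi xi xifix i + 1 - 1) *
  expR (- (label_lam lam lamfix i * t))).

Let LLfin (i : label) p : LL i p = (AL i p)%:E.
Proof. exact: label_laplace_atom. Qed.

(** A fixed location exists at every round, so its mixing density is the gamma prior
and every round contributes a thinning factor. *)
Lemma fixed_label_laplace k :
  LL (inl k : label) (psifix k) =
  fixed_laplace psifix xifix lamfix (thinned_rate sigma) k.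
Proof.
have bw := @birth_weight_gt0 R N K xi lam xifix lamfix xi_gt lam_gt0 xifix_gt lamfix_gt0 (inl k).
have := @label_laplaceE R N K xi lam xifix lamfix xi_gt lam_gt0 xifix_gt lamfix_gt0 (inl k)
  (sigma ^~ (psifix k)) (fun n => sigma0 n _).
move=> /(congr1 (fun z => (birth_weight xi lam xifix lamfix (inl k : label))^-1%:E * z)%E).
rewrite muleA -EFinM mulVf ?gt_eqF// mul1e => ->.
rewrite -ge0_integralZl//; last 3 first.
- by apply/measurable_EFinP; exact: measurable_step_product.
- move=> t; rewrite /= in_itv/= andbT => t0; rewrite lee_fin mulr_ge0 ?mulr_ge0 ?powR_ge0
  ?expR_ge0//.
  by rewrite prodr_ge0// => n _; rewrite /step_laplace/= expR_ge0.
- by rewrite lee_fin invr_ge0 ltW.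
apply: eq_integral => t _; rewrite -EFinM; congr EFin.
have -> : birth_weight xi lam xifix lamfix (inl k : label) =
    Gamma_fun (xifix k + 1) / lamfix k `^ (xifix k + 1).
  rewrite /birth_weight /polya_weight past_sum_birth/= !addr0 /history_fact.
  by rewrite big_pred0 ?mulr1.
rewrite invf_div /gamma_pdf mulrA -!mulrA; congr (_ * (_ * (_ * (_ * _)))).
rewrite /step_laplace/= /thinned_rate mulr_sumr -sumrN expR_sum.
by apply: eq_bigr.
Qed.

Let thin p := thinned_rate sigma p.

Lemma measurable_step_loss (g : 'I_N * nat) p :
  measurable_fun (`]0%R, +oo[%classic : set R)
    (fun t => base (inr (g, 0%N) : label) t * step_loss (K := K) (sigma ^~ p) t g).
Proof.
have m s := @measurable_step_product R N K xi lam xifix lamfix (inr (g, 0%N)) s.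
apply: (@eq_measurable_fun _ _ _ _ _ (fun t => base (inr (g, 0%N) : label) t * \prod_n
  step_laplace (inr (g, 0%N) : label) (fun=> 0) n t - base (inr (g, 0%N) : label) t * \prod_n
    step_laplace (inr (g, 0%N) : label) (sigma ^~ p) n t)).
  by move=> t _; rewrite /step_loss mulrBr.
by apply: measurable_funB.
Qed.

(** Both [label_laplaceE] at [sigma] and at 0 are integrals against the same mixing
measure; their difference carries the loss. *)
Lemma new_atom_mean_loss (g : 'I_N * nat) p :
  ((new_atom_mean gam xi lam g.1.+1 g.2.+1 * (1 - AL (inr (g, 0%N)) p))%:E =
   \int[mu]_(t in `]0%R, +oo[) (gam * (t `^ xi * expR (- (lam * t))) *
      step_loss (K := K) (sigma ^~ p) t g)%:E)%E.
Proof.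
pose i : label := inr (g, 0%N).
have bw := @birth_weight_gt0 R N K xi lam xifix lamfix xi_gt lam_gt0 xifix_gt lamfix_gt0 i.
have E s s0 := @label_laplaceE R N K xi lam xifix lamfix xi_gt lam_gt0 xifix_gt lamfix_gt0 i s s0.
have m s := @measurable_step_product R N K xi lam xifix lamfix i s.
have E0 := E (fun=> 0) (fun=> lexx 0).
have E1 := E (sigma ^~ p) (fun n => sigma0 n p).
rewrite label_laplace0// mule1 in E0; rewrite LLfin -EFinM in E1.
have b0 t : 0 <= t `^ xi * expR (- (lam * t)) by rewrite mulr_ge0 ?powR_ge0 ?expR_ge0.
have bE t : base i t = t `^ xi * expR (- (lam * t)) by rewrite /i /= addrK.
have mloss := measurable_step_loss g p.
have loss0 t : `]0%R, +oo[%classic t -> 0 <= step_loss (K := K) (sigma ^~ p) t g.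
  by rewrite /= in_itv/= andbT => t0; exact: step_loss_ge0.
(* The integral at 0 splits into the integral at sigma and the loss. *)
have D : ((birth_weight xi lam xifix lamfix i)%:E =
    (birth_weight xi lam xifix lamfix i * AL i p)%:E +
    \int[mu]_(t in `]0%R, +oo[) (base i t * step_loss (K := K) (sigma ^~ p) t g)%:E)%E.
  rewrite E1 [in LHS]E0 -ge0_integralD//.
  - by apply: eq_integral => t _; rewrite -EFinD; congr EFin; rewrite /step_loss/=; ring.
  - move=> t; rewrite /= in_itv/= andbT => t0; rewrite lee_fin bE mulr_ge0//.
    rewrite prodr_ge0// => n _; rewrite /step_laplace; case: ifP => _; rewrite ?mulr_ge0
      ?expR_ge0//.
    exact: poisson_mass_ge0.
  - by apply/measurable_EFinP; exact: m.
  - by move=> t t0; rewrite lee_fin bE mulr_ge0 ?loss0.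
  - by apply/measurable_EFinP; exact: mloss.
transitivity (gam%:E * \int[mu]_(t in `]0%R, +oo[) (base i t * step_loss (K := K) (sigma ^~ p)
  t g)%:E)%E.
  rewrite (new_atom_meanE gam xi lam xifix lamfix g) -mulrA EFinM; congr (_ * _)%E.
  rewrite mulrBr mulr1 EFinB {1}D addeAC subee// add0e //.
rewrite -ge0_integralZl//; last 3 first.
- by apply/measurable_EFinP; exact: mloss.
- by move=> t t0; rewrite lee_fin bE mulr_ge0 ?loss0.
- by rewrite lee_fin ltW.
by apply: eq_integral => t _; rewrite -EFinM bE; congr EFin; ring.
Qed.

(** All integrands are nonnegative, so the sum over rounds and weights moves inside the
integrals over p and theta, where [esum_step_loss] evaluates it. *)
Lemma new_atom_exponentE :
  new_atom_exponent gam xi lam G xifix lamfix sigma =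
  ordinary_exponent gam xi lam G (thinned_rate sigma).
Proof.
have AL01 (i : label) p : 0 < AL i p <= 1 by exact: atom_laplace01.
have mAL (i : label) : measurable_fun setT (fun p => AL i p) by exact: measurable_atom_laplace.
have M0 (g : 'I_N * nat) : 0 <= new_atom_mean gam xi lam g.1.+1 g.2.+1.
  by rewrite (new_atom_meanE gam xi lam xifix lamfix g) mulr_ge0 ?ltW// birth_weight_gt0.
transitivity (\esum_(g in [set: 'I_N * nat]) \int[G]_p
    (new_atom_mean gam xi lam g.1.+1 g.2.+1 * (1 - AL (inr (g, 0%N) : label) p))%:E)%E.
  apply: eq_esum => g _; rewrite /mean_gamma.
  transitivity ((new_atom_mean gam xi lam g.1.+1 g.2.+1)%:E *
    \int[G]_p (1 - AL (inr (g, 0%N) : label) p)%:E)%E; last first.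
    rewrite -ge0_integralZl//.
    - by apply/measurable_EFinP; exact: measurable_funB.
    - by move=> p _; rewrite lee_fin subr_ge0; case/andP: (AL01 (inr (g, 0%N)) p).
    - by rewrite lee_fin; exact: M0.
  congr (_ * _)%E; apply/esym.
  have D : (1 = \int[G]_p (1 - AL (inr (g, 0%N) : label) p)%:E +
      \int[G]_p (AL (inr (g, 0%N) : label) p)%:E)%E.
    rewrite -ge0_integralD//.
    - rewrite -(@probability_setT _ _ _ G) -[LHS]mul1e -integral_cst//.
      by apply: eq_integral => p _; rewrite -EFinD subrK.
    - by move=> p _; rewrite lee_fin subr_ge0; case/andP: (AL01 (inr (g, 0%N)) p).
    - by apply/measurable_EFinP; exact: measurable_funB.
    - by move=> p _; rewrite lee_fin ltW//; case/andP: (AL01 (inr (g, 0%N)) p).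
    - exact/measurable_EFinP.
  rewrite {1}D addeK// ge0_fin_numE.
    rewrite (@le_lt_trans _ _ 1%E) ?ltry// {1}D leeDr//; apply: integral_ge0 => p _.
    by rewrite lee_fin subr_ge0; case/andP: (AL01 (inr (g, 0%N)) p).
  by apply: integral_ge0 => p _; rewrite lee_fin ltW//; case/andP: (AL01 (inr (g, 0%N)) p).
rewrite -ge0_integral_esum//; last 2 first.
- by move=> g; apply/measurable_EFinP; apply: measurable_funM => //; exact: measurable_funB.
- by move=> g p; rewrite lee_fin mulr_ge0// subr_ge0; case/andP: (AL01 (inr (g, 0%N)) p).
have b0 t : 0 <= t `^ xi * expR (- (lam * t)) by rewrite mulr_ge0 ?powR_ge0 ?expR_ge0.
have mb : measurable_fun setT (fun t : R => gam * (t `^ xi * expR (- (lam * t)))).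
  apply: measurable_funM => //; apply: measurable_funM; first exact: measurable_powR.
  by apply: measurableT_comp => //; apply: measurableT_comp => //; exact: measurable_funM.
have thin0 p : 0 <= thin p by exact: thinned_rate_ge0.
have mthin : measurable_fun setT thin by exact: measurable_thinned_rate.
transitivity (\int[G]_p \int[mu]_(t in `]0%R, +oo[)
    (gam * (t `^ xi * expR (- (lam * t))) * (1 - expR (- (t * thin p))))%:E)%E.
  apply: eq_integral => p _.
  under eq_esum do rewrite new_atom_mean_loss.
  rewrite -ge0_integral_esum_dom//; last 2 first.
  - move=> g; apply/measurable_EFinP.
    apply: (@eq_measurable_fun _ _ _ _ _ (fun t => gam * (base (inr (g, 0%N) : label) t *
      step_loss (K := K) (sigma ^~ p) t g))).
      by move=> t _; rewrite /= addrK mulrA.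
    by apply: measurable_funM => //; exact: measurable_step_loss.
  - move=> g t; rewrite /= in_itv/= andbT => t0; rewrite lee_fin mulr_ge0 ?step_loss_ge0//.
    by rewrite mulr_ge0// ltW.
  apply: eq_integral => t; rewrite inE/= in_itv/= andbT => t0.
  under eq_esum do rewrite EFinM.
  rewrite ge0_esumZl//; last 2 first.
  - by move=> g; rewrite lee_fin step_loss_ge0.
  - by rewrite mulr_ge0 ?(ltW gam_gt0).
  by rewrite esum_step_loss// -EFinM.
have phi0 t p : 0 < t -> (0 <= (gam * (t `^ xi * expR (- (lam * t))) * (1 - expR (- (t * thin
  p))))%:E)%E.
  move=> t0; rewrite lee_fin; apply: mulr_ge0; first by rewrite mulr_ge0// ltW.
  by rewrite subr_ge0 -[leRHS]expR0 ler_expR oppr_le0 mulr_ge0 ?(ltW t0) ?thin0.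
pose phi (z : R * Psi) := (gam * (z.1 `^ xi * expR (- (lam * z.1))) * (1 - expR (- (z.1 * thin
  z.2))))%:E.
have mphi : measurable_fun setT phi.
  apply/measurable_EFinP; apply: measurable_funM; first exact: measurableT_comp mb measurable_fst.
  apply: measurable_funB => //; apply: measurableT_comp => //; apply: measurableT_comp => //.
  apply: measurable_funM; first exact: measurable_fst.
  exact: measurableT_comp mthin measurable_snd.
rewrite -(@half_line_swap R _ _ G phi mphi phi0).
apply: eq_integral => t; rewrite inE/= in_itv/= andbT => t0.
rewrite -ge0_integralZl//.
- by apply: eq_integral => p _; rewrite -EFinM /phi/= mulrA.
- apply/measurable_EFinP; apply: measurable_funB => //; apply: measurableT_comp => //.
  by apply: measurableT_comp => //; exact: measurable_funM.
- move=> p _; rewrite lee_fin subr_ge0 -[leRHS]expR0 ler_expR oppr_le0.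
  by rewrite mulr_ge0 ?(ltW t0) ?thin0.
- by rewrite lee_fin -mulrA mulr_ge0// ltW.
Qed.

End marginal_laplace_formula.

(** * Laplace transforms of extended counts *)

Section power_series_uniqueness.
Context {R : realType}.
Implicit Types (a b : nat -> R) (t : R).

Let series a t : \bar R := \esum_(x in [set: nat]) (a x * t ^+ x)%:E.

Let series_recl a t : (forall x, 0 <= a x) -> 0 <= t ->
  series a t = ((a 0%N)%:E + t%:E * series (a \o S) t)%E.
Proof.
move=> a0 t0; have at0 x : (0 <= (a x * t ^+ x)%:E)%E by rewrite lee_fin mulr_ge0 ?exprn_ge0.
rewrite /series -nneseries_esumT// nneseries_recl//.
rewrite expr0 mulr1; congr (_ + _)%E.
rewrite -(@nneseries_addn _ _ 1%N)// -ge0_esumZl//; last first.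
  by move=> x; rewrite lee_fin mulr_ge0 ?exprn_ge0//=.
rewrite -[RHS]nneseries_esumT//.
  by apply: eq_eseriesr => x _; rewrite addn1 -EFinM exprS /=; congr EFin; ring.
by move=> x; rewrite -EFinM lee_fin mulr_ge0 ?mulr_ge0 ?exprn_ge0//=.
Qed.

Let series_le a t : (forall x, 0 <= a x) -> 0 < t < 1 ->
  (series a t <= \esum_(x in [set: nat]) (a x)%:E)%E.
Proof.
move=> a0 /andP[t0 t1]; apply: le_esum => x _; rewrite lee_fin.
by rewrite ler_piMr// exprn_ile1// ltW.
Qed.

Let esum_shift a : (forall x, 0 <= a x) ->
  (\esum_(x in [set: nat]) ((a \o S) x)%:E <= \esum_(x in [set: nat]) (a x)%:E)%E.
Proof.
move=> a0; have a0' x : (0 <= (a x)%:E)%E by rewrite lee_fin.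
have aS0 x : (0 <= ((a \o S) x)%:E)%E by rewrite lee_fin/=.
rewrite -nneseries_esumT// -[leRHS]nneseries_esumT// [leRHS]nneseries_recl//.
rewrite -(@nneseries_addn _ (fun x => (a x)%:E) 1%N)//.
rewrite [X in (_ <= _ + X)%E](eq_eseriesr (g := fun x => (a x.+1)%:E)); last by move=> x _;
  rewrite addn1.
by rewrite leeDr ?lee_fin.
Qed.

Let le_const a b (B : R) : (forall x, 0 <= a x) -> (forall x, 0 <= b x) ->
  (\esum_(x in [set: nat]) (b x)%:E <= B%:E)%E ->
  (forall t, 0 < t < 1 -> series a t = series b t) -> a 0%N <= b 0%N.
Proof.
move=> a0 b0 bB ab; apply/ler_addgt0Pr => e e0.
have B0 : 0 <= B.
  by rewrite -lee_fin; apply: le_trans bB; apply: esum_ge0 => x _; rewrite lee_fin.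
(* Small enough for t * B <= e, and less than 1. *)
pose t := Num.min (2^-1) (e / (B + 1)).
have B1 : 0 < B + 1 by rewrite ltr_wpDl.
have t01 : 0 < t < 1.
  rewrite lt_min invr_gt0 ltr0n/= divr_gt0//= gt_min.
  by apply/orP; left; lra.
have /andP[t0 t1] := t01.
have := ab t t01; rewrite (series_recl a0 (ltW t0)) (series_recl b0 (ltW t0)) => E; rewrite
  -lee_fin; apply: (@le_trans _ _ ((b 0%N)%:E + t%:E * series (b \o S) t)%E).
  rewrite -E leeDl// mule_ge0 ?lee_fin ?(ltW t0)//; apply: esum_ge0 => x _.
  by rewrite lee_fin mulr_ge0 ?exprn_ge0 ?(ltW t0)//=.
rewrite EFinD leeD2l//; apply: (@le_trans _ _ (t%:E * B%:E)%E).
  rewrite lee_pmul2l ?lte_fin//; apply: (le_trans (series_le _ _)) => //=.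
  exact: le_trans (esum_shift b0) bB.
rewrite -EFinM lee_fin; apply: (@le_trans _ _ (e / (B + 1) * B)).
  by rewrite ler_wpM2r// ge_min lexx orbT.
by rewrite mulrAC ler_pdivrMr// ler_pM2l// lerDl.
Qed.

Let eq_const a b :
  (forall x, 0 <= a x) -> (forall x, 0 <= b x) ->
  (\esum_(x in [set: nat]) (a x)%:E < +oo)%E ->
  (\esum_(x in [set: nat]) (b x)%:E < +oo)%E ->
  (forall t, 0 < t < 1 -> series a t = series b t) -> a 0%N = b 0%N.
Proof.
move=> a0 b0 aoo boo ab.
have fin (c : nat -> R) : (forall x, 0 <= c x) -> (\esum_(x in [set: nat]) (c x)%:E < +oo)%E ->
    (\esum_(x in [set: nat]) (c x)%:E <= (fine (\esum_(x in [set: nat]) (c x)%:E))%:E)%E.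
  move=> c0 coo; rewrite fineK// ge0_fin_numE//.
  by apply: esum_ge0 => y _; rewrite lee_fin.
apply/eqP; rewrite eq_le (le_const a0 b0 (fin _ b0 boo) ab)/=.
by apply: (le_const b0 a0 (fin _ a0 aoo)) => t t01; rewrite -ab.
Qed.

(** The constant terms agree in the limit t -> 0; dividing by t and shifting the
coefficients gives the others by induction. *)
Lemma power_series_unique a b :
  (forall x, 0 <= a x) -> (forall x, 0 <= b x) ->
  (\esum_(x in [set: nat]) (a x)%:E < +oo)%E ->
  (\esum_(x in [set: nat]) (b x)%:E < +oo)%E ->
  (forall t, 0 < t < 1 ->
     \esum_(x in [set: nat]) (a x * t ^+ x)%:E =
     \esum_(x in [set: nat]) (b x * t ^+ x)%:E) ->
  a =1 b.
Proof.
move=> + + + + + x; elim: x a b => [|x ih] a b a0 b0 aoo boo ab; first exact: eq_const.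
have ab0 : a 0%N = b 0%N by exact: eq_const.
apply: (ih (a \o S) (b \o S)) => //=.
- exact: le_lt_trans (esum_shift a0) aoo.
- exact: le_lt_trans (esum_shift b0) boo.
move=> t /[dup] t01 /ab; rewrite -/(series a t) -/(series b t).
have /andP[t0 t1] := t01; rewrite (series_recl a0 (ltW t0)) (series_recl b0 (ltW t0)) ab0.
move=> /(congr1 (fun z => z - (b 0%N)%:E)%E).
rewrite ![((b 0%N)%:E + _)%E]addeC !addeK// => /(congr1 (fun z => t^-1%:E * z)%E).
by rewrite !muleA -!EFinM mulVf ?gt_eqF// !mul1e.
Qed.

End power_series_uniqueness.

Section extended_counts.
Context {R : realType}.
Local Notation option_nat := (unit + nat)%type.

(** The values of an integer-valued measure, indexed by a countable type; [inl tt]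
stands for +oo. *)
Definition ext_nat (o : option_nat) : \bar R := if o is inr x then x%:R%:E else +oo%E.

Lemma ext_nat_inj : injective ext_nat.
Proof.
move=> [[]|x] [[]|y]//= [/eqP]; by rewrite eqr_nat => /eqP ->.
Qed.

Section weighted_law.
Context {d : measure_display} {T : measurableType d} (P : probability T R).
Variables (U : T -> \bar R) (Z : T -> R).
Hypothesis mU : measurable_fun setT U.
Hypothesis mZ : measurable_fun setT Z.
Hypothesis Z01 : forall w, 0 <= Z w <= 1.
Hypothesis valU : forall w, range ext_nat (U w).

Let Z0 w : 0 <= Z w. Proof. by case/andP: (Z01 w). Qed.
Let Z1 w : Z w <= 1. Proof. by case/andP: (Z01 w). Qed.

(** The mass function of [U] under the measure of density [Z]; a general weight is
needed to treat the coordinates of a vector one after the other. *)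
Definition weighted_mass (o : option_nat) : R :=
  fine (\int[P]_w (\1_[set ext_nat o] (U w) * Z w)%:E)%E.

Let mI o : measurable_fun setT (fun w => \1_[set ext_nat o] (U w) : R).
Proof.
apply: (measurableT_comp _ mU); apply: measurable_indic.
exact: emeasurable_set1.
Qed.

Let I01 o w : 0 <= \1_[set ext_nat o] (U w) * Z w <= (1 : R).
Proof. by rewrite indicE; case: (_ \in _); rewrite ?mul1r ?Z0 ?Z1// mul0r lexx ler01. Qed.

Let massE o : (\int[P]_w (\1_[set ext_nat o] (U w) * Z w)%:E = (weighted_mass o)%:E)%E.
Proof.
have mIZ : measurable_fun setT (fun w => \1_[set ext_nat o] (U w) * Z w).
  exact: measurable_funM.
have /andP[i0 i1] := integral_unit_interval P mIZ (I01 o).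
by rewrite /weighted_mass fineK// ge0_fin_numE// (le_lt_trans i1)// ltry.
Qed.

Lemma weighted_mass_ge0 o : 0 <= weighted_mass o.
Proof.
by rewrite -lee_fin -massE; apply: integral_ge0 => w _; rewrite lee_fin; case/andP: (I01 o w).
Qed.

Lemma integral_weighted_law (g : \bar R -> R) : (forall y, 0 <= g y) ->
  (\int[P]_w (g (U w) * Z w)%:E =
   \esum_(o in [set: option_nat]) (g (ext_nat o) * weighted_mass o)%:E)%E.
Proof.
move=> g0.
transitivity (\int[P]_w \esum_(o in [set: option_nat])
    (g (ext_nat o) * (\1_[set ext_nat o] (U w) * Z w))%:E)%E.
  apply: eq_integral => w _; case: (valU w) => o _ oU.
  rewrite (esumID [set o])//; last first.
    by move=> o' _; rewrite lee_fin mulr_ge0//; case/andP: (I01 o' w).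
  rewrite setTI esum_set1; last first.
    by rewrite lee_fin mulr_ge0//; case/andP: (I01 o w).
  rewrite -oU indicE mem_set// mul1r esum1 ?adde0// => o' [_ /= oo'].
  by rewrite indicE memNset ?mul0r ?mulr0// => /ext_nat_inj/esym.
rewrite ge0_integral_esum//; last 2 first.
- by move=> o; apply/measurable_EFinP; apply: measurable_funM => //; exact: measurable_funM.
- by move=> o w; rewrite lee_fin mulr_ge0//; case/andP: (I01 o w).
apply: eq_esum => o _; rewrite EFinM -massE -ge0_integralZl//.
- by apply/measurable_EFinP; exact: measurable_funM.
- by move=> w _; rewrite lee_fin; case/andP: (I01 o w).
- by rewrite lee_fin.
Qed.

Lemma integral_weighted_law_sum (g : \bar R -> R) : (forall y, 0 <= g y) ->
  (\int[P]_w (g (U w) * Z w)%:E =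
   (g +oo%E * weighted_mass (inl tt))%:E +
   \esum_(x in [set: nat]) (g x%:R%:E * weighted_mass (inr x))%:E)%E.
Proof.
move=> g0; rewrite integral_weighted_law// esum_sumType; last first.
  by move=> o; rewrite lee_fin mulr_ge0 ?weighted_mass_ge0.
congr (_ + _)%E; rewrite (_ : [set: unit] = [set tt]); last by apply/seteqP; split => // -[].
by rewrite esum_set1// lee_fin mulr_ge0 ?weighted_mass_ge0.
Qed.

Lemma esum_weighted_mass_lty :
  (\esum_(x in [set: nat]) (weighted_mass (inr x))%:E < +oo)%E.
Proof.
have := @integral_weighted_law_sum (cst 1) (fun=> ler01).
under eq_integral do rewrite mul1r.
under [X in _ = (_ + X)%E -> _]eq_esum do rewrite mul1r.
move=> tot; apply: (@le_lt_trans _ _ 1%E); last exact: ltry.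
apply: (@le_trans _ _ (\int[P]_w (Z w)%:E)%E).
  by rewrite tot leeDr// lee_fin mul1r weighted_mass_ge0.
by case/andP: (integral_unit_interval P mZ Z01).
Qed.

End weighted_law.

Section joint_law.
Context {d1 d2 : measure_display} {T1 : measurableType d1} {T2 : measurableType d2}
  (P : probability T1 R) (Q : probability T2 R).

Definition expNr (c : R) (y : \bar R) : R := fine (expN (c%:E * y)).

Lemma expNr_ge0 c y : 0 <= expNr c y.
Proof. by rewrite fine_ge0// expN_ge0. Qed.

Lemma expNr_le1 c y : 0 <= c -> (0 <= y)%E -> expNr c y <= 1.
Proof.
move=> c0 y0; have : (expN (c%:E * y) <= 1)%E by rewrite expN_le1// mule_ge0.
by rewrite /expNr; case: (expN _) => // r; rewrite lee_fin.
Qed.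

Lemma measurable_expNr c : measurable_fun setT (expNr c).
Proof.
by apply: measurableT_comp => //; apply: measurable_expN_comp; exact: emeasurable_funM.
Qed.

(** For c > 0 the Laplace transform is a power series in exp(- c) whose coefficients
are the masses at the natural numbers, the value +oo contributing 0.  The case
c = 0 then gives the mass at +oo. *)
Lemma laplace_determines_law (U : T1 -> \bar R) (V : T2 -> \bar R)
    (Z : T1 -> R) (Z' : T2 -> R) :
  measurable_fun setT U -> measurable_fun setT V ->
  measurable_fun setT Z -> measurable_fun setT Z' ->
  (forall w, 0 <= Z w <= 1) -> (forall w, 0 <= Z' w <= 1) ->
  (forall w, range ext_nat (U w)) -> (forall w, range ext_nat (V w)) ->
  (forall c : R, (0 <= c)%R ->
     \int[P]_w (expNr c (U w) * Z w)%:E = \int[Q]_w (expNr c (V w) * Z' w)%:E)%E ->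
  forall B : set (\bar R),
  (\int[P]_w (\1_B (U w) * Z w)%:E = \int[Q]_w (\1_B (V w) * Z' w)%:E)%E.
Proof.
move=> mU mV mZ mZ' Z01 Z'01 vU vV eL B.
pose a := weighted_mass P U Z; pose b := weighted_mass Q V Z'.
have a0 o : 0 <= a o by exact: weighted_mass_ge0.
have b0 o : 0 <= b o by exact: weighted_mass_ge0.
(* The total masses: c = 0. *)
have e0 : (expNr 0 : \bar R -> R) =1 cst 1 by move=> y; rewrite /expNr mul0e expN0.
have := eL 0 (lexx 0); rewrite !integral_weighted_law_sum//; [|exact: expNr_ge0..].
rewrite -/a -/b !e0 !mul1r; under eq_esum do rewrite e0 mul1r.
under [X in _ = (_ + X)%E -> _]eq_esum do rewrite e0 mul1r.
move=> tot.
have ab : a \o inr =1 b \o inr.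
  apply: power_series_unique => //=; [exact: esum_weighted_mass_lty..|].
  move=> t /andP[t0 t1]; have c0 : 0 < - ln t by rewrite oppr_gt0 ln_lt0// t0.
  have eoo : expNr (- ln t) +oo%E = 0 by rewrite /expNr gt0_muley.
  have := eL (- ln t) (ltW c0); rewrite !integral_weighted_law_sum//; [|exact: expNr_ge0..].
  rewrite eoo !mul0r !add0e.
  have E x : expNr (- ln t) x%:R%:E = t ^+ x.
    by rewrite /expNr -EFinM expN_EFin/= mulNr opprK expRM_natr lnK.
  under eq_esum do rewrite E mulrC.
  by under [X in _ = X -> _]eq_esum do rewrite E mulrC.
have ab' : a (inl tt) = b (inl tt).
  move: tot; rewrite (_ : esum _ (fun x => (b (inr x))%:E) = \esum_(x in [set: nat]) (a (inr
    x))%:E); last first.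
    by apply: eq_esum => x _; have /= -> := ab x.
  have afin : \esum_(x in [set: nat]) (a (inr x))%:E \is a fin_num.
    rewrite ge0_fin_numE; first exact: esum_weighted_mass_lty.
    by apply: esum_ge0 => x _; rewrite lee_fin.
  by move=> /(congr1 (fun z => z - \esum_(x in [set: nat]) (a (inr x))%:E)%E); rewrite !addeK//
    => -[].
by rewrite ab'; congr (_ + _)%E; apply: eq_esum => x _; have /= -> := ab x.
Qed.

Let measurable_indic_ext_nat d (T : measurableType d) (U : T -> \bar R) B :
  measurable_fun setT U -> (forall w, range ext_nat (U w)) ->
  measurable_fun setT (fun w => \1_B (U w) : R).
Proof.
move=> mU vU; have mB : measurable (B `&` range ext_nat).
  apply: countable_measurable => [y|]; first exact: emeasurable_set1.
  apply: (@sub_countable _ _ _ (range ext_nat)); first by apply: subset_card_le; exact: subIsetr.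
  by apply: sub_countable (card_image_le _ _) _.
rewrite (_ : (fun w => _) = fun w => \1_(B `&` range ext_nat) (U w)).
  by apply: measurableT_comp mU; exact: measurable_indic.
apply/funext => w; rewrite !indicE; congr (nat_of_bool _)%:R.
by rewrite in_setI [X in _ = _ && X]mem_set// andbT.
Qed.

(** Induction on the list of constraints: with the others as weight,
[laplace_determines_law] turns the Laplace factor of one coordinate into the
indicator of its constraint. *)
Lemma joint_laplace_determines_law (I : Type) (U : I -> T1 -> \bar R)
    (V : I -> T2 -> \bar R) :
  (forall i, measurable_fun setT (U i)) -> (forall i, measurable_fun setT (V i)) ->
  (forall i w, range ext_nat (U i w)) -> (forall i w, range ext_nat (V i w)) ->
  (forall s : seq (I * {nonneg R}),
     \int[P]_w expN (\sum_(q <- s) q.2%:num%:E * U q.1 w) =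
     \int[Q]_w expN (\sum_(q <- s) q.2%:num%:E * V q.1 w))%E ->
  forall r : seq (I * set (\bar R)),
  P (\big[setI/setT]_(q <- r) (U q.1 @^-1` q.2)) =
  Q (\big[setI/setT]_(q <- r) (V q.1 @^-1` q.2)).
Proof.
move=> mU mV vU vV eL r.
have ext_nat_ge0 y : range ext_nat y -> (0 <= y)%E.
  by move=> [[[]|x]] _ <- //=; rewrite ?leey ?lee_fin.
pose Z (T : Type) (W : I -> T -> \bar R) (s : seq (I * {nonneg R})) (r : seq (I * set (\bar
  R))) w : R :=
  \prod_(q <- s) expNr q.2%:num (W q.1 w) * \prod_(q <- r) \1_q.2 (W q.1 w).
have Z01 (T : Type) (W : I -> T -> \bar R) s r' w : (forall i w, range ext_nat (W i w)) ->
    0 <= Z T W s r' w <= 1.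
  move=> vW; have W0 i : (0 <= W i w)%E by exact/ext_nat_ge0/vW.
  have i01 (q : I * set (\bar R)) : 0 <= (\1_q.2 (W q.1 w) : R) <= 1.
    by rewrite indicE; case: (_ \in _); rewrite ?lexx ?ler01.
  have e01 (q : I * {nonneg R}) : 0 <= expNr q.2%:num (W q.1 w) <= 1.
    by rewrite expNr_ge0 expNr_le1.
  have p0 : 0 <= \prod_(q <- s) expNr q.2%:num (W q.1 w).
    by apply: prodr_ge0 => q _; case/andP: (e01 q).
  have q0 : 0 <= \prod_(q <- r') (\1_q.2 (W q.1 w) : R).
    by apply: prodr_ge0 => q _; case/andP: (i01 q).
  rewrite /Z mulr_ge0//= mulr_ile1//.
    by apply: prodr_ile1 => q _; exact: e01.
  by apply: prodr_ile1 => q _; exact: i01.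
have mZ d (T : measurableType d) (W : I -> T -> \bar R) s r' :
    (forall i, measurable_fun setT (W i)) -> (forall i w, range ext_nat (W i w)) ->
    measurable_fun setT (Z T W s r').
  move=> mW vW; have mprod J (t : seq J) (h : J -> T -> R) :
      (forall q, measurable_fun setT (h q)) -> measurable_fun setT (fun w => \prod_(q <- t) h q w).
    move=> mh; elim: t => [|q t ih].
      by rewrite [X in measurable_fun _ X](_ : _ = cst 1)//; apply/funext => w; rewrite big_nil.
    rewrite [X in measurable_fun _ X](_ : _ = fun w => h q w * \prod_(q <- t) h q w).
      exact: measurable_funM.
    by apply/funext => w; rewrite big_cons.
  apply: measurable_funM; apply: mprod => q; last exact: measurable_indic_ext_nat.
  by apply: measurableT_comp (mW q.1); exact: measurable_expNr.
have claim r' s : (\int[P]_w (Z _ U s r' w)%:E = \int[Q]_w (Z _ V s r' w)%:E)%E.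
  elim: r' s => [|[i B] r' ih] s.
    have E (T : Type) (W : I -> T -> \bar R) w : (forall i w, range ext_nat (W i w)) ->
        (Z T W s [::] w)%:E = expN (\sum_(q <- s) q.2%:num%:E * W q.1 w)%E.
      move=> vW; rewrite /Z big_nil mulr1 expN_sum.
        rewrite -prodEFin; apply: eq_bigr => q _; rewrite fineK//.
        rewrite ge0_fin_numE ?expN_ge0// (le_lt_trans (expN_le1 _)) ?ltry//.
        by rewrite mule_ge0//; exact/ext_nat_ge0/vW.
      by move=> q; rewrite mule_ge0//; exact/ext_nat_ge0/vW.
    under eq_integral do rewrite E//.
    by under [in RHS]eq_integral do rewrite E//.
  have E (T : Type) (W : I -> T -> \bar R) w :
      Z T W s ((i, B) :: r') w = \1_B (W i w) * Z T W s r' w.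
    by rewrite /Z big_cons/= mulrCA.
  under eq_integral do rewrite E.
  under [in RHS]eq_integral do rewrite E.
  apply: laplace_determines_law => //; [exact: mZ|exact: mZ|by move=> w; exact: Z01..|].
  move=> c c0; have := ih ((i, NngNum c0) :: s).
  have E' (T : Type) (W : I -> T -> \bar R) w :
      Z T W ((i, NngNum c0) :: s) r' w = expNr c (W i w) * Z T W s r' w.
    by rewrite /Z big_cons/= mulrA.
  under eq_integral do rewrite E'.
  by under [X in _ = X -> _]eq_integral do rewrite E'.
have toP d (T : measurableType d) (m : probability T R) (W : I -> T -> \bar R) :
    (forall i, measurable_fun setT (W i)) -> (forall i w, range ext_nat (W i w)) ->
    (m (\big[setI/setT]_(q <- r) (W q.1 @^-1` q.2)) = \int[m]_w (Z _ W [::] r w)%:E)%E.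
  move=> mW vW; rewrite -[LHS]mul1e -integral_cst.
    rewrite integral_mkcond; apply: eq_integral => w _.
    rewrite /Z big_nil mul1r; elim: r => [|q r' ih].
      by rewrite !big_nil patchT// inE.
    rewrite !big_cons EFinM -ih !patchE in_setI indicE.
    rewrite (_ : (w \in W q.1 @^-1` q.2) = (W q.1 w \in q.2)); last first.
      by apply/idP/idP; rewrite !inE.
    by case: (_ \in q.2); rewrite ?mul1e ?mul0e.
  apply: bigsetI_measurable => q _.
  have := @measurable_indic_ext_nat d T (W q.1) q.2 (mW _) (vW _).
  move=> /(_ measurableT [set 1] (measurable_set1 _)); rewrite setTI.
  congr (measurable _); apply/seteqP; split => w /=; rewrite indicE.
    by case: (boolP (_ \in _)) => [/set_mem//|_ /eqP]; rewrite eq_sym oner_eq0.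
  by move=> h; rewrite mem_set.
by rewrite !toP.
Qed.

End joint_law.

End extended_counts.

(** * Laplace functionals of atomic processes *)

(** A finite supremum of natural numbers is attained. *)
Lemma esum_nat_ext_nat {R : realType} (J : choiceType) (a : J -> nat) :
  range ext_nat (\esum_(j in [set: J]) (a j)%:R%:E : \bar R).
Proof.
have nat_sum A : finite_set A -> exists n : nat, (\sum_(j \in A) ((a j)%:R : R)%:E)%E = (n%:R :
  R)%:E.
  move=> fA; exists (\sum_(j <- fset_set A) a j)%N.
  by rewrite fsbig_finite// sumEFin natr_sum.
have e0 : (0 <= \esum_(j in [set: J]) ((a j)%:R : R)%:E)%E.
  by apply: esum_ge0 => j _; rewrite lee_fin.
have [oo|fin] := eqVneq (\esum_(j in [set: J]) ((a j)%:R : R)%:E) +oo%E.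
  by exists (inl tt).
have efin : (\esum_(j in [set: J]) ((a j)%:R : R)%:E) \is a fin_num.
  by rewrite ge0_fin_numE// ltey.
(* A finite partial sum n within less than 1 of the supremum bounds all others,
   which are natural numbers too. *)
have [_ [A [fA _] <-]] := ub_ereal_sup_adherent (@ltr01 R) efin.
have [n En] := nat_sum A fA; rewrite En => nlt.
exists (inr n) => //=; apply/eqP; rewrite eq_le; apply/andP; split.
  by rewrite -En; apply: ereal_sup_ubound; exists A.
apply: ge_ereal_sup => _ [B [fB _] <-].
have fAB : finite_set (A `|` B) by rewrite finite_setU.
have [m Em] := nat_sum _ fAB; have [k Ek] := nat_sum B fB.
have sub_le (C D : set J) (c d : nat) : finite_set C -> finite_set D -> C `<=` D ->
    (\sum_(j \in C) ((a j)%:R : R)%:E)%E = (c%:R : R)%:E ->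
    (\sum_(j \in D) ((a j)%:R : R)%:E)%E = (d%:R : R)%:E -> (c <= d)%N.
  move=> fC fD CD Ec Ed; rewrite -(ler_nat R) -lee_fin -Ec -Ed.
  apply: lee_fsum_nneg_subset => //.
  by move=> j; rewrite !inE; exact: CD.
rewrite Ek lee_fin ler_nat.
have km : (k <= m)%N by apply: (sub_le B (A `|` B)).
apply: (leq_trans km).
have mle : ((m%:R : R)%:E <= \esum_(j in [set: J]) ((a j)%:R : R)%:E)%E.
  by rewrite -Em; apply: ereal_sup_ubound; exists (A `|` B).
have : ((m%:R - 1 : R)%:E < (n%:R : R)%:E)%E.
  by apply: le_lt_trans nlt; rewrite EFinB leeB.
by rewrite lte_fin ltrBlDr natr1 ltr_nat ltnS.
Qed.

Section atomic_processes.
Context {R : realType} {dPsi : measure_display} {Psi : measurableType dPsi}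
  {N : nat} {J : countType} {d : measure_display} {T : measurableType d}.
Variables (loc : J -> T -> Psi) (x : 'I_N -> J -> T -> nat).
Hypothesis mloc : forall j, measurable_fun setT (loc j).
Hypothesis mx : forall n j, measurable_fun setT (x n j).
Local Notation test := ('I_N * {A : set Psi | measurable A})%type.

Definition atomic_process (n : 'I_N) (w : T) : {measure set Psi -> \bar R} :=
  atomic_measure (fun j => (x n j w)%:R%:nng) (loc ^~ w).

Lemma atomic_processE n w A : atomic_process n w A =
  \esum_(j in [set: J]) (x n j w * (loc j w \in A))%:R%:E.
Proof.
by apply: eq_esum => j _; rewrite diracE/= -EFinM natrM.
Qed.

Lemma atomic_process_ext_nat n w A : range ext_nat (atomic_process n w A).
Proof. by rewrite atomic_processE; exact: esum_nat_ext_nat. Qed.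

Lemma measurable_atomic_process n A : measurable A ->
  measurable_fun setT (fun w => atomic_process n w A).
Proof.
move=> mA; rewrite [X in measurable_fun _ X](_ : _ = fun w =>
   \esum_(j in [set: J]) ((x n j w)%:R * \1_A (loc j w))%:E).
  apply: measurable_esum => [j|j w]; last by rewrite lee_fin mulr_ge0.
  apply/measurable_EFinP; apply: measurable_funM; first exact: measurableT_comp.
  by apply: measurableT_comp (mloc j); exact: measurable_indic.
apply/funext => w; rewrite atomic_processE; apply: eq_esum => j _.
by rewrite natrM indicE.
Qed.

(** The functions sigma for which sum_n X_n(sigma_n) is the linear combination of
values of the processes listed in [s]. *)
Definition test_intensity (s : seq (test * {nonneg R})) (n : 'I_N) (p : Psi) : R :=
  \sum_(q <- s) if q.1.1 == n then q.2%:num * \1_(sval q.1.2) p else 0.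

Lemma test_intensity_ge0 s n p : 0 <= test_intensity s n p.
Proof. by apply: sumr_ge0 => q _; case: ifP => // _; rewrite mulr_ge0. Qed.

Lemma measurable_test_intensity s n : measurable_fun setT (test_intensity s n).
Proof.
apply: measurable_sum => -[[m [A mA]] c] /=; case: (m == n); last exact: measurable_cst.
by apply: measurable_funM => //; exact: measurable_indic.
Qed.

Lemma sum_atomic_process (s : seq (test * {nonneg R})) w :
  (\sum_(q <- s) q.2%:num%:E * atomic_process q.1.1 w (sval q.1.2) =
   \esum_(j in [set: J]) (\sum_n test_intensity s n (loc j w) * (x n j w)%:R)%:E)%E.
Proof.
have t0 r j : (0 <= (\sum_n test_intensity r n (loc j w) * (x n j w)%:R)%:E)%E.
  by rewrite lee_fin sumr_ge0// => n _; rewrite mulr_ge0 ?test_intensity_ge0.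
elim: s => [|q s ih].
  rewrite big_nil esum1// => j _; congr EFin; apply: big1 => n _.
  by rewrite /test_intensity big_nil mul0r.
rewrite big_cons ih atomic_processE -ge0_esumZl//.
rewrite -esumD//.
apply: eq_esum => j _; rewrite -EFinM -EFinD; congr EFin.
rewrite [RHS](eq_bigr (fun n => (if q.1.1 == n then q.2%:num * \1_(sval q.1.2) (loc j w) else
  0) * (x n j w)%:R + test_intensity s n (loc j w) * (x n j w)%:R)); last first.
  by move=> n _; rewrite {1}/test_intensity big_cons mulrDl.
rewrite big_split/=; congr (_ + _).
rewrite (bigD1 q.1.1)//= eqxx big1 ?addr0; last first.
  by move=> n /negbTE; rewrite eq_sym => ->; rewrite mul0r.
by rewrite natrM indicE -mulrA [X in _ * X]mulrC.
Qed.

End atomic_processes.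

Section same_law_criterion.
Context {R : realType} {dPsi : measure_display} {Psi : measurableType dPsi}
  {N : nat} {d1 : measure_display} {T1 : measurableType d1}
  {d2 : measure_display} {T2 : measurableType d2}
  (P : probability T1 R) (Q : probability T2 R).
Context {J1 J2 : countType}.
Variables (loc1 : J1 -> T1 -> Psi) (x1 : 'I_N -> J1 -> T1 -> nat).
Variables (loc2 : J2 -> T2 -> Psi) (x2 : 'I_N -> J2 -> T2 -> nat).
Hypothesis mloc1 : forall j, measurable_fun setT (loc1 j).
Hypothesis mx1 : forall n j, measurable_fun setT (x1 n j).
Hypothesis mloc2 : forall j, measurable_fun setT (loc2 j).
Hypothesis mx2 : forall n j, measurable_fun setT (x2 n j).
Local Notation test := ('I_N * {A : set Psi | measurable A})%type.
Local Notation X := (@atomic_process R _ _ _ _ _ _ loc1 x1).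
Local Notation Y := (@atomic_process R _ _ _ _ _ _ loc2 x2).

(** Indicators combine into arbitrary linear combinations of the values X_n(A), whose
joint laws are then determined; finite intersections of such events form a
pi-system generating all events of tuples of measures. *)
Lemma laplace_functional_same_law :
  (forall sigma : 'I_N -> Psi -> R, (forall n, measurable_fun setT (sigma n)) ->
    (forall n p, 0 <= sigma n p) ->
    (\int[P]_w expN (\esum_(j in [set: J1])
       (\sum_n sigma n (loc1 j w) * (x1 n j w)%:R)%:E) =
     \int[Q]_w expN (\esum_(j in [set: J2])
       (\sum_n sigma n (loc2 j w) * (x2 n j w)%:R)%:E))%E) ->
  same_law P Q X Y.
Proof.
move=> L E mE.
pose cyl (r : seq (test * set (\bar R))) : set ('I_N -> {measure set Psi -> \bar R}) :=
  \big[setI/setT]_(q <- r) [set mu | q.2 (mu q.1.1 (sval q.1.2))].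
pose G := [set E | exists2 r : seq (test * set (\bar R)),
  (forall q, List.In q r -> measurable q.2) & E = cyl r].
have cylE (T : Type) (Z : 'I_N -> T -> {measure set Psi -> \bar R}) r :
    (fun w => Z ^~ w) @^-1` (cyl r) =
    \big[setI/setT]_(q <- r) ((fun w => Z q.1.1 w (sval q.1.2)) @^-1` q.2).
  rewrite /cyl; elim: r => [|q r ih]; first by rewrite !big_nil.
  by rewrite !big_cons preimage_setI ih.
have mcyl (d : measure_display) (T : measurableType d) (J : countType)
    (loc : J -> T -> Psi) (x : 'I_N -> J -> T -> nat) A :
    (forall j, measurable_fun setT (loc j)) ->
    (forall n j, measurable_fun setT (x n j)) -> G A ->
    measurable ((fun w => atomic_process (R := R) loc x ^~ w) @^-1` A).
  move=> ml mx [r mr ->]; rewrite cylE; elim: r mr => [|q r ih] mr.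
    by rewrite big_nil.
  rewrite big_cons; apply: measurableI; last by apply: ih => p pr; apply: mr; right.
  rewrite -[X in measurable X]setTI.
  apply: (measurable_atomic_process ml mx q.1.1 (svalP q.1.2)) => //.
  by apply: mr; left.
have PT : (P setT < +oo)%E by rewrite probability_setT ltry.
have PQT : P setT = Q setT by rewrite !probability_setT.
apply: (@pi_system_ext R _ G _ T1 _ T2 P Q (fun w => X ^~ w) (fun w => Y ^~ w)).
- move=> A B [r mr ->] [r' mr' ->]; exists (r ++ r').
    by move=> q /List.in_app_iff[]; [exact: mr|exact: mr'].
  by rewrite /cyl big_cat.
- by move=> A; exact: mcyl.
- by move=> A; exact: mcyl.
- exact: PT.
- exact: PQT.
- move=> A [r mr ->]; rewrite !cylE.
  apply: (@joint_laplace_determines_law R _ _ T1 T2 P Q test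
    (fun i w => X i.1 w (sval i.2)) (fun i w => Y i.1 w (sval i.2))).
  + by move=> i; exact: measurable_atomic_process (svalP i.2).
  + by move=> i; exact: measurable_atomic_process (svalP i.2).
  + by move=> i w; exact: atomic_process_ext_nat.
  + by move=> i w; exact: atomic_process_ext_nat.
  + move=> s; under eq_integral do rewrite sum_atomic_process.
    under [in RHS]eq_integral do rewrite sum_atomic_process.
    by apply: L => [n|n p]; [exact: measurable_test_intensity|exact: test_intensity_ge0].
- move: E mE; apply: smallest_sub; first exact: smallest_sigma_algebra.
  move=> A [n [C [B [mC mB ->]]]]; apply: sub_sigma_algebra.
  exists [:: ((n, exist _ C mC), B)]; first by move=> q [<-|].
  by rewrite /cyl big_seq1.
Qed.

End same_law_criterion.

(** * Almost sure distinctness of the locations *)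

Lemma ae_forall_countType {R : realType} d (T : measurableType d)
    (mu : {measure set T -> \bar R}) (I : countType) (A : I -> T -> Prop) :
  (forall i, {ae mu, forall w, A i w}) -> {ae mu, forall w, forall i, A i w}.
Proof.
move=> Ai; have : {ae mu, forall w, forall n, oapp (A ^~ w) True (pickle_inv n)}.
  apply: ae_foralln => n; case: (pickle_inv n) => [i|] /=; first exact: Ai.
  exact: aeW.
apply: filterS => w Aw i; have := Aw (choice.pickle i).
by rewrite pickleK_inv.
Qed.

Section distinct_locations.
Context {R : realType} {dPsi : measure_display} {Psi : measurableType dPsi}
  {d : measure_display} {T : measurableType d} (Q : probability T R)
  (G : probability Psi R).
Hypothesis measurable_diagonal : measurable [set p : Psi * Psi | p.1 = p.2].
Hypothesis diffuse : forall p : Psi, G [set p] = 0%E.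

(** The joint law is the product of [G] with itself, and the sections of the diagonal
are singletons. *)
Lemma independent_diffuse_neq (f g : T -> Psi) :
  measurable_fun setT f -> measurable_fun setT g ->
  (forall A, measurable A -> Q (f @^-1` A) = G A) ->
  (forall A, measurable A -> Q (g @^-1` A) = G A) ->
  (forall A B, measurable A -> measurable B ->
     Q (f @^-1` A `&` g @^-1` B) = Q (f @^-1` A) * Q (g @^-1` B))%E ->
  {ae Q, forall w, f w <> g w}.
Proof.
move=> mf mg fG gG fgI.
have mfg : measurable_fun setT (fun w => (f w, g w)) by exact: measurable_fun_pair.
pose m' := measure_function_pushforward__canonical__measure_function_Measure Q mfg.
have E := @product_measure_unique _ _ Psi Psi R G G m' _ _ measurable_diagonal.
exists [set w | f w = g w]; split.
- by rewrite -[X in measurable X]setTI; exact: (mfg measurableT _ measurable_diagonal).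
- have <- : m' [set p : Psi * Psi | p.1 = p.2] = Q [set w | f w = g w] by [].
  rewrite -E; last first.
    by move=> A B mA mB; apply: (etrans (fgI A B mA mB)); rewrite fG// gG.
  rewrite /product_measure1 integral0_eq// => p _ /=.
  rewrite (_ : xsection _ _ = [set p])//.
  by apply/seteqP; split => q; rewrite /xsection/= inE/= => ->.
- by move=> w /= /contrapT.
Qed.

End distinct_locations.

Section distinct_labels.
Context {R : realType} {dPsi : measure_display} {Psi : measurableType dPsi}
  {N K : nat} {dO : measure_display} {O : measurableType dO}
  (Q : probability O R) (psifix : 'I_K -> Psi) (s : marginal_draws O Psi N K)
  (gam xi lam : R) (G : probability Psi R).
Hypothesis measurable_singleton : forall p : Psi, measurable [set p].
Hypothesis measurable_diagonal : measurable [set p : Psi * Psi | p.1 = p.2].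
Hypothesis diffuse : forall p : Psi, G [set p] = 0%E.
Hypothesis psifix_inj : injective psifix.
Hypothesis Y_step_two : step_two Q s gam xi lam G.
Local Notation label := ('I_K + 'I_N * nat * nat)%type.

Lemma ae_distinct_locations :
  {ae Q, forall w, forall i i' : label, i != i' ->
    label_loc psifix s i w <> label_loc psifix s i' w}.
Proof.
have [_ locG ind] := Y_step_two.
have fix_new k q : {ae Q, forall w, psifix k <> new_loc s q.1.1 q.1.2 q.2 w}.
  exists (new_loc s q.1.1 q.1.2 q.2 @^-1` [set psifix k]); split.
  - by rewrite -[X in measurable X]setTI; exact: measurable_funPT.
  - by rewrite locG.
  - by move=> w /= /contrapT ->.
suff : {ae Q, forall w, forall q : label * label, q.1 != q.2 ->
    label_loc psifix s q.1 w <> label_loc psifix s q.2 w}.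
  by apply: filterS => w H i i'; exact: (H (i, i')).
apply: ae_forall_countType => -[[k|[[n x] j]] [k'|[[n' x'] j']]] /=.
- by apply: aeW => w kk' /psifix_inj kE; rewrite kE eqxx in kk'.
- by apply: filterS (fix_new k (n', x', j')) => w H _.
- by apply: filterS (fix_new k' (n, x, j)) => w H _ /esym.
- have [_|ne] := eqVneq (inr (n, x, j) : label) (inr (n', x', j')); first exact: aeW.
  have : {ae Q, forall w, new_loc s n x j w <> new_loc s n' x' j' w}.
    apply: (independent_diffuse_neq measurable_diagonal diffuse) => //.
    - by move=> A mA; exact: locG.
    - by move=> A mA; exact: locG.
    move=> A B mA mB.
    pose E (i : ('I_N * nat + 'I_N * nat * nat)%type) : set O :=
      if i == inr (n, x, j) then new_loc s n x j @^-1` A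
      else new_loc s n' x' j' @^-1` B.
    have ne' : (inr (n', x', j') == inr (n, x, j) :> ('I_N * nat + 'I_N * nat * nat)) = false.
      by apply/negbTE; apply: contraNneq ne => -[-> -> ->].
    have := @mutually_independent_seq R _ _ Q _ _ [:: inr (n, x, j); inr (n', x', j')] E ind.
    rewrite !big_cons !big_nil /E eqxx ne' setIT mulr1 EFinM !fineK ?fin_num_measure//.
    + apply => [|i]; first by rewrite /= inE eq_sym ne'.
      rewrite !inE => /orP[/eqP ->|/eqP ->].
        by rewrite eqxx; exists A => //; rewrite setTI.
      by rewrite ne'; exists B => //; rewrite setTI.
    + by rewrite -[X in measurable X]setTI; exact: measurable_funPT.
    + by rewrite -[X in measurable X]setTI; exact: measurable_funPT.
  by apply: filterS => w H _.
Qed.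

Let Y := constructed_process (R := R) psifix s.

Lemma constructed_process_distinct w :
  (forall i i' : label, i != i' -> label_loc psifix s i w <> label_loc psifix s i' w) ->
  forall (n : 'I_N) (p : Psi) (W : nat),
    (forall i : label, label_loc psifix s i w = p -> label_weight s n i w = W) ->
    (W <> 0%N -> exists i : label, label_loc psifix s i w = p) ->
  Y n w [set p] = W%:R%:E.
Proof.
move=> dist n p W hW hex.
have [W0|W0] := eqVneq W 0%N.
  rewrite W0 /Y /constructed_process; apply: esum1 => i _; rewrite /= diracE.
  have [/set_mem/= ip|] := boolP (label_loc psifix s i w \in [set p]).
    by rewrite hW// W0 mul0e.
  by rewrite mule0.
have [i ip] := hex (elimN eqP W0).
rewrite /Y /constructed_process /= /atomic_measure (esumID [set i])//; last first.
  by move=> j _; rewrite mule_ge0.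
rewrite setTI esum_set1 ?mule_ge0// esum1 ?adde0.
  by rewrite diracE mem_set//= mule1 hW.
move=> j [_ /= /eqP ji]; rewrite diracE memNset ?mule0//= => jp.
by apply: (dist j i ji); rewrite jp ip.
Qed.

(** With distinct locations, the mass at a location is the weight of its only label,
and a label of round n has weight 0 at the rounds before n. *)
Lemma new_atoms_ae :
  {ae Q, forall w,
    (forall (n m : 'I_N) (y j : nat), (m < n)%N -> (j < new_count s n y w)%N ->
       ~ atom_locations (Y m w) (new_loc s n y j w)) /\
    (forall (n : 'I_N) (i : atom_label), is_label s i w ->
       Y n w [set label_loc psifix s i w] = (label_weight s n i w)%:R%:E)}.
Proof.
apply: filterS ae_distinct_locations => w dist.
have val n (i : label) : Y n w [set label_loc psifix s i w] = (label_weight s n i w)%:R%:E.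
  apply: constructed_process_distinct => // [i' ii'|_]; last by exists i.
  by have [->//|/dist] := eqVneq i' i.
split=> [n m y j mn _|n i _]; last exact: val.
rewrite /atom_locations/= (val m (inr (n, y, j))) /label_weight /existing/=.
have -> : (n < m)%N = false by apply/negbTE; rewrite -leqNgt ltnW.
have -> : (n == m) = false by rewrite -val_eqE/= gtn_eqF.
by rewrite !andbF eqxx.
Qed.

End distinct_labels.

(** * Equality of the laws *)

Lemma measurable_atom_loc {R : realType} {dPsi : measure_display}
    {Psi : measurableType dPsi} {K : nat} {dOmega : measure_display}
    {Omega : measurableType dOmega} (P : probability Omega R)
    (psifix : 'I_K -> Psi) (a : crm_atoms Omega Psi R K) (gam xi lam : R)
    (G : probability Psi R) (xifix lamfix : 'I_K -> R) :
  is_gamma_process P a gam xi lam G xifix lamfix ->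
  forall j, measurable_fun setT (atom_loc psifix a j).
Proof.
move=> [_ _ [mpt _ _ _] _] [k|k]; first exact: measurable_cst.
exact: measurableT_comp measurable_snd (mpt k).
Qed.

Lemma measurable_label_loc {dPsi : measure_display}
    {Psi : measurableType dPsi} {N K : nat} {dO : measure_display}
    {O : measurableType dO} (psifix : 'I_K -> Psi) (s : marginal_draws O Psi N K) i :
  measurable_fun setT (label_loc psifix s i).
Proof.
case: i => [k|[[m x] j]]; first exact: measurable_cst.
exact: measurable_funPT.
Qed.

Lemma esum_counts_by_atom {R : realType} (N : nat) (J : choiceType)
    (a : 'I_N -> J -> R) : (forall n j, 0 <= a n j) ->
  \esum_(q in [set: 'I_N * J]) (a q.1 q.2)%:E =
  \esum_(j in [set: J]) (\sum_n a n j)%:E.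
Proof.
move=> a0; rewrite (@esum_pair R _ _ (fun n j => (a n j)%:E)).
  rewrite esum_exchange; last by move=> n j; rewrite lee_fin.
  apply: eq_esum => j _; rewrite esum_finType ?sumEFin// => n.
  by rewrite lee_fin.
by move=> n j; rewrite lee_fin.
Qed.

Theorem corollary6p4 (R : realType)
    (dPsi : measure_display) (Psi : measurableType dPsi)
    (measurable_singleton : forall p : Psi, measurable [set p])
    (N K : nat)
    (gam xi lam : R) (gam_gt0 : 0 < gam) (xi_gt : -2 < xi) (xi_le : xi <= -1)
    (lam_gt0 : 0 < lam)
    (G : probability Psi R) (diffuse : forall p : Psi, G [set p] = 0%E)
    (psifix : 'I_K -> Psi) (psifix_inj : injective psifix)
    (xifix lamfix : 'I_K -> R)
    (xifix_gt : forall k, -1 < xifix k) (lamfix_gt0 : forall k, 0 < lamfix k)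
    (dOmega : measure_display) (Omega : measurableType dOmega)
    (P : probability Omega R)
    (Theta : Omega -> {measure set Psi -> \bar R})
    (a : crm_atoms Omega Psi R K)
    (ThetaE : Theta = crm psifix a)
    (Theta_gamma : is_gamma_process P a gam xi lam G xifix lamfix)
    (X : 'I_N -> Omega -> {measure set Psi -> \bar R})
    (x : 'I_N -> 'I_K + nat -> {mfun Omega >-> nat})
    (XE : X = likelihood_process psifix a x)
    (X_poisson : poisson_likelihood P a x)
    (dOmega' : measure_display) (Omega' : measurableType dOmega')
    (Q : probability Omega' R)
    (s : marginal_draws Omega' Psi N K)
    (Y : 'I_N -> Omega' -> {measure set Psi -> \bar R})
    (YE : Y = constructed_process psifix s)
    (Y_step_one : step_one Q s xi lam xifix lamfix)
    (Y_step_two : step_two Q s gam xi lam G) :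
  same_law P Q X Y /\
  (measurable [set p : Psi * Psi | p.1 = p.2] ->
    {ae Q, forall w,
      (forall (n m : 'I_N) (y j : nat),
         (m < n)%N -> (j < new_count s n y w)%N ->
         ~ atom_locations (Y m w) (new_loc s n y j w)) /\
      (forall (n : 'I_N) (i : atom_label), is_label s i w ->
         Y n w [set label_loc psifix s i w] = (label_weight s n i w)%:R%:E)}).
Proof.
split; last by move=> mdiag; rewrite YE; exact (new_atoms_ae measurable_singleton mdiag diffuse
  psifix_inj Y_step_two).
rewrite XE YE.
apply: (@laplace_functional_same_law R _ Psi N _ Omega _ Omega' P Q
  ('I_K + nat)%type ('I_K + 'I_N * nat * nat)%type
  (atom_loc psifix a) (fun n j w => x n j w)
  (label_loc psifix s) (fun n i w => label_weight s n i w)).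
- exact: measurable_atom_loc Theta_gamma.
- by move=> n j; exact: measurable_funPT.
- exact: measurable_label_loc.
- by move=> n i; exact: measurable_label_weight.
move=> sigma msigma sigma0.
rewrite (marginal_laplace psifix gam_gt0 xi_gt lam_gt0 xifix_gt lamfix_gt0
  Y_step_one Y_step_two msigma sigma0).
rewrite new_atom_exponentE//.
under eq_bigr do
  rewrite (fixed_label_laplace psifix xi_gt lam_gt0 xifix_gt lamfix_gt0 sigma0).
rewrite -(gamma_process_laplace psifix gam_gt0 xifix_gt Theta_gamma); last 2 first.
- exact: measurable_thinned_rate.
- exact: thinned_rate_ge0.
rewrite -(laplace_counts_given_atoms psifix Theta_gamma X_poisson msigma sigma0).
apply: eq_integral => w _; congr expN.
rewrite (@esum_counts_by_atom R N _ (fun n j => sigma n (atom_loc psifix a j w) * (x n j w)%:R))//.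
by move=> n j; rewrite mulr_ge0.
Qed.
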